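(* Let $\nu$ be a symmetric Lévy measure on $\mathbb{R}^d\setminus\{0\}$, let $\mathcal{L}=\mathcal{L}_\nu$, and let $T\in(0,\infty)$. Assume that $\mathcal{L}_\nu$ has an associated heat kernel $P$ such that: (1) $P_t\in C(\mathbb{R}^d)$ and $P_t>0$ for all $t>0$; (2) there is a constant $C$ such that $\int_{\{|y|\ge1\}}P_1(x-y)\,d\nu(y)\le CP_1(x)$ for all $x\in\mathbb{R}^d$; (3) for all $0<\varepsilon<\tau$ there is a constant $C_{\varepsilon,\tau}>1$ such that $C_{\varepsilon,\tau}^{-1}P_t(x)\le P_s(x)\le C_{\varepsilon,\tau}P_t(x)$ for all $x\in\mathbb{R}^d$ and $t,s\in[\varepsilon,\tau]$; (4) there is a constant $C>0$ such that $P_1(z)\le CP_1(x)$ for all $x\in\mathbb{R}^d$ and $z\in B_1(x)$. Let $\mu_0$ be a Radon measure on $\mathbb{R}^d$. Suppose that $u_1$ and $u_2$ both belong to $L^1_{\rm loc}([0,T);L^1_{P_1})$ and that, for $u=u_1$ and for $u=u_2$, $$\int_0^T\int_{\mathbb{R}^d}u(x,t)\big(\partial_t\tilde\theta(x,t)-\mathcal{L}\tilde\theta(x,t)\big)\,dx\,dt=-\int_{\mathbb{R}^d}\tilde\theta(x,0)\,d\mu_0(x)\quad\text{for all }\tilde\theta\in C_c^\infty(\mathbb{R}^d\times[0,T)).$$ Then $u_1=u_2$ a.e. in $\mathbb{R}^d\times(0,T)$.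
   Context: Symmetric Lévy measure: a nonnegative Radon measure $\nu$ on $\mathbb{R}^d\setminus\{0\}$ with $\nu(B)=\nu(-B)$ for all Borel $B$ and $\int\min\{1,|y|^2\}\,d\nu(y)<\infty$. Operator (acting in the $x$ variable): $\mathcal{L}_\nu u(x)=\int_{\mathbb{R}^d}\Big(u(x)-\frac{u(x+y)+u(x-y)}2\Big)d\nu(y)$. Heat kernel: with $m(\xi)=\int_{\mathbb{R}^d}(1-\cos\langle\xi,y\rangle)\,d\nu(y)$, for each $t>0$ let $p_t$ be the law at time $t$ of the Lévy process with characteristic exponent $m$, i.e. the probability measure with $\int e^{i\langle\xi,x\rangle}p_t(dx)=e^{-tm(\xi)}$. $\mathcal{L}_\nu$ has an associated heat kernel $P(x,t)=P_t(x)$ if $p_t(dx)=P_t(x)\,dx$ with $P_t\in L^1(\mathbb{R}^d)$ for all $t>0$. $L^1_{P_1}=\{v\in L^1_{\rm loc}(\mathbb{R}^d):\int_{\mathbb{R}^d}|v|P_1\,dx<\infty\}$; $u\in L^1_{\rm loc}([0,T);L^1_{P_1})$ means $\int_0^{T'}\int_{\mathbb{R}^d}|u(x,t)|P_1(x)\,dx\,dt<\infty$ for all $T'\in(0,T)$. Radon measures $\mu_0$ may be signed (elements of the dual of $C_c(\mathbb{R}^d)$). $B_1(x)$ is the unit ball centered at $x$. $C_c^\infty(\mathbb{R}^d\times[0,T))$ denotes smooth functions (up to $t=0$) with compact support in $\mathbb{R}^d\times[0,T)$. *)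

(* Defs.v *)
From HB Require Import structures.
From mathcomp Require Import all_boot all_order all_algebra.
From mathcomp Require Import all_classical all_reals all_analysis.
From mathcomp Require Import measurable_realfun.
From mathcomp.real_closed Require Import complex.

Set Implicit Arguments.
Unset Strict Implicit.
Unset Printing Implicit Defensive.

Import Order.TTheory GRing.Theory Num.Theory numFieldNormedType.Exports.

Local Open Scope classical_set_scope.
Local Open Scope ring_scope.

Section borel.
Context {R : realType} {m n : nat}.

HB.instance Definition _ := @isMeasurable.Build
  (sigma_display (@open 'M[R]_(m, n))) 'M[R]_(m, n)
  <<s @open 'M[R]_(m, n) >> (@sigma_algebra0 _ setT _) (@sigma_algebraC _ _)
  (@sigma_algebra_bigcup _ setT _).

End borel.

Lemma open_measurable_mx (R : realType) m n (U : set 'M[R]_(m, n)) :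
  open U -> measurable U.
Proof. exact: sub_sigma_algebra. Qed.

Lemma measurable_coord (R : realType) m n i j :
  measurable_fun setT (fun A : 'M[R]_(m, n) => A i j).
Proof.
apply: (measurability _ (RGenOpens.measurableE R)) => _ [_ [a [b ->] <-]].
rewrite setTI; apply: open_measurable_mx; apply: open_comp.
  by move=> x _; exact: coord_continuous.
exact: interval_open.
Qed.

Section measurable_rV.
Context d (T : measurableType d) (R : realType) (n : nat).

(* An open set is a countable union of rational boxes. *)
Lemma measurable_fun_rV (f : T -> 'rV[R]_n) :
  (forall i, measurable_fun setT (fun x => f x ord0 i)) -> measurable_fun setT f.
Proof.
move=> mf; apply: (@measurability _ _ _ _ _ _ (@open 'rV[R]_n)) => //.
move=> _ [U oU <-]; rewrite setTI.
pose box (q : 'rV[rat]_n * 'rV[rat]_n) : set 'rV[R]_n :=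
  \bigcap_(i in [set: 'I_n])
    [set v | v ord0 i \in `]ratr (q.1 ord0 i), ratr (q.2 ord0 i)[].
have mbox q : measurable (f @^-1` box q).
  rewrite preimage_bigcap; apply: fin_bigcap_measurable => // i _.
  have := mf i measurableT `]ratr (q.1 ord0 i), ratr (q.2 ord0 i)[%classic.
  by rewrite setTI; apply; exact: measurable_itv.
have -> : f @^-1` U = \bigcup_k
    (if unpickle k is Some q then [set x | box q `<=` U /\ box q (f x)]
     else set0).
  apply/seteqP; split => [x Ux|x [k _]]; last first.
    by case: unpickle => // q [qU] /qU.
  have /nbhs_ballP[e /= e0 eU] : nbhs (f x) U by exact: open_nbhs_nbhs.
  have lo i : {q : rat | ratr q \in `](f x ord0 i - e), (f x ord0 i)[}.
    by apply/cid/rat_in_itvoo; rewrite ltrBlDr ltrDl.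
  have hi i : {q : rat | ratr q \in `](f x ord0 i), (f x ord0 i + e)[}.
    by apply/cid/rat_in_itvoo; rewrite ltrDl.
  pose q := (\row_i sval (lo i), \row_i sval (hi i)).
  exists (pickle q) => //; rewrite pickleK; split => [v qv|i _ /=].
    apply: eU; split => // i j; rewrite (ord1 i) /ball/= ltr_distlC.
    have := qv j I; rewrite /= !mxE in_itv/=.
    case: (lo j) => a /=; case: (hi j) => b /=; rewrite !in_itv/=.
    move=> /andP[_ bh] /andP[al _] /andP[av vb].
    by rewrite (lt_trans al av) (lt_trans vb bh).
  rewrite !mxE in_itv/=; case: (lo i) => a /=; case: (hi i) => b /=.
  by rewrite !in_itv/= => /andP[-> _] /andP[_ ->].
apply: bigcupT_measurable => k; case: unpickle => // q.
have [qU|qU] := pselect (box q `<=` U).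
  rewrite (_ : [set _ | _] = f @^-1` box q) //.
  by apply/seteqP; split => x //= [].
rewrite (_ : [set _ | _] = set0) //.
by apply/seteqP; split => x //= [].
Qed.

End measurable_rV.

Lemma product_sigma_finite d1 d2 (T1 : measurableType d1)
    (T2 : measurableType d2) (R : realType)
    (m1 : {sigma_finite_measure set T1 -> \bar R})
    (m2 : {sigma_finite_measure set T2 -> \bar R}) :
  sigma_finite setT (m1 \x m2)%E.
Proof.
have /sigma_finiteP[F [TF ndF Foo]] := sigma_finiteT m1.
have /sigma_finiteP[G [TG ndG Goo]] := sigma_finiteT m2.
exists (fun n => F n `*` G n).
  rewrite -setXTT TF TG predeqE => -[x y]; split.
    move=> [/= [n _ Fnx] [k _ Gky]]; exists (maxn n k) => //; split.
    - by move: x Fnx; exact/subsetPset/ndF/leq_maxl.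
    - by move: y Gky; exact/subsetPset/ndG/leq_maxr.
  by move=> [n _ []/= ? ?]; split; exists n.
move=> k; have [? ?] := Foo k; have [? ?] := Goo k.
split; first exact: measurableX.
by rewrite product_measure1E// lte_mul_pinfty// ge0_fin_numE.
Qed.

Section lebesgue.
Context {R : realType}.

Definition consrv n (z : measurableTypeR R * 'rV[R]_n) : 'rV[R]_n.+1 :=
  row_mx (\row_(_ < 1) (z.1 : R)) z.2.

Lemma measurable_consrv n : measurable_fun setT (@consrv n).
Proof.
apply: measurable_fun_rV => i.
have [j ->|j ->] := @split_ordP 1 n i.
  rewrite (_ : (fun z => _) = fst); first exact: measurable_fst.
  by apply/funext => z; rewrite [LHS](@row_mxEl _ 1 1 n) mxE.
rewrite (_ : (fun z => _) = (fun v : 'rV[R]_n => v ord0 j) \o snd).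
  by apply: measurableT_comp; [exact: measurable_coord|exact: measurable_snd].
by apply/funext => z; rewrite [LHS](@row_mxEr _ 1 1 n).
Qed.

Section step.
Variables (n : nat) (mu : {sigma_finite_measure set 'rV[R]_n -> \bar R}).
Local Open Scope ereal_scope.

Definition lebesgue_step : set 'rV[R]_n.+1 -> \bar R :=
  pushforward (@lebesgue_measure R \x mu) (@consrv n).

Let step0 : lebesgue_step set0 = 0.
Proof. by rewrite /lebesgue_step /pushforward preimage_set0 measure0. Qed.

Let step_ge0 A : 0 <= lebesgue_step A.
Proof. by rewrite /lebesgue_step /pushforward; exact: measure_ge0. Qed.

Let mconsrv A : measurable A -> measurable (@consrv n @^-1` A).
Proof. by move=> mA; rewrite -[X in measurable X]setTI; exact: measurable_consrv. Qed.

Let step_sigma_additive : semi_sigma_additive lebesgue_step.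
Proof.
move=> F mF tF mUF; rewrite /lebesgue_step /pushforward preimage_bigcup.
apply: measure_semi_sigma_additive; first by move=> k; exact: mconsrv.
- apply/trivIsetP => /= i j _ _ ij; rewrite -preimage_setI.
  by move/trivIsetP : tF => /(_ _ _ _ _ ij) ->//; rewrite preimage_set0.
- by rewrite -preimage_bigcup; exact: mconsrv.
Qed.

HB.instance Definition _ := isMeasure.Build _ _ _ lebesgue_step
  step0 step_ge0 step_sigma_additive.

Let unconsrv (v : 'rV[R]_n.+1) : measurableTypeR R * 'rV[R]_n :=
  (v ord0 ord0, @rsubmx _ 1 1 n v).

Let consrvK : cancel (@consrv n) unconsrv.
Proof.
move=> [x v]; rewrite /unconsrv/consrv row_mxKr; congr pair.
have -> : ord0 = lshift n (ord0 : 'I_1) by exact: ord_inj.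
by rewrite [LHS](@row_mxEl _ 1 1 n) mxE.
Qed.

Let measurable_unconsrv : measurable_fun setT unconsrv.
Proof.
apply/measurable_fun_pairP; split; first exact: measurable_coord.
apply: measurable_fun_rV => i.
rewrite (_ : (fun v => _) = (fun v : 'rV[R]_n.+1 => v ord0 (rshift 1 i))).
  exact: measurable_coord.
by apply/funext => v; rewrite /= mxE.
Qed.

Let step_sigma_finite : sigma_finite setT lebesgue_step.
Proof.
have [F FT mF] := product_sigma_finite (@lebesgue_measure R) mu.
exists (fun k => unconsrv @^-1` F k).
  by rewrite -preimage_bigcup -FT preimage_setT.
move=> k; have [mFk Fk] := mF k; split.
  by rewrite -[X in measurable X]setTI; exact: measurable_unconsrv.
rewrite /lebesgue_step /pushforward -comp_preimage.
by rewrite (_ : _ \o _ = id) //; apply/funext => z; exact: consrvK.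
Qed.

HB.instance Definition _ := Measure_isSigmaFinite.Build _ _ _ lebesgue_step
  step_sigma_finite.

End step.

(* Lebesgue measure on R^n, as the n-fold product of the one-dimensional one. *)
Fixpoint lebesgue_rV n : {sigma_finite_measure set 'rV[R]_n -> \bar R} :=
  if n is n'.+1 then lebesgue_step (lebesgue_rV n') else dirac (0 : 'rV[R]_0).

Lemma lebesgue_rV_box n (a b : 'rV[R]_n) : (forall i, a ord0 i <= b ord0 i) ->
  lebesgue_rV n [set v | forall i, v ord0 i \in `[a ord0 i, b ord0 i]] =
  (\prod_(i < n) (b ord0 i - a ord0 i))%:E.
Proof.
elim: n a b => [a b _|n IHn a b ab].
  by rewrite big_ord0 /= diracE mem_set// => -[].
pose a' := @rsubmx _ 1 1 n a; pose b' := @rsubmx _ 1 1 n b.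
pose box : set 'rV[R]_n := [set v | forall i, v ord0 i \in `[a' ord0 i, b' ord0 i]].
have l0 : lift ord0 =1 @rshift 1 n by move=> i; exact: ord_inj.
rewrite /= /lebesgue_step /pushforward.
rewrite (_ : _ @^-1` _ = `[a ord0 ord0, b ord0 ord0] `*` box); last first.
  apply/seteqP; split => [[x v] xv|[x v] [/= hx hv] i].
    split => [|i] /=.
      have := xv ord0; have -> : ord0 = lshift n (ord0 : 'I_1) by exact: ord_inj.
      by rewrite /consrv (@row_mxEl _ 1 1 n) mxE.
    have := xv (rshift 1 i).
    by rewrite /consrv (@row_mxEr _ 1 1 n) !mxE.
  have [j ->|j ->] := @split_ordP 1 n i.
    rewrite (@row_mxEl _ 1 1 n) mxE (ord1 j).
    by have <- : ord0 = lshift n (ord0 : 'I_1) by exact: ord_inj.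
  by have := hv j; rewrite (@row_mxEr _ 1 1 n) !mxE.
rewrite product_measure1E ?IHn.
- rewrite [X in (X * _)%E]lebesgue_measure_itv/= lte_fin big_ord_recl EFinM.
  congr (_ * _)%E; last by congr EFin; apply: eq_bigr => i _; rewrite !mxE l0.
  have := ab ord0; rewrite le_eqVlt => /predU1P[->|->//].
  by rewrite ltxx subrr.
- by move=> i; rewrite !mxE.
- exact: measurable_itv.
- have -> : box = \bigcap_(i in [set: 'I_n])
      ((fun v : 'rV[R]_n => v ord0 i) @^-1` `[a' ord0 i, b' ord0 i]).
    by apply/seteqP; split => v vb i => [_|]; [exact: vb|exact: (vb i I)].
  apply: fin_bigcap_measurable => // i _.
  rewrite -[X in measurable X]setTI; apply: measurable_coord => //.
Qed.

End lebesgue.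

Section levy.
Context {R : realType} {d : nat}.
Implicit Types (x y xi : 'rV[R]_d) (nu : {measure set 'rV[R]_d -> \bar R}).

Definition dotrv x y : R := \sum_(i < d) x ord0 i * y ord0 i.

(* The library norm on row vectors is the sup norm. *)
Definition enorm x : R := Num.sqrt (dotrv x x).

(* A measure on R^d \ {0} is encoded as a measure on R^d for which {0} is null.
   Locally finite Borel measures on R^d \ {0} are automatically regular. *)
Definition symmetric_levy_measure nu : Prop :=
  [/\ nu [set 0] = 0%E,
      forall K : set 'rV[R]_d, compact K -> ~ K 0 -> (nu K < +oo)%E,
      forall B : set 'rV[R]_d, measurable B -> nu [set - y | y in B] = nu B &
      (\int[nu]_y (Num.min 1 (enorm y ^+ 2))%:E < +oo)%E].

Definition levy_op nu (u : 'rV[R]_d -> R) x : R :=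
  \int[nu]_y (u x - (u (x + y) + u (x - y)) / 2).

Definition levy_symbol nu xi : R := \int[nu]_y (1 - cos (dotrv xi y)).

Definition charfun (p : probability 'rV[R]_d R) xi : R[i] :=
  Complex (\int[p]_x cos (dotrv xi x)) (\int[p]_x sin (dotrv xi x)).

Definition levy_law nu (t : R) (p : probability 'rV[R]_d R) : Prop :=
  forall xi, charfun p xi = (expR (- t * levy_symbol nu xi))%:C%C.

Definition heat_kernel nu (P : R -> 'rV[R]_d -> R) : Prop :=
  forall t, 0 < t ->
    (lebesgue_rV d).-integrable setT (EFin \o P t) /\
    exists2 p : probability 'rV[R]_d R, levy_law nu t p &
      forall A, measurable A -> p A = (\int[lebesgue_rV d]_(x in A) (P t x)%:E)%E.

Definition Cc (f : 'rV[R]_d -> R) : Prop :=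
  continuous f /\
  exists2 K : set 'rV[R]_d, compact K & forall x, ~ K x -> f x = 0.

(* Signed Radon measures as continuous linear functionals on C_c(R^d) with its
   inductive limit topology; values outside C_c(R^d) are irrelevant. *)
Definition signed_radon_measure (L : ('rV[R]_d -> R) -> R) : Prop :=
  (forall (a : R) f g, Cc f -> Cc g ->
     L (fun x => a * f x + g x) = a * L f + L g) /\
  (forall K : set 'rV[R]_d, compact K -> exists C : R,
     forall f M, Cc f -> (forall x, ~ K x -> f x = 0) ->
       (forall x, `|f x| <= M) -> `|L f| <= C * M).

Definition iter_derive (vs : seq ('rV[R]_d * R)) (f : 'rV[R]_d * R -> R) :=
  foldr (fun v g z => 'D_v g z) f vs.

Definition smooth (f : 'rV[R]_d * R -> R) : Prop :=
  forall vs, continuous (iter_derive vs f) /\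
             forall z v, derivable (iter_derive vs f) z v.

(* C_c^oo(R^d x [0,T)): only the restriction to t >= 0 is used, and smoothness up
   to t = 0 is the existence of a smooth extension to R^d x R. *)
Definition test_fun (T : R) (theta : 'rV[R]_d * R -> R) : Prop :=
  smooth theta /\
  exists2 K : set ('rV[R]_d * R),
    compact K /\ K `<=` [set z | 0 <= z.2 < T] &
    forall z, 0 <= z.2 -> ~ K z -> theta z = 0.

(* Elements of Lebesgue spaces are given by Borel representatives. *)
Definition L1loc_L1 (T : R) (w : 'rV[R]_d -> R) (u : 'rV[R]_d * R -> R) : Prop :=
  measurable_fun (setT `*` `]0, T[) u /\
  forall T', 0 < T' < T ->
    (\int[lebesgue_measure]_(t in `]0%R, T'[)
       \int[lebesgue_rV d]_x (`|u (x, t)| * w x)%:E < +oo)%E.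

Definition very_weak_solution nu (T : R) (mu0 : ('rV[R]_d -> R) -> R)
    (u : 'rV[R]_d * R -> R) : Prop :=
  forall theta, test_fun T theta ->
    \int[lebesgue_measure]_(t in `]0, T[) \int[lebesgue_rV d]_x
      (u (x, t) * (derive1 (fun s => theta (x, s)) t
                   - levy_op nu (fun y => theta (y, t)) x))
    = - mu0 (fun x => theta (x, 0)).

End levy.

(* Main.v *)
Require Import Defs.
From HB Require Import structures.
From mathcomp Require Import all_boot all_order all_algebra.
From mathcomp Require Import all_classical all_reals all_analysis.
From mathcomp Require Import measurable_realfun ring lra.
Set Implicit Arguments.
Unset Strict Implicit.
Unset Printing Implicit Defensive.
Import Order.TTheory GRing.Theory Num.Theory numFieldNormedType.Exports.
Local Open Scope classical_set_scope.
Local Open Scope ring_scope.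

(** Write [p] for the heat kernel at time 1 and [w] for the difference of the
    two solutions, which solves the equation with zero initial datum.  The idea
    is to mollify [w] and to run a Gronwall argument on an L^1 norm whose weight
    is a regularisation of [p].

    The weight is [Phi x = \int p z * k (x - z) dz], where [k] is a smooth bump.
    The Harnack inequality for [p] makes [Phi] comparable with [p] and, since
    the derivatives fall on [k], bounds the second differences
    [Phi (x + y) + Phi (x - y) - 2 Phi x] by [C |y|^2 Phi x] for [|y| < 1]
    ([weight_c11]).  Together with the bound on the jumps of length at least 1,
    this says that [- L_delta Phi <= C Phi], where [L_delta] only keeps the
    jumps of length at least [delta] and [C] does not depend on [delta]
    ([weight_jump]).

    Let [W t x] be the integral of [w (z, s) * k (x - z) * eta (t - s)], with
    [k] and [eta] smooth bumps and [eta] supported in positive times.  For each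
    [x] and each [t < T] the function [k (x - z) * eta (t - s)] of [(z, s)] is
    an admissible test function, and it tells that [W] solves the equation
    classically: [W (t + s) = W t - s * L (W t) + O(s^2)] in the weighted norm
    ([weak_slab]).  If [nu] has mass [M] on the jumps of length at least
    [delta] and [s * M <= 1], then [W - s * L_delta W] at [x] is
    [(1 - s * M) * W x] plus [s] times the integral of the values [W (x + y)]:
    all coefficients are nonnegative, so the triangle inequality loses nothing,
    and moving the jumps onto the weight gives
    [\int |W - s * L_delta W| Phi <= (1 + s * C) \int |W| Phi] ([euler_jump]).
    The jumps shorter than [delta] act on [k], which has bounded second
    differences, and contribute [s] times a quantity that vanishes with [delta]
    ([euler_levy]).  Adding up [n] Euler steps, and letting first [n] grow and
    then [delta] vanish, gives [\int |W t| Phi = 0] ([time_stepping]).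

    So [W] vanishes identically.  When the bumps increase to indicators of
    intervals this becomes the vanishing of the integrals of [w] over all boxes,
    whence [w = 0] almost everywhere ([ae_eq0_of_oboxes]). *)

(** * An algebra of smooth functions *)

Section flat.
Context {R : realType}.
Implicit Types (p : {poly R}) (s u : R).

Lemma exprn_le_expR n : exists2 C, 0 < C & forall u, 0 <= u -> u ^+ n <= C * expR u.
Proof.
exists (n`!%:R + 1) => [|u u0]; first by rewrite ltr_wpDl.
case: n => [|n].
  rewrite expr0 fact0; have := expR_ge1Dx u; lra.
have := expR_ge1Dxn n u0.
have f0 : 0 < (n.+1)`!%:R :> R by rewrite ltr0n fact_gt0.
move=> h; have : u ^+ n.+1 / (n.+1)`!%:R <= expR u by lra.
rewrite ler_pdivrMr// => /le_trans; apply.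
by rewrite mulrC ler_wpM2r ?expR_ge0// lerDl.
Qed.

Lemma horner_le_expR p : exists2 C, 0 < C & forall u, 0 <= u -> `|p.[u]| <= C * expR u.
Proof.
have /choice[C hC] n : exists c : R, 0 < c /\ forall u, 0 <= u -> u ^+ n <= c * expR u.
  by have [c] := exprn_le_expR n; exists c.
exists (\sum_(i < size p) `|p`_i| * C i + 1) => [|u u0].
  by rewrite ltr_wpDl// sumr_ge0// => i _; rewrite mulr_ge0// ltW// (hC i).1.
rewrite horner_coef mulrDl mul1r ler_wpDr ?expR_ge0//.
rewrite (le_trans (ler_norm_sum _ _ _))// mulr_suml ler_sum// => i _.
rewrite normrM -mulrA ler_wpM2l// ger0_norm ?exprn_ge0//; exact: (hC i).2.
Qed.

(** For [p = 1] this is the standard smooth function which is flat at 0.  The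
    polynomial factor in [1 / s] makes the family stable under derivation. *)
Definition flat p s : R := if 0 < s then p.[s^-1] * expR (- s^-1) else 0.

Lemma flat_le0 p s : s <= 0 -> flat p s = 0.
Proof. by rewrite /flat leNgt; case: ifP. Qed.

Lemma flat_bounded p : exists C, forall s, `|flat p s| <= C.
Proof.
have [C C0 hC] := horner_le_expR p; exists C => s.
rewrite /flat; case: ifPn => [s0|_]; last by rewrite normr0 ltW.
rewrite normrM (ger0_norm (expR_ge0 _)) expRN ler_pdivrMr ?expR_gt0//.
by rewrite hC// invr_ge0 ltW.
Qed.

(** At 0 the difference quotient of [flat p] is [h * flat ('X^2 * p) h], and
    the second factor is bounded. *)
Lemma is_derive_flat p s : is_derive s 1 (flat p) (flat ('X^2 * (p - p^`())) s).
Proof.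
have [s0|s0|->] := ltgtP s 0.
- rewrite flat_le0 ?ltW//; apply: (@near_eq_is_derive _ _ _ (cst 0)).
  by near=> t; rewrite flat_le0// ltW//; near: t; exact: lt_nbhsl.
- have sn0 : s != 0 by rewrite gt_eqF.
  have dV : is_derive s 1 (fun t : R => t^-1) (- s ^- 2).
    by apply: is_derive_eq; first exact: is_deriveV; rewrite scaler1.
  have d1 : is_derive s 1 (fun t : R => p.[t^-1]) (p^`().[s^-1] * (- s ^- 2)).
    exact: (@is_derive1_comp _ (horner p) (fun t => t^-1)).
  have d2 : is_derive s 1 (fun t : R => expR (- t^-1)) (expR (- s^-1) * (- (- s ^- 2))).
    exact: (@is_derive1_comp _ expR (fun t => - t^-1)).
  have d3 : is_derive s 1 (fun t : R => p.[t^-1] * expR (- t^-1))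
      (flat ('X^2 * (p - p^`())) s).
    have d12 := is_deriveM d1 d2.
    have -> : (fun t : R => p.[t^-1] * expR (- t^-1)) =
      (fun t : R => p.[t^-1]) * (fun t : R => expR (- t^-1)) by [].
    move: d12; set a := (X in is_derive s 1 _ X); suff -> : a = flat ('X^2 * (p - p^`())) s by [].
    rewrite /a.
    rewrite /flat s0 hornerM hornerXn hornerD hornerN /GRing.scale/= exprVn.
    by ring.
  apply: near_eq_is_derive d3.
  by near=> t; rewrite /flat ifT//; near: t; exact: lt_nbhsr.
rewrite flat_le0//; have [C hC] := flat_bounded ('X^2 * p).
have C0 : 0 <= C by exact: le_trans (hC 0).
suff h : (h^-1 *: ((flat p \o shift 0) (h *: 1) - flat p 0) @[h --> 0^'] --> (0 : R)).
  split; [by apply/cvg_ex; exists 0 | exact/cvg_lim].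
apply/cvgrPdist_le => e e0; near=> h; rewrite sub0r normrN /= addr0.
rewrite [flat p 0]flat_le0// subr0 /GRing.scale/= mulr1.
have [h0|h0] := leP h 0; first by rewrite flat_le0// mulr0 normr0 ltW.
have -> : h^-1 * flat p h = h * flat ('X^2 * p) h.
  rewrite /flat h0 hornerM hornerXn; field.
  by rewrite gt_eqF.
rewrite normrM (le_trans (ler_wpM2l _ (hC h)))//.
rewrite (le_trans (ler_wpM2l _ (_ : C <= C + 1)))// ?lerDl//.
rewrite -ler_pdivlMr ?ltr_wpDl//.
rewrite ltW//; near: h; apply: dnbhs0_lt.
by rewrite divr_gt0// ltr_wpDl.
Unshelve. all: by end_near. Qed.

Lemma continuous_flat p : continuous (flat p).
Proof.
move=> s; have := is_derive_flat p s => -[h _].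
by apply: differentiable_continuous; apply/derivable1_diffP.
Qed.

(** Test functions on [R^d x R] and mollifiers on [R] are both products of
    [flat 1] composed with affine functions.  The linear part of [l] is kept as a
    plain function [c] with the identity that directional derivatives use. *)
Inductive flat_alg (V : normedModType R) : (V -> R) -> Prop :=
| flat_alg_comp p (l c : V -> R) : continuous l ->
    (forall z v (h : R), l (h *: v + z) = h * c v + l z) ->
    flat_alg (flat p \o l)
| flat_alg_cst (a : R) : flat_alg (cst a)
| flat_alg_add f g : flat_alg f -> flat_alg g -> flat_alg (f + g)
| flat_alg_mul f g : flat_alg f -> flat_alg g -> flat_alg (f * g).

Section theory.
Variable V : normedModType R.

Lemma flat_alg_continuous (f : V -> R) : flat_alg f -> continuous f.
Proof.
elim=> [p l c cl _|a|g1 g2 _ h1 _ h2|g1 g2 _ h1 _ h2] z.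
- by apply: continuous_comp; [exact: cl|exact: continuous_flat].
- exact: cvg_cst.
- by apply: cvgD; [exact: h1|exact: h2].
- by apply: cvgM; [exact: h1|exact: h2].
Qed.

Lemma flat_alg_bounded (f : V -> R) : flat_alg f -> exists C, forall z, `|f z| <= C.
Proof.
elim=> [p l c cl _|a|g1 g2 _ [C1 h1] _ [C2 h2]|g1 g2 _ [C1 h1] _ [C2 h2]].
- by have [C hC] := flat_bounded p; exists C => z; exact: hC.
- by exists `|a|.
- by exists (C1 + C2) => z; rewrite (le_trans (ler_normD _ _))// lerD.
- by exists (C1 * C2) => z; rewrite normrM ler_pM.
Qed.

Lemma flat_alg_derive (f : V -> R) v : flat_alg f ->
  exists2 g, flat_alg g & forall z, is_derive z v f (g z).
Proof.
elim=> [p l c cl hl|a|f1 f2 F1 [g1 G1 h1] F2 [g2 G2 h2]|f1 f2 F1 [g1 G1 h1] F2 [g2 G2 h2]].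
- exists ((flat ('X^2 * (p - p^`())) \o l) * cst (c v)).
    by apply: flat_alg_mul; [exact: (flat_alg_comp _ cl hl)|exact: flat_alg_cst].
  move=> z.
  have E : (fun h : R => h^-1 *: ((flat p \o l \o shift z) (h *: v) - (flat p \o l) z)) =
    (fun h : R => h^-1 *: ((flat p \o shift (l z)) (h *: (c v : R)) - flat p (l z))).
    by apply/funext => h /=; rewrite hl.
  have [d1 d2] := is_derive_flat p (l z).
  have df : differentiable (flat p) (l z) by apply/derivable1_diffP.
  split.
    by rewrite /derivable E; exact: (@diff_derivable _ _ _ _ (l z) (c v)).
  rewrite /derive E -/(derive (flat p) (l z) (c v)) deriveE//.
  rewrite diff1E// derive1E d2 /=.
  by rewrite /GRing.scale/= mulrC.
- by exists (cst 0); [exact: flat_alg_cst|move=> z; exact: is_derive_cst].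
- by exists (g1 + g2) => [|z]; [exact: flat_alg_add|exact: is_deriveD].
- exists (f1 * g2 + f2 * g1) => [|z]; last exact: is_deriveM.
  by apply: flat_alg_add; exact: flat_alg_mul.
Qed.

Lemma flat_alg_prod I (r : seq I) (F : I -> V -> R) :
  (forall i, flat_alg (F i)) -> flat_alg (fun z => \prod_(i <- r) F i z).
Proof.
move=> hF; elim: r => [|i r IH].
  by under eq_fun do rewrite big_nil; exact: flat_alg_cst.
by under eq_fun do rewrite big_cons; exact: flat_alg_mul.
Qed.

End theory.

Lemma flat_alg_smooth d (f : 'rV[R]_d * R -> R) :
  @flat_alg ('rV[R]_d * R)%type f -> smooth f.
Proof.
move=> hf vs.
suff : @flat_alg ('rV[R]_d * R)%type (iter_derive vs f).
  move=> h; split; first exact: flat_alg_continuous.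
  by move=> z v; have [g _ hg] := flat_alg_derive v h; have [] := hg z.
elim: vs => [//|v vs IH] /=; have [g Gg hg] := flat_alg_derive v IH.
rewrite (_ : (fun z => _) = g)//; apply/funext => z.
by have [_] := hg z.
Qed.

(** Both remainders come from the mean value theorem applied to [f] and to its
    derivative [g], the derivatives being bounded since they stay in the
    algebra. *)
Lemma flat_alg_taylor (f : R -> R) : @flat_alg R f ->
  exists2 g, @flat_alg R g & exists2 A, 0 <= A & forall s,
   [/\ is_derive s 1 f (g s), `|f s| <= A, `|g s| <= A,
   forall h, `|f (s + h) - f s| <= A * `|h| &
   forall h, `|f (s + h) - f s - h * g s| <= A * h ^+ 2].
Proof.
have mvt (a b : R -> R) (C : R) : (forall s, is_derive s 1 a (b s)) ->
    (forall s, `|b s| <= C) -> forall s h, exists2 c, `|c - s| <= `|h| & a (s + h) - a s = b c * h.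
  move=> dab bC s h.
  have cont : continuous a.
    by move=> x; apply: differentiable_continuous; apply/derivable1_diffP; have [] := dab x.
  have [h0|h0] := leP 0 h.
    have [||c] := @MVT_segment _ a b s (s + h); rewrite ?lerDl//.
      exact: continuous_subspaceT.
    rewrite in_itv/= => /andP[c1 c2] E; exists c; last by rewrite E; ring.
    by rewrite !ger0_norm ?subr_ge0// lerBlDl.
  have [||c] := @MVT_segment _ a b (s + h) s; rewrite ?gerDl ?ltW//.
    exact: continuous_subspaceT.
  rewrite in_itv/= => /andP[c1 c2] E; exists c; last by rewrite -opprB E; ring.
  by rewrite (ltr0_norm h0) ler_norml; apply/andP; split; lra.
move=> hf; have [g Gg dg] := flat_alg_derive (1 : R) hf.
have [g' Gg' dg'] := flat_alg_derive (1 : R) Gg.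
have [A0 h0] := flat_alg_bounded hf; have [A1 h1] := flat_alg_bounded Gg.
have [A2 h2] := flat_alg_bounded Gg'.
have B0 : 0 <= A0 by exact: le_trans (h0 0).
have B1 : 0 <= A1 by exact: le_trans (h1 0).
have B2 : 0 <= A2 by exact: le_trans (h2 0).
exists g => //; exists (A0 + A1 + A2); first lra.
move=> s; split => //.
- by rewrite (le_trans (h0 s))//; lra.
- by rewrite (le_trans (h1 s))//; lra.
- move=> h; have [c _ ->] := mvt _ _ _ dg h1 s h.
  by rewrite normrM ler_wpM2r// (le_trans (h1 c))//; lra.
move=> h; have [c ch ->] := mvt _ _ _ dg h1 s h.
rewrite -(mulrC (g s)) -mulrBl normrM.
have [c' _] := mvt _ _ _ dg' h2 s (c - s).
rewrite (_ : s + (c - s) = c); last by ring.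
move=> ->; rewrite normrM -mulrA.
rewrite -(real_normK (num_real h)) expr2; apply: ler_pM => //.
- by rewrite (le_trans (h2 c'))//; lra.
- by rewrite ler_wpM2r.
Qed.

End flat.

(** * Bumps, the Euclidean norm and kernels with bounded second differences *)

Lemma cvg_prodr (R : realType) T (F : set_system T) {FF : Filter F} I (r : seq I)
    (f : I -> T -> R) (l : I -> R) :
  (forall i, f i x @[x --> F] --> l i) ->
  \prod_(i <- r) f i x @[x --> F] --> \prod_(i <- r) l i.
Proof.
move=> h; elim: r => [|i r IH].
  by under eq_fun do rewrite big_nil; rewrite big_nil; exact: cvg_cst.
by under eq_fun do rewrite big_cons; rewrite big_cons; exact: cvgM.
Qed.

Section bump.
Context {R : realType}.

(** As [c] grows, [bump c a b] increases to the indicator of the open interval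
    from [a] to [b]. *)
Definition bump (c a b s : R) : R :=
  flat 1 (c * (s - a)) * flat 1 (c * (b - s)).

Lemma flat1_ge0 (s : R) : 0 <= flat 1 s.
Proof. by rewrite /flat; case: ifP => // _; rewrite hornerC mul1r expR_ge0. Qed.

Lemma flat1_le1 (s : R) : flat 1 s <= 1.
Proof.
rewrite /flat; case: ifP => // s0; rewrite hornerC mul1r expRN invf_le1 ?expR_gt0//.
by rewrite -[X in X <= _]expR0 ler_expR invr_ge0 ltW.
Qed.

Lemma flat1_gt0 (s : R) : 0 < s -> 0 < flat 1 s.
Proof. by move=> s0; rewrite /flat s0 hornerC mul1r expR_gt0. Qed.

Lemma flat1_homo (s t : R) : s <= t -> flat 1 s <= flat 1 t.
Proof.
move=> st; have [s0|s0] := leP s 0; first by rewrite flat_le0// flat1_ge0.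
rewrite /flat s0 (lt_le_trans s0 st) !hornerC !mul1r ler_expR lerN2.
by rewrite lef_pV2// posrE (lt_le_trans s0 st).
Qed.

Lemma bump_ge0 c a b s : 0 <= bump c a b s.
Proof. by rewrite mulr_ge0// flat1_ge0. Qed.

Lemma bump_le1 c a b s : bump c a b s <= 1.
Proof. by rewrite mulr_ile1 ?flat1_ge0 ?flat1_le1. Qed.

Lemma bump_out c a b s : 0 <= c -> s <= a \/ b <= s -> bump c a b s = 0.
Proof.
move=> c0 [sa|bs]; rewrite /bump.
  by rewrite flat_le0 ?mul0r// mulr_ge0_le0// subr_le0.
by rewrite [X in _ * X]flat_le0 ?mulr0// mulr_ge0_le0// subr_le0.
Qed.

Lemma bump_reflect c a b x s : bump c a b (x - s) = bump c (x - b) (x - a) s.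
Proof.
by rewrite /bump mulrC; congr (flat 1 (c * _) * flat 1 (c * _)); ring.
Qed.

Lemma flat1_cvg (s : R) : flat 1 (n.+1%:R * s) @[n --> \oo] --> ((0 < s)%R%:R : R).
Proof.
have [s0|s0] := leP s 0.
  under eq_fun do rewrite flat_le0 ?mulr_ge0_le0//.
  exact: cvg_cst.
have -> : (fun n : nat => flat 1 (n.+1%:R * s)) = (fun n : nat => expR (- (n.+1%:R^-1 * s^-1))).
  by apply/funext => n; rewrite /flat mulr_gt0// hornerC mul1r invfM.
have : - (n.+1%:R^-1 * s^-1) @[n --> \oo] --> - (0 * s^-1).
  apply: cvgN; apply: cvgM; [exact: cvg_harmonic|exact: cvg_cst].
rewrite mul0r oppr0 => h.
have := @cvg_comp _ _ _ _ _ _ _ _ h (@continuous_expR R 0).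
by rewrite expR0.
Qed.

Lemma bump_cvg a b s : bump n.+1%:R a b s @[n --> \oo] --> ((a < s < b)%R%:R : R).
Proof.
have -> : (a < s < b)%R%:R = (0 < s - a)%R%:R * (0 < b - s)%R%:R :> R.
  by rewrite !subr_gt0; case: (a < s); case: (s < b); rewrite ?mulr1 ?mulr0.
by apply: cvgM; exact: flat1_cvg.
Qed.

Lemma flat_alg_bump (V : normedModType R) c a b (l m : V -> R) :
  continuous l -> (forall z v (h : R), l (h *: v + z) = h * m v + l z) ->
  flat_alg (bump c a b \o l).
Proof.
move=> cl hl; apply: (@flat_alg_mul _ _ (flat 1 \o (fun z => c * (l z - a)))
  (flat 1 \o (fun z => c * (b - l z)))).
  apply: (@flat_alg_comp _ _ _ _ (fun v => c * m v)).
    move=> z; apply: cvgM; first exact: cvg_cst.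
    by apply: cvgB; [exact: cl|exact: cvg_cst].
  by move=> z v h; rewrite hl; ring.
apply: (@flat_alg_comp _ _ _ _ (fun v => - (c * m v))).
  move=> z; apply: cvgM; first exact: cvg_cst.
  by apply: cvgB; [exact: cvg_cst|exact: cl].
by move=> z v h; rewrite hl; ring.
Qed.

Lemma flat_alg_bump1 c a b : @flat_alg R R (bump c a b).
Proof.
apply: (@flat_alg_bump R c a b idfun idfun) => [z|z v h] //=.
Qed.

End bump.

Section enorm.
Context {R : realType} {d : nat}.
Implicit Types x y v : 'rV[R]_d.

Lemma dotrv_ge0 y : 0 <= dotrv y y.
Proof. by apply: sumr_ge0 => i _; rewrite -expr2 sqr_ge0. Qed.

Lemma enorm_ge0 y : 0 <= enorm y.
Proof. exact: sqrtr_ge0. Qed.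

Lemma enorm_sqr y : enorm y ^+ 2 = dotrv y y.
Proof. by rewrite sqr_sqrtr// dotrv_ge0. Qed.

Lemma coord_le_enorm y i : `|y ord0 i| <= enorm y.
Proof.
rewrite -(@ler_pXn2r _ 2)// ?nnegrE ?enorm_ge0// enorm_sqr real_normK ?num_real//.
rewrite /dotrv (bigD1 i)//= -expr2 lerDl sumr_ge0// => j _.
by rewrite -expr2 sqr_ge0.
Qed.

Lemma enormZ (c : R) y : enorm (c *: y) = `|c| * enorm y.
Proof.
rewrite /enorm /dotrv -(sqrtr_sqr c) -sqrtrM ?sqr_ge0//; congr Num.sqrt.
by rewrite mulr_sumr; apply: eq_bigr => i _; rewrite !mxE; ring.
Qed.

Lemma enormN y : enorm (- y) = enorm y.
Proof. by rewrite -scaleN1r enormZ normrN1 mul1r. Qed.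

Lemma enorm_le_coord y (r : R) : (forall i, `|y ord0 i| <= r) ->
  enorm y <= Num.sqrt (d%:R * r ^+ 2).
Proof.
move=> yr; rewrite ler_wsqrtr// /dotrv.
rewrite (le_trans (ler_sum _ (_ : forall i, true -> _ <= r ^+ 2)))//.
  by move=> i _; rewrite -expr2 -real_normK ?num_real// lerXn2r// nnegrE// (le_trans _ (yr i)).
by rewrite sumr_const card_ord mulr_natl.
Qed.

Lemma measurable_enorm : measurable_fun setT (@enorm R d).
Proof.
apply: measurableT_comp; first by apply: continuous_measurable_fun; exact: sqrt_continuous.
rewrite /dotrv; apply: measurable_sum => i.
by apply: measurable_funM; exact: measurable_coord.
Qed.

Lemma measurable_enorm_lt (r : R) : measurable [set y : 'rV[R]_d | enorm y < r].
Proof.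
rewrite -[X in measurable X]setTI.
have := measurable_enorm measurableT (measurable_itv `]-oo, r[).
by rewrite /preimage /= !setTI; congr measurable; apply/funext => y/=; rewrite in_itv.
Qed.

Lemma measurable_enorm_ge (r : R) : measurable [set y : 'rV[R]_d | r <= enorm y].
Proof.
rewrite (_ : [set _ | _] = ~` [set y : 'rV[R]_d | enorm y < r]).
  by apply: measurableC; exact: measurable_enorm_lt.
by apply/seteqP; split=> y/=; rewrite leNgt => /negP.
Qed.

Lemma continuous_measurable_rV (f : 'rV[R]_d -> R) : continuous f -> measurable_fun setT f.
Proof.
move=> cf; apply: (measurability _ (RGenOpens.measurableE R)) => _ [_ [a [b ->] <-]].
rewrite setTI; apply: open_measurable_mx; apply: open_comp.
  by move=> x _; exact: cf.
exact: interval_open.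
Qed.

End enorm.

Section kernel.
Context {R : realType} {d : nat}.
Implicit Types (x y v a b : 'rV[R]_d) (K : 'rV[R]_d -> R).

(** Differences replace derivatives: this class is stable under products without
    any multivariate calculus, and second differences are what the operator
    integrates. *)
Definition c11 (A : R) K := forall v y,
  [/\ `|K v| <= A, `|K (v + y) - K v| <= A * enorm y &
      `|K (v + y) + K (v - y) - 2 * K v| <= A * enorm y ^+ 2].

Lemma c11M A B K1 K2 : c11 A K1 -> c11 B K2 -> c11 (4 * A * B) (K1 \* K2).
Proof.
move=> h1 h2 v y; have [b1 l1 s1] := h1 v y; have [b2 l2 s2] := h2 v y.
have [_ l1' _] := h1 v (- y); have [_ l2' _] := h2 v (- y).
rewrite enormN in l1' l2'; have y0 := enorm_ge0 y.
have [b1' _ _] := h1 (v + y) y.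
have A0 : 0 <= A by exact: le_trans b1.
have B0 : 0 <= B by exact: le_trans b2.
have AB0 : 0 <= A * B by rewrite mulr_ge0.
split => /=.
- by rewrite normrM (le_trans (ler_pM _ _ b1 b2))//; lra.
- have -> : K1 (v + y) * K2 (v + y) - K1 v * K2 v =
    K1 (v + y) * (K2 (v + y) - K2 v) + (K1 (v + y) - K1 v) * K2 v by ring.
  rewrite (le_trans (ler_normD _ _))// !normrM.
  rewrite (le_trans (lerD (ler_pM _ _ b1' l2) (ler_pM _ _ l1 b2)))//.
  have := mulr_ge0 AB0 y0; lra.
(* Leibniz rule for second differences. *)
have -> : K1 (v + y) * K2 (v + y) + K1 (v - y) * K2 (v - y) - 2 * (K1 v * K2 v) =
   K1 v * (K2 (v + y) + K2 (v - y) - 2 * K2 v) + (K1 (v + y) + K1 (v - y) - 2 * K1 v) * K2 v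
   + (K1 (v + y) - K1 v) * (K2 (v + y) - K2 v) + (K1 (v - y) - K1 v) * (K2 (v - y) - K2 v) by ring.
rewrite (le_trans (ler_normD _ _))// (le_trans (lerD (ler_normD _ _) (lexx _)))//.
rewrite (le_trans (lerD (lerD (ler_normD _ _) (lexx _)) (lexx _)))// !normrM.
rewrite (le_trans (lerD (lerD (lerD (ler_pM _ _ b1 s2) (ler_pM _ _ s1 b2)) (ler_pM _ _ l1 l2)) (ler_pM _ _ l1' l2')))//.
by rewrite le_eqVlt; apply/orP; left; apply/eqP; ring.
Qed.

Lemma c11_coord (f : R -> R) i : @flat_alg R R f ->
  exists A, c11 A (fun v => f (v ord0 i)).
Proof.
move=> /flat_alg_taylor[g _ [A A0 h]]; exists (2 * A) => v y.
have [_ b _ l t] := h (v ord0 i); have yi := coord_le_enorm y i.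
have y0 := enorm_ge0 y.
rewrite !mxE; split; first lra.
  rewrite (le_trans (l _))//.
  by rewrite (le_trans (ler_wpM2l A0 yi))// ler_wpM2r//; lra.
have -> : f (v ord0 i + y ord0 i) + f (v ord0 i + - y ord0 i) - 2 * f (v ord0 i) =
  (f (v ord0 i + y ord0 i) - f (v ord0 i) - y ord0 i * g (v ord0 i)) +
  (f (v ord0 i + - y ord0 i) - f (v ord0 i) - - y ord0 i * g (v ord0 i)) by ring.
have := t (- y ord0 i); rewrite sqrrN => t'.
rewrite (le_trans (ler_normD _ _))// (le_trans (lerD (t _) t'))//.
rewrite -mulr2n -(mulr_natl (A * _)) mulrA ler_wpM2l ?mulr_ge0//.
by rewrite -real_normK ?num_real// lerXn2r// nnegrE.
Qed.

Lemma c11_prod I (r : seq I) (F : I -> 'rV[R]_d -> R) :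
  (forall i, exists A, c11 A (F i)) -> exists A, c11 A (fun v => \prod_(i <- r) F i v).
Proof.
move=> hF; elim: r => [|i r [A hA]].
  exists 1 => v y; rewrite !big_nil normr1 subrr normr0.
  rewrite (_ : 1 + 1 - 2 * 1 = 0 :> R) ?normr0 ?mul1r ?enorm_ge0 ?sqr_ge0//; ring.
have [B hB] := hF i; exists (4 * B * A).
rewrite (_ : (fun v => _) = (F i) \* (fun v => \prod_(i <- r) F i v)).
  exact: c11M.
by apply/funext => v; rewrite big_cons.
Qed.

Definition box (r : R) (v : 'rV[R]_d) : Prop := forall i, `|v ord0 i| <= r.

(** A kernel is a mollifier on which the operator is well defined: the bound on
    second differences absorbs the singularity of the jump measure at 0. *)
Record kernel (r A : R) K : Prop := Kernel {
  kernel_cont : continuous K;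
  kernel_out : forall v, ~ box r v -> K v = 0;
  kernel_c11 : c11 A K }.

Definition bumpV (c : R) (a b v : 'rV[R]_d) : R :=
  \prod_(i < d) bump c (a ord0 i) (b ord0 i) (v ord0 i).

Lemma bumpV_ge0 c a b v : 0 <= bumpV c a b v.
Proof. by apply: prodr_ge0 => i _; exact: bump_ge0. Qed.

Lemma bumpV_le1 c a b v : bumpV c a b v <= 1.
Proof. by apply: prodr_ile1 => i _; rewrite bump_ge0 bump_le1. Qed.

Lemma bumpV_out c a b v : 0 <= c ->
  ~ (forall i, a ord0 i < v ord0 i < b ord0 i) -> bumpV c a b v = 0.
Proof.
move=> c0 /existsNP[i /negP]; rewrite negb_and -!leNgt => /orP h.
by rewrite /bumpV (bigD1 i)//= bump_out ?mul0r.
Qed.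

Lemma bumpV_reflect c a b x v : bumpV c a b (x - v) = bumpV c (x - b) (x - a) v.
Proof. by apply: eq_bigr => i _; rewrite !mxE bump_reflect. Qed.

Lemma bumpV_kernel c a b : 0 <= c -> exists r A, kernel r A (bumpV c a b).
Proof.
move=> c0.
have [A hA] : exists A, c11 A (bumpV c a b).
  apply: (@c11_prod _ _ (fun i v => bump c (a ord0 i) (b ord0 i) (v ord0 i))) => i.
  exact: c11_coord (flat_alg_bump1 _ _ _).
exists (\sum_i (`|a ord0 i| + `|b ord0 i|)), A; split => //.
- move=> v; apply: (@cvg_prodr R _ (nbhs v) _ _ _
    (fun i (v : 'rV[R]_d) => bump c (a ord0 i) (b ord0 i) (v ord0 i))
    (fun i => bump c (a ord0 i) (b ord0 i) (v ord0 i))) => i.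
  apply: (@continuous_comp _ _ _ (fun v : 'rV[R]_d => v ord0 i)).
    exact: coord_continuous.
  exact: (flat_alg_continuous (flat_alg_bump1 _ _ _)).
- move=> v nv; apply: bumpV_out => // hv; apply: nv => i.
  rewrite (bigD1 i)//= ler_wpDr//; first by rewrite sumr_ge0// => j _; rewrite addr_ge0.
  have /andP[h1 h2] := hv i.
  rewrite ler_norml; apply/andP; split.
    have := ler_norm (- a ord0 i); rewrite normrN; have := normr_ge0 (b ord0 i); lra.
  have := ler_norm (b ord0 i); have := normr_ge0 (a ord0 i); lra.
Qed.

Lemma bumpV_cvg a b v :
  bumpV n.+1%:R a b v @[n --> \oo] --> ([forall i, (a ord0 i < v ord0 i < b ord0 i)%R]%:R : R).
Proof.
have -> : [forall i, (a ord0 i < v ord0 i < b ord0 i)%R]%:R = \prod_i (a ord0 i < v ord0 i < b ord0 i)%R%:R :> R.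
  case: forallP => [h|/existsNP[i /negP/negPf h]].
    by rewrite big1// => i _; rewrite h.
  by rewrite (bigD1 i)//= h mul0r.
apply: (@cvg_prodr R _ \oo _ _ _
  (fun i n => bump n.+1%:R (a ord0 i) (b ord0 i) (v ord0 i))) => i.
exact: bump_cvg.
Qed.

Lemma kernel_ge0 r A K : kernel r A K -> 0 <= A.
Proof. by move=> [_ _ /(_ 0 0)[+ _ _]]; exact: le_trans. Qed.

Lemma kernel_measurable r A K : kernel r A K -> measurable_fun setT K.
Proof. by move=> [+ _ _]; exact: continuous_measurable_rV. Qed.

End kernel.

(** * Integrals of real functions and translation invariance *)

Section real_integrands.
Context d (T : measurableType d) (R : realType).
Variable mu : {measure set T -> \bar R}.
Implicit Types f g : T -> R.
Local Open Scope ereal_scope.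

Lemma le_integral_EFin (D : set T) f g : measurable D ->
  measurable_fun D f -> measurable_fun D g ->
  (forall x, D x -> 0 <= f x <= g x)%R ->
  \int[mu]_(x in D) (f x)%:E <= \int[mu]_(x in D) (g x)%:E.
Proof.
move=> mD mf mg fg; apply: ge0_le_integral => //.
- by move=> x /fg/andP[]; rewrite lee_fin.
- exact/measurable_EFinP.
- exact/measurable_EFinP.
- by move=> x /fg/andP[]; rewrite lee_fin.
Qed.

Lemma integralZl_EFin_ge0 (D : set T) (k : R) f : measurable D -> (0 <= k)%R ->
  measurable_fun D f -> (forall x, D x -> 0 <= f x)%R ->
  \int[mu]_(x in D) (k * f x)%:E = k%:E * \int[mu]_(x in D) (f x)%:E.
Proof.
move=> mD k0 mf f0; under eq_integral do rewrite EFinM.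
rewrite ge0_integralZl_EFin//.
exact/measurable_EFinP.
Qed.

Lemma integralD_EFin_ge0 (D : set T) f g : measurable D ->
  measurable_fun D f -> measurable_fun D g ->
  (forall x, D x -> 0 <= f x)%R -> (forall x, D x -> 0 <= g x)%R ->
  \int[mu]_(x in D) (f x + g x)%:E =
  \int[mu]_(x in D) (f x)%:E + \int[mu]_(x in D) (g x)%:E.
Proof.
move=> mD mf mg f0 g0; under eq_integral do rewrite EFinD.
rewrite ge0_integralD//.
- exact/measurable_EFinP.
- exact/measurable_EFinP.
Qed.

Lemma integral_scale_indic (A : set T) (k : R) : measurable A -> (0 <= k)%R ->
  \int[mu]_x (k * \1_A x)%:E = k%:E * mu A.
Proof.
move=> mA k0; rewrite integralZl_EFin_ge0//.
by rewrite integral_indic// setIT.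
Qed.

Lemma integrableD_EFin f g : mu.-integrable setT (EFin \o f) ->
  mu.-integrable setT (EFin \o g) ->
  mu.-integrable setT (EFin \o (fun x => f x + g x)%R).
Proof.
move=> hf hg; rewrite (_ : _ \o _ = (EFin \o f) \+ (EFin \o g))//.
exact: integrableD.
Qed.

Lemma integrableZl_EFin (k : R) f : mu.-integrable setT (EFin \o f) ->
  mu.-integrable setT (EFin \o (fun x => k * f x)%R).
Proof.
move=> hf; rewrite (_ : _ \o _ = (fun x => k%:E * (EFin \o f) x))//.
exact: integrableZl.
Qed.

Lemma integrableB_EFin f g : mu.-integrable setT (EFin \o f) ->
  mu.-integrable setT (EFin \o g) ->
  mu.-integrable setT (EFin \o (fun x => f x - g x)%R).
Proof.
move=> hf hg; rewrite (_ : _ \o _ = (EFin \o f) \- (EFin \o g))//.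
exact: integrableB.
Qed.

Lemma le_integrable_EFin f g : measurable_fun setT f ->
  (forall x, `|f x| <= g x)%R -> mu.-integrable setT (EFin \o g) ->
  mu.-integrable setT (EFin \o f).
Proof.
move=> mf fg; apply: le_integrable => //; first exact/measurable_EFinP.
by move=> x _ /=; rewrite lee_fin (le_trans (fg x))// ler_norm.
Qed.

End real_integrands.

Section translation.
Context {R : realType}.

Lemma measurable_addrv d (T : measurableType d) n (f g : T -> 'rV[R]_n) :
  measurable_fun setT f -> measurable_fun setT g ->
  measurable_fun setT (fun x => f x + g x).
Proof.
move=> mf mg; apply: measurable_fun_rV => i.
under eq_fun do rewrite mxE.
apply: measurable_funD.
  exact: (measurableT_comp (measurable_coord ord0 i) mf).
exact: (measurableT_comp (measurable_coord ord0 i) mg).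
Qed.

Lemma measurable_opprv d (T : measurableType d) n (f : T -> 'rV[R]_n) :
  measurable_fun setT f -> measurable_fun setT (fun x => - f x).
Proof.
move=> mf; apply: measurable_fun_rV => i.
under eq_fun do rewrite mxE.
apply: measurableT_comp => //.
exact: (measurableT_comp (measurable_coord ord0 i) mf).
Qed.

Lemma measurable_subrv d (T : measurableType d) n (f g : T -> 'rV[R]_n) :
  measurable_fun setT f -> measurable_fun setT g ->
  measurable_fun setT (fun x => f x - g x).
Proof. by move=> mf mg; apply: measurable_addrv => //; exact: measurable_opprv. Qed.

Lemma lebesgue_measure_translation (a : R) (A : set R) : measurable A ->
  lebesgue_measure A =
  pushforward lebesgue_measure ((fun x => x + a) : _ -> measurableTypeR R) A.
Proof.
move=> mA; apply: lebesgue_measure_unique => //=.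
  by apply: measurable_funD => //; exact: measurable_cst.
move=> _ _ [[s t]] _ <-; rewrite /pushforward.
rewrite (_ : _ @^-1` _ = `]s - a, t - a]%classic).
  rewrite !lebesgue_measure_itv/= !lte_fin ltrD2r; case: ifP => // _.
  by rewrite -!EFinD; congr EFin; ring.
by apply/seteqP; split => x /=; rewrite !in_itv/= ltrBlDr lerBrDr.
Qed.

(** By induction on the dimension: a translation of the space acts on each factor
    of the product, and a product measure is determined by its rectangles. *)
Lemma lebesgue_rV_translation n (a : 'rV[R]_n) (A : set 'rV[R]_n) : measurable A ->
  lebesgue_rV n ((fun x => x + a) @^-1` A) = lebesgue_rV n A.
Proof.
elim: n a A => [|n IH] a A mA.
  congr (lebesgue_rV 0 _); apply/seteqP; split=> x/=; have -> : x + a = x => //;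
    by rewrite [a]thinmx0 addr0.
pose a' := @rsubmx _ 1 1 n a.
pose tau (z : measurableTypeR R * 'rV[R]_n) : measurableTypeR R * 'rV[R]_n :=
  (((z.1 : R) + a ord0 ord0)%R, z.2 + a').
have mtau : measurable_fun setT tau.
  apply/measurable_fun_pairP; split.
    by apply: measurable_funD; [exact: measurable_fst|exact: measurable_cst].
  by apply: measurable_addrv; [exact: measurable_snd|exact: measurable_cst].
have E z : consrv z + a = consrv (tau z).
  rewrite /consrv/tau/=.
  rewrite -{1}[a](@hsubmxK _ 1 1 n) [LHS](@add_row_mx _ 1 1 n); congr (@row_mx _ 1 1 n _ _).
  apply/rowP => i; rewrite !mxE; congr (_ + a _ _).
  by apply: ord_inj; rewrite /= (ord1 i).
have mA' : measurable (@consrv R n @^-1` A).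
  by rewrite -[X in measurable X]setTI; exact: measurable_consrv.
rewrite /= /lebesgue_step /pushforward.
rewrite (_ : _ @^-1` _ = tau @^-1` (@consrv R n @^-1` A)); last first.
  by apply/seteqP; split=> z /=; rewrite E.
symmetry; rewrite [LHS](@product_measure_unique _ _ _ _ R _ _
  (pushforward (@lebesgue_measure R \x lebesgue_rV n)%E tau))//=.
move=> B C mB mC; rewrite /pushforward.
rewrite (_ : tau @^-1` (B `*` C) =
  ((fun x : R => x + a ord0 ord0) @^-1` B) `*` ((fun x => x + a') @^-1` C)); last first.
  by [].
have m1 : measurable ((fun x : R => x + a ord0 ord0) @^-1` B).
  have mt : measurable_fun setT (fun x : R => x + a ord0 ord0) by exact: measurable_funD.
  by rewrite -[X in measurable X]setTI; exact: mt.
have m2 : measurable ((fun x => x + a') @^-1` C).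
  have mt : measurable_fun setT (fun x : 'rV[R]_n => x + a') by exact: measurable_addrv.
  by rewrite -[X in measurable X]setTI; exact: mt.
rewrite product_measure1E// IH//; congr (_ * _)%E.
by rewrite [RHS](lebesgue_measure_translation (a ord0 ord0)).
Qed.

Local Open Scope ereal_scope.

Lemma ge0_integral_translation n (a : 'rV[R]_n) (f : 'rV[R]_n -> \bar R) :
  measurable_fun setT f -> (forall x, 0 <= f x) ->
  \int[lebesgue_rV n]_x f (x + a)%R = \int[lebesgue_rV n]_x f x.
Proof.
move=> mf f0.
have mt : measurable_fun setT (fun x : 'rV[R]_n => (x + a)%R).
  exact: measurable_addrv.
rewrite -[LHS](@ge0_integral_pushforward _ _ _ _ _ _ mt _ setT f)//.
by apply: eq_measure_integral => //= A mA _; exact: lebesgue_rV_translation.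
Qed.

Lemma measurable_boxrv n (r : R) x : measurable [set z : 'rV[R]_n | box r (z - x)].
Proof.
rewrite (_ : [set _ | _] = \bigcap_(i in [set: 'I_n])
  ((fun v : 'rV[R]_n => (v ord0 i - x ord0 i)%R) @^-1` `[(- r)%R, r])).
  apply: fin_bigcap_measurable => // i _.
  rewrite -[X in measurable X]setTI; apply: measurable_funB => //.
  exact: measurable_coord.
apply/seteqP; split => [z zx i _|z zx i].
  by have := zx i; rewrite /= !mxE in_itv/= ler_norml.
by have := zx i I; rewrite /= !mxE in_itv/= ler_norml.
Qed.

Lemma lebesgue_rV_ball n (r : R) (x : 'rV[R]_n) : (0 <= r)%R ->
  lebesgue_rV n [set z | box r (z - x)] = ((2 * r) ^+ n)%:E.
Proof.
move=> r0.
have h i : ((x - const_mx r) ord0 i <= (x + const_mx r) ord0 i)%R.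
  by rewrite !mxE; lra.
have := lebesgue_rV_box h; set D := (X in lebesgue_rV n X).
have -> : D = [set z | box r (z - x)].
  apply/seteqP; split => z zx i; have := zx i; rewrite /= !mxE in_itv/= ler_norml.
    by move=> /andP[h1 h2]; apply/andP; split; lra.
  by move=> /andP[h1 h2]; apply/andP; split; lra.
move=> ->; congr EFin; rewrite -[X in (_ ^+ X)%R]card_ord -prodr_const.
by apply: eq_bigr => i _; rewrite !mxE; ring.
Qed.

End translation.

(** * The weight *)

(** The definition is locked: matching modulo conversion must not look for an
    integral inside the weight. *)
HB.lock Definition weight (R : realType) (d : nat) (p : 'rV[R]_d -> R)
    (x : 'rV[R]_d) : R :=
  \int[lebesgue_rV d]_z (p z * bumpV 1 (const_mx (-1)) (const_mx 1) (x - z)).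

Section weight.
Context {R : realType} {d : nat}.
Variable p : 'rV[R]_d -> R.
Hypothesis p_cont : continuous p.
Hypothesis p_gt0 : forall x, 0 < p x.
Hypothesis p_harnack : exists2 C : R, 0 < C & forall x z : 'rV[R]_d,
    enorm (z - x) < 1 -> p z <= C * p x.
Implicit Types (x y z v : 'rV[R]_d).
Local Notation leb := (lebesgue_rV d).

Lemma boxN r v : box r (- v) <-> box r v.
Proof.
have h w : box r w -> box r (- w) by move=> hw i; rewrite mxE normrN.
by split=> [/h|]; [rewrite opprK|exact: h].
Qed.

Lemma boxB r x z : box r (x - z) <-> box r (z - x).
Proof. by rewrite -boxN opprB. Qed.

Lemma box_le r s v : r <= s -> box r v -> box s v.
Proof. by move=> rs rv i; exact: le_trans (rv i) rs. Qed.

Lemma boxD r s v w : box r v -> box s w -> box (r + s) (v + w).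
Proof. by move=> rv sw i; rewrite mxE (le_trans (ler_normD _ _))// lerD. Qed.

Lemma box_enorm v : box (enorm v) v.
Proof. by move=> i; exact: coord_le_enorm. Qed.

(** A Harnack chain: cut the segment from [x] to [z] into [N + 1] pieces of
    length less than 1. *)
Lemma harnack_box (r : R) : exists2 C : R, 0 < C &
  forall x z, box r (z - x) -> p z <= C * p x.
Proof.
have [C C0 hC] := p_harnack.
have step k x v : enorm v < 1 -> p (x + k%:R *: v) <= C ^+ k * p x.
  move=> v1; elim: k => [|k IH]; first by rewrite scale0r addr0 mul1r.
  rewrite exprS -mulrA; apply: (le_trans (hC (x + k%:R *: v) _ _)).
    by rewrite opprD addrACA subrr add0r -scalerBl -natrB// subSnn scale1r.
  by rewrite ler_pM2l.
have [N hN] : exists N : nat, Num.sqrt (d%:R * r ^+ 2) < N.+1%:R :> R.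
  exists (Num.truncn (Num.sqrt (d%:R * r ^+ 2))).
  by rewrite truncnS_gt.
exists (C ^+ N.+1) => [|x z hz]; first by rewrite exprn_gt0.
have -> : z = x + N.+1%:R *: (N.+1%:R^-1 *: (z - x)).
  by rewrite scalerA divff ?pnatr_eq0// scale1r addrC subrK.
apply: step; rewrite enormZ ger0_norm// mulrC ltr_pdivrMr// mul1r.
by rewrite (le_lt_trans _ hN)// enorm_le_coord.
Qed.

Lemma p_measurable : measurable_fun setT p.
Proof. exact: continuous_measurable_rV. Qed.

(** The constant depends on [r] only, so the estimates on the weight and on its
    second differences are uniform in [x]. *)
Lemma integral_near (r : R) : 0 <= r ->
  exists2 C : R, 0 <= C & forall x (M : R) (g : 'rV[R]_d -> R),
  measurable_fun setT g -> (forall z, `|g z| <= M) ->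
  (forall z, ~ box r (z - x) -> g z = 0) ->
  leb.-integrable setT (EFin \o (fun z => p z * g z)) /\
  `|\int[leb]_z (p z * g z)| <= C * M * p x.
Proof.
move=> r0; have [C C0 hC] := harnack_box r.
exists (C * (2 * r) ^+ d) => [|x M g mg gM g0].
  by rewrite mulr_ge0 ?exprn_ge0 ?mulr_ge0// ltW.
have M0 : 0 <= M by exact: le_trans (gM 0).
pose D : set 'rV[R]_d := [set z | box r (z - x)].
have mD : measurable D by exact: measurable_boxrv.
have LD : leb D = ((2 * r) ^+ d)%:E by exact: lebesgue_rV_ball.
have mpg : measurable_fun setT (fun z => p z * g z).
  by apply: measurable_funM => //; exact: p_measurable.
have bnd z : `|p z * g z| <= (C * p x * M) * \1_D z.
  rewrite indicE; have [zD|zD] := boolP (z \in D); last first.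
    by rewrite g0 ?mulr0 ?normr0//; move/negP : zD; rewrite inE.
  rewrite mulr1 normrM ler_pM// gtr0_norm// hC//.
  by move: zD; rewrite inE.
have I2 : (\int[leb]_z `|(p z * g z)%:E| <= (C * (2 * r) ^+ d * M * p x)%:E)%E.
  have -> : (C * (2 * r) ^+ d * M * p x)%:E = (\int[leb]_z (((C * p x * M) * \1_D z)%:E))%E.
    rewrite integral_scale_indic ?mulr_ge0 ?(ltW C0) ?(ltW (p_gt0 _))//.
    transitivity ((C * p x * M)%:E * ((2 * r) ^+ d)%:E)%E.
      by rewrite -EFinM; congr EFin; ring.
    by congr (_ * _)%E; exact/esym/LD.
  apply: (@le_integral_EFin _ _ _ _ setT (fun z => `|p z * g z|)) => //.
  - by apply: measurableT_comp.
  - by apply: measurable_funM => //; exact: measurable_indic.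
  - by move=> z _; rewrite normr_ge0 bnd.
have int : leb.-integrable setT (EFin \o (fun z => p z * g z)).
  apply/integrableP; split; first exact/measurable_EFinP.
  exact: le_lt_trans I2 (ltry _).
split => //.
rewrite -lee_fin EFin_normr_Rintegral//.
by apply: le_trans I2; apply: le_abse_integral => //; exact/measurable_EFinP.
Qed.

Local Notation weight := (weight p).

Let K0 : 'rV[R]_d -> R := bumpV 1 (const_mx (-1)) (const_mx 1).

Let mK0 (c : 'rV[R]_d) : measurable_fun setT (fun z => K0 (c - z)).
Proof.
have [r [A hK]] := @bumpV_kernel R d 1 (const_mx (-1)) (const_mx 1) ler01.
by apply: measurableT_comp; [exact: kernel_measurable hK|exact: measurable_subrv].
Qed.

Let K0out v : ~ box 1 v -> K0 v = 0.
Proof.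
move=> hv; apply: bumpV_out => // h; apply: hv => i.
by have := h i; rewrite !mxE ler_norml => /andP[/ltW -> /ltW ->].
Qed.

Let K0out1 x z : ~ box 1 (z - x) -> K0 (x - z) = 0.
Proof. by move=> h; apply: K0out => /boxB. Qed.

Let K0b v : `|K0 v| <= 1.
Proof. by rewrite ger0_norm ?bumpV_ge0// bumpV_le1. Qed.

Lemma weight_integrable x : leb.-integrable setT (EFin \o (fun z => p z * K0 (x - z))).
Proof.
have [C _ h] := integral_near ler01.
by have [] := h x 1 (fun z => K0 (x - z)) (mK0 x) (fun z => K0b _) (@K0out1 x).
Qed.

Lemma EFin_weight x : (weight x)%:E = (\int[leb]_z (p z * K0 (x - z))%:E)%E.
Proof.
rewrite weight.unlock /Rintegral fineK//; apply: integrable_fin_num => //.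
exact: weight_integrable.
Qed.

Lemma weight_measurable : measurable_fun setT weight.
Proof.
apply/measurable_EFinP.
rewrite (_ : EFin \o weight = fubini_F leb (fun xz : 'rV[R]_d * 'rV[R]_d => (p xz.2 * K0 (xz.1 - xz.2))%:E)); last first.
  by apply/funext => x /=; rewrite EFin_weight.
apply: measurable_fun_fubini_tonelli_F => /=.
- apply/measurable_EFinP; apply: measurable_funM.
    by apply: measurableT_comp; [exact: p_measurable|exact: measurable_snd].
  have [r [A hK]] := @bumpV_kernel R d 1 (const_mx (-1)) (const_mx 1) ler01.
  apply: measurableT_comp; first exact: kernel_measurable hK.
  by apply: measurable_subrv; [exact: measurable_fst|exact: measurable_snd].
- by move=> xz; rewrite lee_fin mulr_ge0 ?bumpV_ge0// ltW.
Qed.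

Lemma weight_le : exists2 C : R, 0 < C & forall x, weight x <= C * p x.
Proof.
have [C C0 h] := integral_near ler01; exists (C + 1) => [|x].
  by rewrite ltr_wpDl.
have [_] := h x 1 (fun z => K0 (x - z)) (mK0 x) (fun z => K0b _) (@K0out1 x).
rewrite weight.unlock mulr1 => /(le_trans (ler_norm _))/le_trans; apply.
by rewrite ler_pM2r// lerDl.
Qed.

(** Only the box of radius 1/2 around [x] is kept in the integral; there the bump
    is bounded below and [p] is comparable with [p x]. *)
Lemma weight_ge : exists2 c : R, 0 < c & forall x, c * p x <= weight x.
Proof.
have [C C0 hC] := harnack_box (1 / 2).
pose b : R := (flat 1 (1 / 2 : R)) ^+ 2.
have b0 : 0 < b by rewrite exprn_gt0// flat1_gt0//; lra.
have hb v : box (1 / 2) v -> b ^+ d <= K0 v.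
  move=> hv; rewrite -[X in _ ^+ X]card_ord -prodr_const; apply: ler_prod => i _.
  rewrite ltW//= /bump !mxE !mul1r /b expr2.
  have := hv i; rewrite ler_norml => /andP[h1 h2].
  by apply: ler_pM; rewrite ?flat1_ge0//; apply: flat1_homo; lra.
clearbody b.
exists (C^-1 * b ^+ d); first by rewrite mulr_gt0 ?invr_gt0// exprn_gt0.
move=> x; rewrite -lee_fin EFin_weight.
pose D : set 'rV[R]_d := [set z | box (1 / 2) (z - x)].
have mD : measurable D by exact: measurable_boxrv.
have LD : leb D = ((2 * (1 / 2)) ^+ d)%:E by apply: lebesgue_rV_ball; lra.
have -> : (C^-1 * b ^+ d * p x)%:E = (\int[leb]_z ((C^-1 * b ^+ d * p x) * \1_D z)%:E)%E.
  rewrite integral_scale_indic ?mulr_ge0 ?invr_ge0 ?exprn_ge0 ?(ltW C0) ?(ltW (p_gt0 _)) ?(ltW b0)//.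
  transitivity ((C^-1 * b ^+ d * p x)%:E * ((2 * (1 / 2)) ^+ d)%:E)%E; last first.
    by congr (_ * _)%E; exact/esym/LD.
  by rewrite -EFinM; congr EFin; rewrite (_ : 2 * (1 / 2) = 1 :> R) ?expr1n ?mulr1//; lra.
apply: (@le_integral_EFin _ _ _ leb setT (fun z => (C^-1 * b ^+ d * p x) * \1_D z)
  (fun z => p z * K0 (x - z))) => //.
- by apply: measurable_funM => //; exact: measurable_indic.
- apply: measurable_funM; first exact: p_measurable.
  exact: mK0.
- move=> z _; apply/andP; split.
    by rewrite !mulr_ge0 ?invr_ge0 ?exprn_ge0 ?(ltW C0) ?(ltW (p_gt0 _)) ?(ltW b0).
  rewrite indicE.
  have [zD|zD] := boolP (z \in D); last by rewrite mulr0 mulr_ge0 ?bumpV_ge0 ?(ltW (p_gt0 _)).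
  move: zD; rewrite inE /D/= => /boxB zD; rewrite mulr1 mulrAC ler_pM//.
  + by rewrite mulr_ge0 ?invr_ge0// ltW.
  + by rewrite exprn_ge0// ltW.
  + by rewrite mulrC ler_pdivrMr// mulrC hC.
  + exact: hb.
Qed.

Lemma weight_gt0 x : 0 < weight x.
Proof. by have [c c0 h] := weight_ge; rewrite (lt_le_trans _ (h x))// mulr_gt0. Qed.

(** The second difference is transferred to the bump, where it is of order
    [|y|^2] and lives in the box of radius 2; this is why the weight is a
    regularisation of [p] and not [p] itself. *)
Lemma weight_c11 : exists2 C : R, 0 <= C & forall x y, enorm y < 1 ->
  `|weight (x + y) + weight (x - y) - 2 * weight x| <= C * enorm y ^+ 2 * weight x.
Proof.
have [r [A hK]] := @bumpV_kernel R d 1 (const_mx (-1)) (const_mx 1) ler01.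
have [_ _ hA] := hK; have A0 := kernel_ge0 hK.
have [C C0 h] := @integral_near 2 (ler0n R 2).
have [c c0 hc] := weight_ge.
exists (C * A / c) => [|x y y1]; first by rewrite !mulr_ge0 ?invr_ge0// ltW.
pose g z := K0 (x + y - z) + K0 (x - y - z) - 2 * K0 (x - z).
have mg : measurable_fun setT g.
  apply: measurable_funB; last by apply: measurable_funM => //; exact: mK0.
  by apply: measurable_funD; exact: mK0.
have gA z : `|g z| <= A * enorm y ^+ 2.
  have [_ _] := hA (x - z) y.
  by rewrite /g (addrAC x) (addrAC x (- y)).
have g0 z : ~ box 2 (z - x) -> g z = 0.
  have E : 2 = 1 + 1 :> R by [].
  move=> hz; rewrite /g.
  have -> : K0 (x + y - z) = 0.
    apply: K0out => /boxB h1; apply: hz.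
    have := boxD h1 (box_le (ltW y1) (box_enorm y)).
    by rewrite opprD addrA subrK -E.
  have -> : K0 (x - y - z) = 0.
    apply: K0out => /boxB h1; apply: hz.
    have := boxD h1 (box_le (ltW y1) ((boxN _ _).2 (box_enorm y))).
    by rewrite opprB addrA addrAC addrK -E.
  have -> : K0 (x - z) = 0.
    by apply: K0out => /boxB h1; apply: hz; apply: box_le h1; lra.
  by ring.
have [_] := h x _ g mg gA g0.
have -> : \int[leb]_z (p z * g z) = weight (x + y) + weight (x - y) - 2 * weight x.
  rewrite weight.unlock -RintegralZl//; last exact: weight_integrable.
  rewrite -RintegralD//; try exact: weight_integrable.
  rewrite -RintegralB//; last 2 first.
  - by apply: integrableD_EFin; exact: weight_integrable.
  - by apply: integrableZl_EFin; exact: weight_integrable.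
  by apply: eq_Rintegral => z _; rewrite /g -/K0; ring.
move=> /le_trans; apply.
rewrite (_ : C * A / c * enorm y ^+ 2 * weight x = (C * (A * enorm y ^+ 2)) * (weight x / c)); last by ring.
apply: ler_wpM2l; first by rewrite !mulr_ge0 ?enorm_ge0.
by rewrite ler_pdivlMr// mulrC hc.
Qed.

End weight.

(** * Long and short jumps of the measure *)

Section levy_measure.
Context {R : realType} {d : nat}.
Variable nu : {measure set 'rV[R]_d -> \bar R}.
Hypothesis hnu : symmetric_levy_measure nu.
Implicit Types (x y z v : 'rV[R]_d).

Definition far (delta : R) : set 'rV[R]_d := [set y | delta <= enorm y].

Lemma measurable_far delta : measurable (far delta).
Proof. exact: measurable_enorm_ge. Qed.

Let m1 (y : 'rV[R]_d) : R := Num.min 1 (enorm y ^+ 2).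

Let m1_ge0 y : 0 <= m1 y.
Proof. by rewrite le_min ler01 sqr_ge0. Qed.

Let mm1 : measurable_fun setT m1.
Proof.
apply: measurable_minr => //; apply: measurable_funX; exact: measurable_enorm.
Qed.

Lemma levy_min_integrable :
  nu.-integrable setT (EFin \o (fun y => Num.min 1 (enorm y ^+ 2))).
Proof.
case: hnu => _ _ _ h; apply/integrableP; split; first exact/measurable_EFinP.
apply: le_lt_trans h; rewrite le_eqVlt; apply/orP; left; apply/eqP.
by apply: eq_integral => y _ /=; rewrite ger0_norm// m1_ge0.
Qed.

(** Markov's inequality for the function [min (1, |y|^2)]. *)
Lemma levy_far_fin delta : 0 < delta -> (nu (far delta) < +oo)%E.
Proof.
move=> d0; case: hnu => _ _ _ h.
pose c := Num.min 1 (delta ^+ 2).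
have c0 : 0 < c by rewrite lt_min ltr01 exprn_gt0.
have h1 : (c%:E * nu (far delta) <= \int[nu]_y (m1 y)%:E)%E.
  rewrite -(integral_scale_indic nu (measurable_far delta) (ltW c0)).
  apply: (@le_integral_EFin _ _ _ nu setT (fun y => c * \1_(far delta) y) m1) => //.
    apply: measurable_funM => //; apply: measurable_indic; exact: measurable_far.
  move=> y _; rewrite indicE; have [|_] := boolP (y \in far delta); last first.
    by rewrite mulr0 lexx m1_ge0.
  rewrite inE mulr1 => yd; rewrite (ltW c0)/=.
  by rewrite /c /m1 le_min !ge_min lexx/= lerXn2r ?orbT// nnegrE ?enorm_ge0// ltW.
have := le_lt_trans h1 h.
have [->|ny _] := eqVneq (nu (far delta)) +oo%E; last first.
  by rewrite lt_neqAle ny leey.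
by rewrite gt0_muley// lte_fin.
Qed.

Lemma ge0_integral_levyN (f : 'rV[R]_d -> \bar R) : measurable_fun setT f ->
  (forall y, 0 <= f y)%E -> (\int[nu]_y f (- y)%R = \int[nu]_y f y)%E.
Proof.
case: hnu => _ _ h _ mf f0.
have mt : measurable_fun setT (fun x : 'rV[R]_d => - x) by exact: measurable_opprv.
rewrite -[LHS](@ge0_integral_pushforward _ _ _ _ _ _ mt _ setT f)//.
apply: eq_measure_integral => //= A mA _.
rewrite /pushforward -(h A mA); congr (nu _); apply/seteqP; split=> y /=.
  by move=> Ay; exists (- y) => //; rewrite opprK.
by move=> [z Az <-]; rewrite opprK.
Qed.

Lemma levy_small eps : 0 < eps -> exists delta, [/\ 0 < delta, delta <= 1 &
  (\int[nu]_y (Num.min 1 (enorm y ^+ 2) * \1_(~` far delta) y)%:E <= eps%:E)%E].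
Proof.
move=> e0.
have mi n : measurable_fun setT (fun y => m1 y * \1_(~` far n.+1%:R^-1) y).
  apply: measurable_funM => //; apply: measurable_indic; apply: measurableC.
  exact: measurable_far.
have cv : (\int[nu]_y (m1 y * \1_(~` far n.+1%:R^-1) y)%:E)%E @[n --> \oo] --> (\int[nu]_y 0)%E.
  have [|||||_ _] := @dominated_convergence _ _ _ nu setT measurableT
    (fun n y => (m1 y * \1_(~` far n.+1%:R^-1) y)%:E) (cst 0%E) (EFin \o m1).
  - by move=> n; apply/measurable_EFinP.
  - exact: measurable_cst.
  - apply: aeW => y _ /=.
    have [y0|y0] := eqVneq (enorm y) 0.
      rewrite (_ : (fun n => _) = cst 0%E); first exact: cvg_cst.
      by apply/funext => n; rewrite /m1 y0 expr0n/= min_r// mul0r.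
    have y0' : 0 < enorm y by rewrite lt_neqAle eq_sym y0 enorm_ge0.
    apply: cvg_near_cst; near=> n.
    rewrite indicE memNset ?mulr0// => nf; apply: nf; rewrite /far/= ltW//.
    near: n; exact: (near_infty_natSinv_lt (PosNum y0')).
  - exact: levy_min_integrable.
  - apply: aeW => y n _ /=; rewrite lee_fin ger0_norm ?mulr_ge0 ?m1_ge0//.
    by rewrite ler_piMr ?m1_ge0// indicE; case: (_ \in _).
  - by move=> h; exact: h.
rewrite integral0 in cv.
have [n hn] : exists n, (\int[nu]_y (m1 y * \1_(~` far n.+1%:R^-1) y)%:E < eps%:E)%E.
  have /(_ [set z | z < eps%:E]%E) := cv; case=> [|N _ hN].
    by apply: open_nbhs_nbhs; split; [exact: open_ereal_lt_ereal|rewrite /= lte_fin].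
  by exists N; exact: (hN N (leqnn _)).
exists n.+1%:R^-1; split; rewrite ?invr_gt0//; last exact: ltW.
by rewrite invf_le1// ler1n.
Unshelve. all: by end_near. Qed.

Section jump.
Variable p : 'rV[R]_d -> R.
Hypothesis p_cont : continuous p.
Hypothesis p_gt0 : forall x, 0 < p x.
Hypothesis p_harnack : exists2 C : R, 0 < C & forall x z : 'rV[R]_d,
    enorm (z - x) < 1 -> p z <= C * p x.
Hypothesis p_jump : exists C : R, forall x : 'rV[R]_d,
    (\int[nu]_(y in [set y : 'rV[R]_d | 1 <= enorm y]%R) (p (x - y)%R)%:E
     <= (C * p x)%:E)%E.
Local Notation Phi := (weight p).

Let mPhi : measurable_fun setT Phi.
Proof. exact: weight_measurable. Qed.

Let mPhiD x : measurable_fun setT (fun y => Phi (x + y)).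
Proof. by apply: measurableT_comp => //; exact: measurable_addrv. Qed.

Let mPhiB x : measurable_fun setT (fun y => Phi (x - y)).
Proof. by apply: measurableT_comp => //; exact: measurable_subrv. Qed.

Let farN delta y : far delta (- y) = far delta y.
Proof. by rewrite /far/= enormN. Qed.

Let jumpN delta x : (\int[nu]_(y in far delta) (Phi (x + y))%:E =
  \int[nu]_(y in far delta) (Phi (x - y))%:E)%E.
Proof.
rewrite integral_mkcond [RHS]integral_mkcond.
rewrite -ge0_integral_levyN.
- apply: eq_integral => y _; rewrite !patchE.
  rewrite (_ : (- y \in far delta) = (y \in far delta))//.
  by apply/idP/idP; rewrite !inE farN.
- apply/(measurable_restrictT _ _).1; first exact: measurable_far.
  by apply/measurable_EFinP; exact: measurable_funTS.
- by move=> y; apply: erestrict_ge0 => z _; rewrite lee_fin ltW// weight_gt0.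
Qed.

Let far1 : exists2 C : R, 0 <= C & forall x,
  (\int[nu]_(y in far 1) (Phi (x - y))%:E <= (C * Phi x)%:E)%E.
Proof.
have [C hC] := p_jump; have [U U0 hU] := weight_le p_cont p_gt0 p_harnack.
have [c c0 hc] := weight_ge p_cont p_gt0 p_harnack.
exists (U * `|C| / c) => [|x].
  by rewrite !mulr_ge0 ?invr_ge0// ltW.
have mfp : measurable_fun (far 1) (fun y => p (x - y)).
  apply: measurable_funTS; apply: measurableT_comp; first exact: continuous_measurable_rV.
  exact: measurable_subrv.
apply: (@le_trans _ _ (\int[nu]_(y in far 1) (U * p (x - y))%:E)%E).
  apply: le_integral_EFin => //; first exact: measurable_far.
  - exact: measurable_funTS.
  - exact: measurable_funM.
  - by move=> y _; rewrite hU andbT ltW// weight_gt0.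
rewrite integralZl_EFin_ge0//; [|exact: measurable_far|exact: ltW|by move=> y _; rewrite ltW].
apply: (@le_trans _ _ (U%:E * (C * p x)%:E)%E).
  by apply: lee_wpmul2l; [rewrite lee_fin ltW|exact: hC].
rewrite -EFinM lee_fin -2!mulrA ler_pM2l//.
apply: (@le_trans _ _ (`|C| * p x)); first by rewrite ler_wpM2r ?ler_norm// ltW.
by rewrite ler_wpM2l// mulrC ler_pdivlMr// mulrC.
Qed.

(** By symmetry of [nu] the left-hand side is half the integral of
    [Phi (x - y) + Phi (x + y)].  For [|y| < 1] this sum exceeds [2 * Phi x] by at
    most [C |y|^2 Phi x], and the longer jumps are controlled by hypothesis.  The
    mass of [far delta] appears with coefficient exactly 1, so that in an Euler
    step it cancels the loss term and only [C] remains. *)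
Lemma weight_jump : exists2 C : R, 0 <= C & forall delta x, 0 < delta -> delta <= 1 ->
  (\int[nu]_(y in far delta) (Phi (x - y))%:E <= ((fine (nu (far delta)) + C) * Phi x)%:E)%E.
Proof.
have [C2 C20 h2] := weight_c11 p_cont p_gt0 p_harnack.
have [C1 C10 h1] := far1.
case: (hnu) => _ _ _ hm.
set m := fine (\int[nu]_y (m1 y)%:E)%E.
have mE : (\int[nu]_y (m1 y)%:E = m%:E)%E.
  by rewrite fineK// ge0_fin_numE// integral_ge0// => y _; rewrite lee_fin m1_ge0.
have m0 : 0 <= m by rewrite fine_ge0// integral_ge0// => y _; rewrite lee_fin m1_ge0.
exists ((C2 * m + 2 * C1) / 2) => [|delta x d0 d1].
  by rewrite divr_ge0// addr_ge0// mulr_ge0.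
have Phi0 z : 0 <= Phi z by rewrite ltW// weight_gt0.
set M := fine (nu (far delta)).
have ME : nu (far delta) = M%:E by rewrite fineK// ge0_fin_numE// levy_far_fin.
set I := (X in (X <= _)%E).
(* The inequality is doubled in order to symmetrise the integrand. *)
suff : (2%:E * I <= (2 * ((M + (C2 * m + 2 * C1) / 2) * Phi x))%:E)%E.
  by rewrite [X in (_ <= X)%E]EFinM lee_pmul2l// lte_fin.
have mf := measurable_far.
have -> : (2%:E * I = \int[nu]_(y in far delta) (Phi (x - y) + Phi (x + y))%:E)%E.
  rewrite integralD_EFin_ge0//; try exact: measurable_funTS.
  by rewrite jumpN -/I (mule_natl _ 2) mule2n.
pose g1 y := 2 * Phi x * \1_(far delta) y.
pose g2 y := C2 * Phi x * m1 y.
pose g3 y := (Phi (x - y) + Phi (x + y)) * \1_(far 1) y.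
have mg1 : measurable_fun setT g1.
  by apply: measurable_funM => //; exact: measurable_indic.
have mg2 : measurable_fun setT g2 by apply: measurable_funM.
have mg3 : measurable_fun setT g3.
  apply: measurable_funM; last exact: measurable_indic.
  exact: measurable_funD.
have g10 y : 0 <= g1 y by rewrite /g1 !mulr_ge0.
have g20 y : 0 <= g2 y by rewrite /g2 !mulr_ge0.
have g30 y : 0 <= g3 y by rewrite /g3 mulr_ge0// addr_ge0.
apply: (@le_trans _ _ (\int[nu]_y ((g1 y + g2 y) + g3 y)%:E)%E).
  rewrite integral_mkcond; under eq_integral do rewrite restrict_EFin.
  apply: (@le_integral_EFin _ _ _ nu setT _ (fun y => g1 y + g2 y + g3 y)) => //.
  - apply/(measurable_restrictT _ _).1 => //; apply: measurable_funTS.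
    exact: measurable_funD.
  - by apply: measurable_funD => //; exact: measurable_funD.
  move=> y _; rewrite patchE; case: ifPn => [|_]; last by rewrite lexx/= !addr_ge0.
  rewrite inE => yd; rewrite addr_ge0//=.
  rewrite /g1 indicE mem_set// mulr1.
  have [y1|y1] := ltP (enorm y) 1.
    have -> : g3 y = 0 by rewrite /g3 indicE memNset ?mulr0// /far/= leNgt y1.
    have := h2 x y y1; rewrite ler_norml => /andP[_].
    rewrite /g2 /m1 min_r; last by rewrite expr_le1 ?enorm_ge0// ltW.
    by move=> h; rewrite addr0; lra.
  have -> : g3 y = Phi (x - y) + Phi (x + y) by rewrite /g3 indicE mem_set// mulr1.
  by rewrite lerDr addr_ge0// mulr_ge0.
rewrite !integralD_EFin_ge0//; last 2 first.
- exact: measurable_funD.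
- by move=> y _; rewrite addr_ge0.
rewrite integral_scale_indic// ?mulr_ge0// ME -EFinM.
rewrite integralZl_EFin_ge0// ?mulr_ge0// mE -EFinM.
have h3 : (\int[nu]_y (g3 y)%:E <= (2 * C1 * Phi x)%:E)%E.
  rewrite (_ : (\int[nu]_y (g3 y)%:E = \int[nu]_(y in far 1) (Phi (x - y) + Phi (x + y))%:E)%E).
    rewrite integralD_EFin_ge0//; try exact: measurable_funTS.
    rewrite jumpN (_ : 2 * C1 * Phi x = C1 * Phi x + C1 * Phi x); last by ring.
    by rewrite EFinD leeD.
  rewrite [RHS]integral_mkcond; apply: eq_integral => y _.
  rewrite restrict_EFin/= patchE /g3 indicE.
  by case: (_ \in _); rewrite ?mulr1 ?mulr0.
apply: (@le_trans _ _ ((2 * Phi x * M)%:E + (C2 * Phi x * m)%:E + (2 * C1 * Phi x)%:E)%E).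
  by rewrite leeD2l.
by rewrite -!EFinD lee_fin le_eqVlt; apply/orP; left; apply/eqP; field.
Qed.

End jump.

End levy_measure.

(** * Mollification *)

Section parametric.
Context d1 d2 (X : measurableType d1) (Y : measurableType d2) (R : realType).
Variable mu : {sigma_finite_measure set Y -> \bar R}.

Lemma measurable_Rintegral_param (h : X * Y -> R) : measurable_fun setT h ->
  measurable_fun setT (fun x => \int[mu]_y h (x, y)).
Proof.
move=> mh; rewrite /Rintegral.
apply: (measurableT_comp (fine_measurable measurableT)).
under eq_fun do rewrite integralE.
have mE : measurable_fun setT (EFin \o h) by exact/measurable_EFinP.
apply: emeasurable_funB.
  rewrite (_ : (fun _ => _) = fubini_F mu (EFin \o h)^\+%E); last first.
    apply/funext => x; apply: eq_integral => y _.
    by rewrite -[RHS]/(((EFin \o h)^\+ \o pair x)%E y) -funepos_comp.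
  by apply: measurable_fun_fubini_tonelli_F => //; exact: measurable_funepos.
rewrite (_ : (fun _ => _) = fubini_F mu (EFin \o h)^\-%E); last first.
  apply/funext => x; apply: eq_integral => y _.
  by rewrite -[RHS]/(((EFin \o h)^\- \o pair x)%E y) -funeneg_comp.
by apply: measurable_fun_fubini_tonelli_F => //; exact: measurable_funeneg.
Qed.

Lemma measurable_integral_param (h : X * Y -> R) : measurable_fun setT h ->
  (forall z, 0 <= h z) ->
  measurable_fun setT (fun x => \int[mu]_y (h (x, y))%:E)%E.
Proof.
move=> mh h0; apply: (@measurable_fun_fubini_tonelli_F _ _ _ _ _ _ (EFin \o h)).
  exact/measurable_EFinP.
by move=> z; rewrite lee_fin.
Qed.

End parametric.

(** The mollified function integrates over an abstract space [Z] with a position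
    map [q]: space and time can then be mollified at once, the mollifier in time
    being a factor of [f]. *)
HB.lock Definition conv (R : realType) (d : nat) dZ (Z : measurableType dZ)
  (mz : {sigma_finite_measure set Z -> \bar R}) (q : Z -> 'rV[R]_d)
  (f : Z -> R) (g : 'rV[R]_d -> R) (x : 'rV[R]_d) : R :=
  \int[mz]_z (f z * g (x - q z)).

Section conv.
Context {R : realType} {d : nat} dZ (Z : measurableType dZ).
Variable mz : {sigma_finite_measure set Z -> \bar R}.
Variable q : Z -> 'rV[R]_d.
Hypothesis mq : measurable_fun setT q.
Variable p : 'rV[R]_d -> R.
Hypothesis p_cont : continuous p.
Hypothesis p_gt0 : forall x, 0 < p x.
Hypothesis p_harnack : exists2 C : R, 0 < C & forall x z : 'rV[R]_d,
    enorm (z - x) < 1 -> p z <= C * p x.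
Implicit Types (x y v : 'rV[R]_d) (f : Z -> R) (g : 'rV[R]_d -> R).
Local Notation leb := (lebesgue_rV d).
Local Notation Phi := (weight p).
Local Notation conv := (conv mz q).

Let mp : measurable_fun setT p. Proof. exact: continuous_measurable_rV. Qed.
Let mPhi : measurable_fun setT Phi. Proof. exact: weight_measurable. Qed.
Let Phi0 x : 0 <= Phi x. Proof. by rewrite ltW// weight_gt0. Qed.

(** This is the norm that the local integrability of the solutions controls. *)
Definition mass f : \bar R := (\int[mz]_z (`|f z| * p (q z))%:E)%E.

(** What makes [g (x - q z)] integrable against every [f] of finite mass. *)
Definition dominated g x := exists2 C : R, 0 <= C & forall z, `|g (x - z)| <= C * p z.

Lemma mass_integrable f : measurable_fun setT f -> (mass f < +oo)%E ->
  mz.-integrable setT (EFin \o (fun z => `|f z| * p (q z))).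
Proof.
move=> mf foo; apply/integrableP; split.
  apply/measurable_EFinP; apply: measurable_funM; apply: measurableT_comp => //.
apply: le_lt_trans foo; rewrite le_eqVlt; apply/orP; left; apply/eqP.
by apply: eq_integral => z _; rewrite /= ger0_norm// mulr_ge0// ltW.
Qed.

Lemma mass_mul f (k : Z -> R) (B : R) : measurable_fun setT f -> (mass f < +oo)%E ->
  measurable_fun setT k -> (forall z, `|k z| <= B) ->
  (mass (fun z => (f z * k z)%R) < +oo)%E.
Proof.
move=> mf foo mk kB.
have mpq : measurable_fun setT (fun z => `|f z| * p (q z)).
  by apply: measurable_funM; apply: measurableT_comp.
have mfk : measurable_fun setT (fun z => `|f z * k z| * p (q z)).
  apply: measurable_funM; last exact: measurableT_comp.
  by apply: measurableT_comp => //; exact: measurable_funM.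
have mB : measurable_fun setT (fun z => `|B| * (`|f z| * p (q z))) by exact: measurable_funM.
apply: (@le_lt_trans _ _ (`|B|%:E * mass f)%E); last by rewrite lte_mul_pinfty// lee_fin.
rewrite /mass -integralZl_EFin_ge0//; last by move=> z _; rewrite mulr_ge0// ltW.
apply: le_integral_EFin => // z _.
rewrite mulr_ge0 ?(ltW (p_gt0 _))//= mulrA ler_wpM2r ?(ltW (p_gt0 _))//.
by rewrite normrM mulrC ler_wpM2r// (le_trans (kB z))// ler_norm.
Qed.

Lemma massB (f k : Z -> R) : measurable_fun setT f -> measurable_fun setT k ->
  (mass f < +oo)%E -> (mass k < +oo)%E -> (mass (fun z => (f z - k z)%R) < +oo)%E.
Proof.
move=> mf mk foo koo.
have mP (h : Z -> R) : measurable_fun setT h -> measurable_fun setT (fun z => `|h z| * p (q z)).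
  by move=> mh; apply: measurable_funM; apply: measurableT_comp.
have h0 (h : Z -> R) z : 0 <= `|h z| * p (q z) by rewrite mulr_ge0// ltW.
apply: (@le_lt_trans _ _ (mass f + mass k)%E); last by rewrite lte_add_pinfty.
rewrite /mass -integralD_EFin_ge0//; try exact: mP.
apply: le_integral_EFin => //.
- by apply: mP; exact: measurable_funB.
- by apply: measurable_funD; exact: mP.
- by move=> z _; rewrite mulr_ge0 ?(ltW (p_gt0 _))//= -mulrDl ler_wpM2r ?(ltW (p_gt0 _))// ler_normB.
Qed.

Lemma conv_integrable f g x : measurable_fun setT f -> (mass f < +oo)%E ->
  measurable_fun setT g -> dominated g x ->
  mz.-integrable setT (EFin \o (fun z => f z * g (x - q z))).
Proof.
move=> mf foo mg [C C0 hC].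
apply: (@le_integrable_EFin _ _ _ _ _ (fun z => C * (`|f z| * p (q z)))).
- apply: measurable_funM => //; apply: measurableT_comp => //.
  exact: measurable_subrv.
- by move=> z; rewrite normrM mulrCA ler_wpM2l.
- apply: integrableZl_EFin; exact: mass_integrable.
Qed.

Lemma convB f1 f2 g x : measurable_fun setT f1 -> measurable_fun setT f2 ->
  (mass f1 < +oo)%E -> (mass f2 < +oo)%E -> measurable_fun setT g -> dominated g x ->
  conv (fun z => f1 z - f2 z) g x = conv f1 g x - conv f2 g x.
Proof.
move=> mf1 mf2 f1oo f2oo mg gx; rewrite conv.unlock -RintegralB//; try exact: conv_integrable.
by apply: eq_Rintegral => z _; rewrite mulrBl.
Qed.

Lemma dominated_local (r A : R) g x : (forall v, `|g v| <= A) ->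
  (forall v, ~ box r v -> g v = 0) -> dominated g x.
Proof.
move=> gA g0; have [C C0 hC] := harnack_box p_harnack r.
have A0 : 0 <= A by exact: le_trans (gA 0).
have K0 : 0 <= A * C / p x by rewrite !mulr_ge0 ?invr_ge0// ltW.
exists (A * C / p x) => // z.
have [bz|bz] := pselect (box r (x - z)); last first.
  by rewrite g0// normr0 mulr_ge0// ltW.
rewrite (le_trans (gA _))// -2!mulrA ler_peMr//.
by rewrite mulrCA mulrC ler_pdivlMr// mul1r hC.
Qed.

Lemma dominated_kernel (r A : R) K x : kernel r A K -> dominated K x.
Proof.
move=> hK; have [_ K0 hA] := hK.
by apply: (@dominated_local r A) => // v; have [] := hA v 0.
Qed.

Lemma measurable_conv f g : measurable_fun setT f -> measurable_fun setT g ->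
  measurable_fun setT (conv f g).
Proof.
move=> mf mg; rewrite (_ : conv f g = fun x => \int[mz]_z (f z * g (x - q z))); last first.
  by apply/funext => x; rewrite conv.unlock.
apply: (measurable_Rintegral_param mz (h := fun xz : 'rV[R]_d * Z => f xz.2 * g (xz.1 - q xz.2))).
apply: measurable_funM.
  by apply: measurableT_comp => //; exact: measurable_snd.
apply: measurableT_comp => //; apply: measurable_subrv; first exact: measurable_fst.
by apply: measurableT_comp => //; exact: measurable_snd.
Qed.

(** Fubini puts the integral of [|g (x - z)| * Phi x] over [x] in front, and on
    the support of [g] the Harnack inequality bounds [Phi x] by [p z].  The
    constant is linear in the bound [A] on [g], which makes the contribution of
    the short jumps small. *)
Lemma conv_bounded (r : R) : 0 <= r -> exists2 C : R, 0 <= C &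
  forall A f g, measurable_fun setT f -> (mass f < +oo)%E ->
  measurable_fun setT g -> (forall v, `|g v| <= A) ->
  (forall v, ~ box r v -> g v = 0) ->
  (\int[leb]_x (`|conv f g x| * Phi x)%:E <= (C * A)%:E * mass f)%E.
Proof.
move=> r0; have [C C0 hC] := harnack_box p_harnack r.
have [U U0 hU] := weight_le p_cont p_gt0 p_harnack.
exists (U * C * (2 * r) ^+ d) => [|A f g mf foo mg gA g0].
  by rewrite !mulr_ge0 ?exprn_ge0 ?mulr_ge0// ltW.
have A0 : 0 <= A by exact: le_trans (gA 0).
have mfg : measurable_fun setT (fun xz : 'rV[R]_d * Z =>
    `|f xz.2| * `|g (xz.1 - q xz.2)| * Phi xz.1).
  apply: measurable_funM; last by apply: measurableT_comp => //; exact: measurable_fst.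
  apply: measurable_funM; apply: measurableT_comp => //.
    by apply: measurableT_comp => //; exact: measurable_snd.
  apply: measurableT_comp => //; apply: measurable_subrv; first exact: measurable_fst.
  by apply: measurableT_comp => //; exact: measurable_snd.
have mgx x : measurable_fun setT (fun z => g (x - q z)).
  by apply: measurableT_comp => //; exact: measurable_subrv.
apply: (@le_trans _ _ (\int[leb]_x \int[mz]_z (`|f z| * `|g (x - q z)| * Phi x)%:E)%E).
  apply: ge0_le_integral => //.
  - by move=> x _; rewrite lee_fin mulr_ge0.
  - apply/measurable_EFinP; apply: measurable_funM => //; apply: measurableT_comp => //.
    exact: measurable_conv.
  - apply: (measurable_integral_param mz mfg) => xz.
    by rewrite !mulr_ge0.
  move=> x _; rewrite conv.unlock mulrC EFinM.
  have hint : mz.-integrable setT (EFin \o (fun z => f z * g (x - q z))).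
    by apply: conv_integrable => //; exact: dominated_local gA g0.
  rewrite EFin_normr_Rintegral//.
  apply: (@le_trans _ _ ((Phi x)%:E * \int[mz]_z (`|f z * g (x - q z)|)%:E)%E).
    apply: lee_wpmul2l; first by rewrite lee_fin.
    apply: le_abse_integral => //; apply/measurable_EFinP.
    exact: measurable_funM.
  rewrite -integralZl_EFin_ge0//; last first.
    by apply: measurableT_comp => //; exact: measurable_funM.
  rewrite le_eqVlt; apply/orP; left; apply/eqP; apply: eq_integral => z _.
  by rewrite normrM; congr EFin; ring.
rewrite (@fubini_tonelli _ _ _ _ _ leb mz (fun xz : 'rV[R]_d * Z =>
  (`|f xz.2| * `|g (xz.1 - q xz.2)| * Phi xz.1)%:E)); last 2 first.
- exact/measurable_EFinP.
- by move=> xz; rewrite lee_fin !mulr_ge0.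
have mpq : measurable_fun setT (fun z => `|f z| * p (q z)).
  by apply: measurable_funM; apply: measurableT_comp.
have pq0 z : 0 <= `|f z| * p (q z) by rewrite mulr_ge0// ltW.
have K0 : 0 <= U * C * (2 * r) ^+ d * A by rewrite !mulr_ge0 ?exprn_ge0 ?mulr_ge0// ltW.
rewrite /mass -integralZl_EFin_ge0//.
apply: ge0_le_integral => //.
- by move=> z _; apply: integral_ge0 => x _; rewrite lee_fin !mulr_ge0.
- have msw : measurable_fun setT (fun zx : Z * 'rV[R]_d =>
      `|f zx.1| * `|g (zx.2 - q zx.1)| * Phi zx.2).
    apply: measurable_funM; last by apply: measurableT_comp => //; exact: measurable_snd.
    apply: measurable_funM; apply: measurableT_comp => //.
      by apply: measurableT_comp => //; exact: measurable_fst.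
    apply: measurableT_comp => //; apply: measurable_subrv; first exact: measurable_snd.
    by apply: measurableT_comp => //; exact: measurable_fst.
  by apply: (measurable_integral_param leb msw) => xz; rewrite !mulr_ge0.
- by apply/measurable_EFinP; exact: measurable_funM.
move=> z _.
pose D : set 'rV[R]_d := [set x | box r (x - q z)].
have mD : measurable D by exact: measurable_boxrv.
have LD : leb D = ((2 * r) ^+ d)%:E by exact: lebesgue_rV_ball.
apply: (@le_trans _ _ (\int[leb]_x ((`|f z| * A * (U * (C * p (q z)))) * \1_D x)%:E)%E).
  apply: le_integral_EFin => //.
  - have mgz : measurable_fun setT (fun x => g (x - q z)).
      by apply: (measurableT_comp mg); exact: measurable_subrv.
    rewrite /=; apply: measurable_funM => //; apply: measurable_funM => //.
    exact: measurableT_comp.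
  - by apply: measurable_funM => //; exact: measurable_indic.
  move=> x _; rewrite /= !mulr_ge0//= indicE.
  have [xD|xD] := boolP (x \in D); last first.
    rewrite g0 ?normr0 ?mulr0 ?mul0r//.
    by move/negP : xD; rewrite inE.
  move: xD; rewrite inE mulr1 => xD.
  apply: ler_pM => //; rewrite ?mulr_ge0//; first by rewrite ler_wpM2l.
  by rewrite (le_trans (hU _))// ler_pM2l// hC.
rewrite integral_scale_indic//; last by rewrite !mulr_ge0// ltW.
rewrite le_eqVlt; apply/orP; left; apply/eqP.
transitivity ((`|f z| * A * (U * (C * p (q z))))%:E * ((2 * r) ^+ d)%:E)%E.
  by congr (_ * _)%E; exact: LD.
by rewrite -EFinM; congr EFin; ring.
Qed.

End conv.

(** * An Euler step for a finite jump measure *)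

Section real_fubini.
Context d1 d2 (X : measurableType d1) (Y : measurableType d2) (R : realType).
Variables (m1 : {sigma_finite_measure set X -> \bar R})
  (m2 : {sigma_finite_measure set Y -> \bar R}).
Variable h : X * Y -> R.
Hypothesis ih : (m1 \x m2)%E.-integrable setT (EFin \o h).

Let mh : measurable_fun setT h.
Proof. by case/integrableP: ih => /measurable_EFinP. Qed.

Let mswap : measurable_fun setT (fun yx : Y * X => h (yx.2, yx.1)).
Proof.
apply: measurableT_comp => //; apply/measurable_fun_pairP; split.
  exact: measurable_snd.
exact: measurable_fst.
Qed.

Lemma Rintegral_prod12 :
  \int[m1]_x \int[m2]_y h (x, y) = \int[(m1 \x m2)%E]_z h z.
Proof.
rewrite /Rintegral -integral12_prod_meas1//; congr fine.
apply: ae_eq_integral => //.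
- apply/measurable_EFinP; exact: (measurable_Rintegral_param m2 mh).
- exact: (measurable_fubini_F ih).
have := integrable_ae measurableT (integrable_fubini_F ih).
by apply: filterS => x hx _; rewrite /fubini_F/= fineK// hx.
Qed.

Lemma Rintegral_prod21 :
  \int[m2]_y \int[m1]_x h (x, y) = \int[(m1 \x m2)%E]_z h z.
Proof.
rewrite /Rintegral -integral21_prod_meas1//; congr fine.
apply: ae_eq_integral => //.
- apply/measurable_EFinP.
  exact: (measurable_Rintegral_param m1 mswap).
- exact: (measurable_fubini_G ih).
have := ae_integrable2 ih.
apply: filterS => y hy _; rewrite /fubini_G/= fineK//.
exact: (integrable_fin_num measurableT hy).
Qed.

Lemma integrable_Rintegral_param :
  m2.-integrable setT (EFin \o (fun y => \int[m1]_x h (x, y))).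
Proof.
have mE : measurable_fun setT (fun y => \int[m1]_x h (x, y)).
  exact: (measurable_Rintegral_param m1 mswap).
apply/integrableP; split; first exact/measurable_EFinP.
apply: le_lt_trans ((integrable21ltyP m1 m2 (measurable_int _ ih)).1 ih).
apply: ge0_le_integral => //.
- by apply/measurable_EFinP; exact: measurableT_comp.
- apply: (measurable_integral_param m1 (h := fun yx => `|h (yx.2, yx.1)|)) => //.
  exact: measurableT_comp.
move=> y _ /=; apply: (@le_trans _ _ `|\int[m1]_x (h (x, y))%:E|%E).
  by rewrite /Rintegral; case: (integral _ _ _) => [r| |] //=; rewrite normr0 leey.
apply: le_abse_integral => //; apply/measurable_EFinP.
exact: measurableT_comp.
Qed.

End real_fubini.

(** The generator of a compound Poisson process with jump measure [lam], without
    the symmetrisation of [levy_op]: the Euler step then involves one translate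
    of the function only. *)
HB.lock Definition jump (R : realType) (d : nat)
  (lam : {measure set 'rV[R]_d -> \bar R}) (K : 'rV[R]_d -> R) (v : 'rV[R]_d) : R :=
  \int[lam]_y (K v - K (v + y)).

Section jump.
Context {R : realType} {d : nat} dZ (Z : measurableType dZ).
Variable mz : {sigma_finite_measure set Z -> \bar R}.
Variable q : Z -> 'rV[R]_d.
Hypothesis mq : measurable_fun setT q.
Variable p : 'rV[R]_d -> R.
Hypothesis p_cont : continuous p.
Hypothesis p_gt0 : forall x, 0 < p x.
Hypothesis p_harnack : exists2 C : R, 0 < C & forall x z : 'rV[R]_d,
    enorm (z - x) < 1 -> p z <= C * p x.
Variable lam : {finite_measure set 'rV[R]_d -> \bar R}.
Variables (M C0 : R).
Hypothesis lamT : lam setT = M%:E.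
Hypothesis C0_ge0 : 0 <= C0.
Hypothesis lam_weight : forall x,
  (\int[lam]_y (weight p (x - y))%:E <= ((M + C0) * weight p x)%:E)%E.
Implicit Types (x y v : 'rV[R]_d) (f : Z -> R) (g : 'rV[R]_d -> R).
Local Notation leb := (lebesgue_rV d).
Local Notation Phi := (weight p).
Local Notation conv := (conv mz q).
Local Notation mass := (mass mz q p).
Local Notation dominated := (dominated p).
Local Notation jump := (jump lam).

Let mp : measurable_fun setT p. Proof. exact: continuous_measurable_rV. Qed.
Let mPhi : measurable_fun setT Phi. Proof. exact: weight_measurable. Qed.
Let Phi0 x : 0 <= Phi x. Proof. by rewrite ltW// weight_gt0. Qed.
Let M0 : 0 <= M. Proof. by rewrite -lee_fin -lamT. Qed.

Let integral_lam_cst (k : R) : (\int[lam]_y k%:E = (k * M)%:E)%E.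
Proof. by rewrite integral_cst// EFinM; congr (_ * _)%E; exact: lamT. Qed.

Let Rintegral_lam_cst (k : R) : \int[lam]_y k = k * M.
Proof. by rewrite /Rintegral integral_lam_cst. Qed.

Let mcompB g x : measurable_fun setT g -> measurable_fun setT (fun y => g (x - y)).
Proof. by move=> mg; apply: measurableT_comp => //; exact: measurable_subrv. Qed.

Let mcompD g x : measurable_fun setT g -> measurable_fun setT (fun y => g (x + y)).
Proof. by move=> mg; apply: measurableT_comp => //; exact: measurable_addrv. Qed.

(** The jump bound passes from the weight to [p] itself, with a constant that
    depends on the mass of [lam]; integrability needs nothing better. *)
Let lam_p : exists2 C : R, 0 <= C & forall x,
  (\int[lam]_y (p (x - y))%:E <= (C * p x)%:E)%E.
Proof.
have [U U0 hU] := weight_le p_cont p_gt0 p_harnack.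
have [c c0 hc] := weight_ge p_cont p_gt0 p_harnack.
have MC : 0 <= M + C0 by rewrite addr_ge0.
exists (c^-1 * ((M + C0) * U)) => [|x]; first by rewrite !mulr_ge0 ?invr_ge0// ltW.
apply: (@le_trans _ _ (\int[lam]_y (c^-1 * Phi (x - y))%:E)%E).
  apply: le_integral_EFin => //.
  - exact: mcompB.
  - by apply: measurable_funM => //; exact: mcompB.
  - by move=> y _; rewrite ltW//= mulrC ler_pdivlMr// mulrC.
rewrite integralZl_EFin_ge0 ?invr_ge0 ?(ltW c0)//; last exact: mcompB.
rewrite -mulrA EFinM; apply: lee_wpmul2l; first by rewrite lee_fin invr_ge0 ltW.
by rewrite (le_trans (lam_weight x))// lee_fin -mulrA ler_wpM2l.
Qed.

Lemma bounded_integrable g (A : R) : measurable_fun setT g -> (forall v, `|g v| <= A) ->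
  lam.-integrable setT (EFin \o g).
Proof.
move=> mg gA; apply: (@le_integrable_EFin _ _ _ _ g (cst A)) => //.
by apply: finite_measure_integrable_cst.
Qed.

Let jump_integrable (K : 'rV[R]_d -> R) (A : R) v :
  measurable_fun setT K -> (forall v, `|K v| <= A) ->
  lam.-integrable setT (EFin \o (fun y => K v - K (v + y))).
Proof.
move=> mK KA; apply: (@bounded_integrable _ (A + A)).
  by apply: measurable_funB => //; exact: mcompD.
by move=> y; rewrite (le_trans (ler_normB _ _))// lerD.
Qed.

Lemma measurable_jump (K : 'rV[R]_d -> R) :
  measurable_fun setT K -> measurable_fun setT (jump K).
Proof.
move=> mK; rewrite (_ : jump K = fun v => \int[lam]_y (K v - K (v + y))); last first.
  by apply/funext => x; rewrite jump.unlock.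
apply: (measurable_Rintegral_param lam (h := fun vy : 'rV[R]_d * 'rV[R]_d => K vy.1 - K (vy.1 + vy.2))).
apply: measurable_funB; apply: (measurableT_comp mK); first exact: measurable_fst.
by apply: measurable_addrv; [exact: measurable_fst|exact: measurable_snd].
Qed.

(** As [K] is dominated at [x], its value at [x - z + y] is at most a multiple of
    [p (z - y)], which integrates over [y] to a multiple of [p z]. *)
Lemma dominated_jump (K : 'rV[R]_d -> R) (A : R) x :
  measurable_fun setT K -> (forall v, `|K v| <= A) ->
  dominated K x -> dominated (jump K) x.
Proof.
move=> mK KA [C C_ge0 hC]; have [B B0 hB] := lam_p.
exists (M * C + C * B) => [|z]; first by rewrite addr_ge0// mulr_ge0.
rewrite -lee_fin jump.unlock EFin_normr_Rintegral//; last exact: jump_integrable KA.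
apply: (@le_trans _ _ (\int[lam]_y (C * p z + C * p (z - y))%:E)%E).
  apply: (le_trans (le_abse_integral _ _ _)) => //.
    by case/integrableP: (@jump_integrable K A (x - z) mK KA).
  apply: (@le_integral_EFin _ _ _ _ _ (fun y => `|K (x - z) - K (x - z + y)|)) => //.
  - apply: measurableT_comp => //; apply: measurable_funB => //; exact: mcompD.
  - by apply: measurable_funD => //; apply: measurable_funM => //; exact: mcompB.
  - move=> y _; rewrite normr_ge0/= (le_trans (ler_normB _ _))// lerD//.
    by rewrite (_ : x - z + y = x - (z - y))// opprB addrA addrAC.
rewrite integralD_EFin_ge0//; last 3 first.
- by apply: measurable_funM => //; exact: mcompB.
- by move=> y _; rewrite mulr_ge0// ltW.
- by move=> y _; rewrite mulr_ge0// ltW.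
rewrite integral_lam_cst integralZl_EFin_ge0//; last 2 first.
- exact: mcompB.
- by move=> y _; rewrite ltW.
rewrite mulrDl EFinD.
apply: leeD; first by rewrite lee_fin; rewrite le_eqVlt; apply/orP; left; apply/eqP; ring.
by rewrite -mulrA EFinM; apply: lee_wpmul2l; [rewrite lee_fin|exact: hB].
Qed.

Section fK.
Variables (f : Z -> R) (K : 'rV[R]_d -> R) (r A : R).
Hypothesis mf : measurable_fun setT f.
Hypothesis foo : (mass f < +oo)%E.
Hypothesis hK : kernel r A K.

Let mK : measurable_fun setT K. Proof. exact: kernel_measurable hK. Qed.
Let KA v : `|K v| <= A. Proof. by have [_ _ /(_ v 0)[]] := hK. Qed.
Let K_out v : ~ box r v -> K v = 0. Proof. by case: hK => _ + _; apply. Qed.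
Let Kdom x : dominated K x. Proof. exact: dominated_kernel hK. Qed.

Let h x (zy : Z * 'rV[R]_d) : R := f zy.1 * (K (x - q zy.1) - K (x - q zy.1 + zy.2)).

Let mh x : measurable_fun setT (h x).
Proof.
apply: measurable_funM.
  by apply: measurableT_comp => //; exact: measurable_fst.
have mq1 : measurable_fun setT (fun zy : Z * 'rV[R]_d => x - q zy.1).
  by apply: measurable_subrv => //; apply: measurableT_comp => //; exact: measurable_fst.
apply: measurable_funB; apply: (measurableT_comp mK) => //.
by apply: measurable_addrv => //; exact: measurable_snd.
Qed.

Let hint x : (mz \x lam)%E.-integrable setT (EFin \o h x).
Proof.
apply/(integrable12ltyP mz lam); first exact/measurable_EFinP.
have [C C_ge0 hC] := Kdom x; have [B B0 hB] := lam_p.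
have pq0 z : 0 <= `|f z| * p (q z) by rewrite mulr_ge0// ltW.
have mpq : measurable_fun setT (fun z => `|f z| * p (q z)).
  by apply: measurable_funM; apply: measurableT_comp.
apply: (@le_lt_trans _ _ (\int[mz]_z ((C * (M + B)) * (`|f z| * p (q z)))%:E)%E).
  apply: ge0_le_integral => //.
  - by move=> z _; apply: integral_ge0 => y _; rewrite /= lee_fin.
  - apply: (measurable_integral_param lam (h := fun zy => `|h x zy|)) => //.
    exact: measurableT_comp.
  - by apply/measurable_EFinP; exact: measurable_funM.
  move=> z _ /=.
  apply: (@le_trans _ _ (\int[lam]_y ((`|f z| * C) * (p (q z) + p (q z - y)))%:E)%E).
    apply: le_integral_EFin => //.
    - apply: measurableT_comp => //; apply: (measurableT_comp (mh x)).
      exact: measurable_pair1.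
    - apply: measurable_funM => //; apply: measurable_funD => //; exact: mcompB.
    move=> y _; rewrite normr_ge0/= normrM -mulrA ler_wpM2l//.
    rewrite mulrDr (le_trans (ler_normB _ _))// lerD//.
    by rewrite (_ : x - q z + y = x - (q z - y))// opprB addrA addrAC.
  rewrite integralZl_EFin_ge0//; last 3 first.
  - by rewrite mulr_ge0.
  - by apply: measurable_funD => //; exact: mcompB.
  - by move=> y _; rewrite addr_ge0// ltW.
  rewrite integralD_EFin_ge0//; last 3 first.
  - exact: mcompB.
  - by move=> y _; rewrite ltW.
  - by move=> y _; rewrite ltW.
  rewrite integral_lam_cst.
  apply: (@le_trans _ _ ((`|f z| * C)%:E * ((p (q z) * M)%:E + (B * p (q z))%:E))%E).
    by apply: lee_wpmul2l; [rewrite lee_fin mulr_ge0|rewrite leeD2l].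
  by rewrite -EFinD -EFinM lee_fin; rewrite le_eqVlt; apply/orP; left; apply/eqP; ring.
rewrite integralZl_EFin_ge0//; last by rewrite !mulr_ge0// addr_ge0.
by rewrite lte_mul_pinfty// lee_fin mulr_ge0// addr_ge0.
Qed.

Let conv_h x y : \int[mz]_z h x (z, y) = conv f K x - conv f K (x + y).
Proof.
rewrite conv.unlock -RintegralB//; try exact: conv_integrable.
by apply: eq_Rintegral => z _; rewrite /h/= mulrBr (addrAC x).
Qed.

(** The jump operator commutes with the mollification. *)
Lemma conv_jump x : conv f (jump K) x = \int[lam]_y (conv f K x - conv f K (x + y)).
Proof.
under [RHS]eq_Rintegral do rewrite -conv_h.
rewrite (Rintegral_prod21 (hint x)) -(Rintegral_prod12 (hint x)).
rewrite conv.unlock; apply: eq_Rintegral => z _; rewrite /h jump.unlock -RintegralZl//.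
exact: jump_integrable KA.
Qed.

Let W := conv f K.

Let mW : measurable_fun setT W. Proof. exact: measurable_conv. Qed.

Let W_integrable x : lam.-integrable setT (EFin \o (fun y => W (x + y))).
Proof.
have h1 := integrable_Rintegral_param (hint x).
rewrite (_ : _ \o _ = EFin \o (fun y => W x - \int[mz]_z h x (z, y))).
  apply: integrableB_EFin => //; exact: finite_measure_integrable_cst.
by apply/funext => y /=; rewrite conv_h /W; congr EFin; ring.
Qed.

Lemma conv_jumpE x : conv f (jump K) x = M * W x - \int[lam]_y W (x + y).
Proof.
rewrite conv_jump RintegralB//; last exact: finite_measure_integrable_cst.
by rewrite Rintegral_lam_cst mulrC.
Qed.

(** Since [s * M <= 1], the step maps [W] to a combination of its translates with
    nonnegative coefficients.  After the triangle inequality, Fubini and a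
    translation replace [\int |W (x + y)| Phi x] by [\int |W x| Phi (x - y)], and
    the bound on the jumps of the weight gives the factor
    [(1 - s * M) + s * (M + C0)]. *)
Lemma euler_jump (s : R) : 0 <= s -> s * M <= 1 ->
  (\int[leb]_x (`|W x - s * conv f (jump K) x| * Phi x)%:E <=
   (1 + s * C0)%:E * \int[leb]_x (`|W x| * Phi x)%:E)%E.
Proof.
move=> s0 sM.
have mWP : measurable_fun setT (fun x => `|W x| * Phi x).
  by apply: measurable_funM => //; exact: measurableT_comp.
have WP0 x : 0 <= `|W x| * Phi x by rewrite mulr_ge0.
have mJ : measurable_fun setT (conv f (jump K)).
  by apply: measurable_conv => //; exact: measurable_jump.
have sM0 : 0 <= 1 - s * M by rewrite subr_ge0.
pose S := (\int[leb]_x (`|W x| * Phi x)%:E)%E.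
pose g (xy : 'rV[R]_d * 'rV[R]_d) := `|W (xy.1 + xy.2)| * Phi xy.1.
have mg : measurable_fun setT g.
  apply: measurable_funM; last by apply: measurableT_comp => //; exact: measurable_fst.
  apply: measurableT_comp => //; apply: measurableT_comp => //.
  by apply: measurable_addrv; [exact: measurable_fst|exact: measurable_snd].
have g0 xy : 0 <= g xy by rewrite mulr_ge0.
have mG : measurable_fun setT (fun x => \int[lam]_y (g (x, y))%:E)%E.
  exact: measurable_integral_param.
have I2 : (\int[leb]_x \int[lam]_y (g (x, y))%:E <= (M + C0)%:E * S)%E.
  rewrite (@fubini_tonelli _ _ _ _ _ leb lam (EFin \o g)); last 2 first.
  - exact/measurable_EFinP.
  - by move=> xy; rewrite lee_fin.
  rewrite /= /g/=.
  have E y : (\int[leb]_x (`|W (x + y)| * Phi x)%:E = \int[leb]_x (`|W x| * Phi (x - y))%:E)%E.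
    rewrite -(@ge0_integral_translation _ _ y (fun x => (`|W x| * Phi (x - y))%:E)).
    - by apply: eq_integral => x _; rewrite addrK.
    - apply/measurable_EFinP; apply: measurable_funM; first exact: measurableT_comp.
      by apply: measurableT_comp => //; exact: measurable_subrv.
    - by move=> x; rewrite lee_fin mulr_ge0.
  under eq_integral do rewrite E.
  pose g' (xy : 'rV[R]_d * 'rV[R]_d) := `|W xy.1| * Phi (xy.1 - xy.2).
  have mg' : measurable_fun setT g'.
    apply: measurable_funM.
      by apply: measurableT_comp => //; apply: measurableT_comp => //; exact: measurable_fst.
    apply: measurableT_comp => //.
    by apply: measurable_subrv; [exact: measurable_fst|exact: measurable_snd].
  rewrite -(@fubini_tonelli _ _ _ _ _ leb lam (EFin \o g')); last 2 first.
  - exact/measurable_EFinP.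
  - by move=> xy; rewrite lee_fin mulr_ge0.
  rewrite /S -integralZl_EFin_ge0//; last by rewrite addr_ge0.
  apply: ge0_le_integral => //.
  - by move=> x _; apply: integral_ge0 => y _; rewrite lee_fin mulr_ge0.
  - by apply: measurable_integral_param => // xy; rewrite mulr_ge0.
  - by apply/measurable_EFinP; exact: measurable_funM.
  move=> x _; rewrite /g'/= integralZl_EFin_ge0//; last exact: mcompB.
  rewrite mulrCA EFinM; apply: lee_wpmul2l; first by rewrite lee_fin.
  exact: lam_weight.
apply: (@le_trans _ _ (\int[leb]_x (((1 - s * M) * (`|W x| * Phi x))%:E +
    s%:E * \int[lam]_y (g (x, y))%:E))%E).
  apply: ge0_le_integral => //.
  - by move=> x _; rewrite lee_fin mulr_ge0.
  - apply/measurable_EFinP; apply: measurable_funM => //; apply: measurableT_comp => //.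
    by apply: measurable_funB => //; exact: measurable_funM.
  - apply: emeasurable_funD; first by apply/measurable_EFinP; exact: measurable_funM.
    exact: measurable_funeM.
  move=> x _.
  have IW := W_integrable x.
  have IWn : lam.-integrable setT (EFin \o (fun y => `|W (x + y)|)).
    by apply: integrable_norm IW.
  have E : (\int[lam]_y (g (x, y))%:E = (Phi x * \int[lam]_y `|W (x + y)|)%:E)%E.
    rewrite EFinM /Rintegral fineK; last exact: integrable_fin_num.
    rewrite -integralZl_EFin_ge0//; last by apply: measurableT_comp => //; exact: mcompD.
    by apply: eq_integral => y _; rewrite /g/= mulrC.
  rewrite E -EFinM -EFinD lee_fin.
  rewrite (_ : _ * _ + _ = ((1 - s * M) * `|W x| + s * \int[lam]_y `|W (x + y)|) * Phi x); last by ring.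
  rewrite ler_wpM2r// conv_jumpE.
  rewrite (_ : W x - _ = (1 - s * M) * W x + s * \int[lam]_y W (x + y)); last by ring.
  rewrite (le_trans (ler_normD _ _))// !normrM (ger0_norm sM0) (ger0_norm s0).
  by rewrite lerD2l ler_wpM2l// le_normr_Rintegral.
rewrite ge0_integralD//; last 4 first.
- by move=> x _; rewrite lee_fin mulr_ge0.
- by apply/measurable_EFinP; exact: measurable_funM.
- by move=> x _; rewrite mule_ge0 ?lee_fin// integral_ge0// => y _; rewrite lee_fin.
- exact: measurable_funeM.
rewrite integralZl_EFin_ge0// ge0_integralZl_EFin//; last first.
  by move=> x _; rewrite integral_ge0// => y _; rewrite lee_fin.
apply: (@le_trans _ _ ((1 - s * M)%:E * S + s%:E * ((M + C0)%:E * S))%E).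
  by rewrite leeD2l// lee_wpmul2l.
have S0 : (0 <= S)%E by apply: integral_ge0 => x _; rewrite lee_fin.
rewrite muleA -EFinM -ge0_muleDl ?lee_fin// ?mulr_ge0 ?addr_ge0//.
rewrite -EFinD (_ : 1 - s * M + s * (M + C0) = 1 + s * C0)//; ring.
Qed.

End fK.

End jump.

(** * An Euler step for the Levy operator *)

Section sigma_finite_copy.
Context d (T : measurableType d) (R : realType).
Variable mu : {measure set T -> \bar R}.

(** A copy of [mu] on which the proof [h] can be declared as a canonical
    structure. *)
Definition sigma_finite_copy (h : sigma_finite setT mu) : set T -> \bar R := mu.

Variable h : sigma_finite setT mu.
HB.instance Definition _ := isMeasure.Build _ _ _ (sigma_finite_copy h)
  (measure0 mu) (measure_ge0 mu) (@measure_semi_sigma_additive _ _ _ mu).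
HB.instance Definition _ :=
  Measure_isSigmaFinite.Build _ _ _ (sigma_finite_copy h) h.

End sigma_finite_copy.

Section levy_operator.
Context {R : realType} {d : nat}.
Variable nu : {measure set 'rV[R]_d -> \bar R}.
Hypothesis hnu : symmetric_levy_measure nu.
Implicit Types (x y z v : 'rV[R]_d) (K : 'rV[R]_d -> R).

(** The origin is negligible and every other point is in some
    [far n.+1%:R^-1]. *)
Lemma levy_sigma_finite : sigma_finite setT nu.
Proof.
have m0 : measurable ([set 0] : set 'rV[R]_d).
  rewrite (_ : [set 0] = ~` \bigcup_n far n.+1%:R^-1).
    by apply: measurableC; apply: bigcupT_measurable => n; exact: measurable_far.
  apply/seteqP; split => y /=.
    move=> -> [n _]; rewrite /far/=.
    by rewrite -[X in enorm X](scale0r (0 : 'rV[R]_d)) enormZ normr0 mul0r leNgt invr_gt0 ltr0n.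
  move=> hy; have y0 : enorm y = 0.
    apply/eqP; rewrite eq_le enorm_ge0 andbT leNgt; apply/negP => y0; apply: hy.
    have [N _ hN] := near_infty_natSinv_lt (PosNum y0).
    by exists N => //; rewrite /far/= ltW//; exact: (hN N (leqnn N)).
  apply/rowP => i; rewrite mxE; apply/eqP; rewrite -normr_le0 -y0.
  exact: coord_le_enorm.
exists (fun n => if n is k.+1 then far k.+1%:R^-1 else [set 0]).
  apply/seteqP; split => // y _.
  have [y0|y0] := eqVneq (enorm y) 0.
    exists 0%N => //=; apply/rowP => i; rewrite mxE; apply/eqP.
    by rewrite -normr_le0 -y0 coord_le_enorm.
  have y0' : 0 < enorm y by rewrite lt_neqAle eq_sym y0 enorm_ge0.
  have [N _ hN] := near_infty_natSinv_lt (PosNum y0').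
  by exists N.+1 => //; rewrite /far/= ltW//; exact: (hN N (leqnn N)).
move=> [|k]; split => //.
- by case: hnu => ->.
- exact: measurable_far.
- by apply: levy_far_fin => //; rewrite invr_gt0.
Qed.

Definition second_diff K v y : R := K v - (K (v + y) + K (v - y)) / 2.

Section fixed_kernel.
Variables (K : 'rV[R]_d -> R) (r A : R).
Hypothesis hK : kernel r A K.

Let mK : measurable_fun setT K. Proof. exact: kernel_measurable hK. Qed.
Let KA v : `|K v| <= A. Proof. by have [_ _ /(_ v 0)[]] := hK. Qed.
Let A0 : 0 <= A. Proof. exact: kernel_ge0 hK. Qed.

Let msd v : measurable_fun setT (second_diff K v).
Proof.
apply: measurable_funB => //; apply: measurable_funM => //.
by apply: measurable_funD; apply: (measurableT_comp mK);
  [exact: measurable_addrv|exact: measurable_subrv].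
Qed.

Lemma second_diff_le v y : `|second_diff K v y| <= A * enorm y ^+ 2.
Proof.
have [_ _ /(_ v y)[_ _ h]] := hK.
rewrite /second_diff (_ : _ - _ = - (K (v + y) + K (v - y) - 2 * K v) / 2); last by field.
rewrite normrM normrN (le_trans (ler_wpM2r _ h))// ger0_norm//.
have := mulr_ge0 A0 (sqr_ge0 (enorm y)); lra.
Qed.

Lemma second_diff_min v y : `|second_diff K v y| <= 2 * A * Num.min 1 (enorm y ^+ 2).
Proof.
have h := second_diff_le v y.
have := mulr_ge0 A0 (sqr_ge0 (enorm y)) => h0.
case: (leP 1 (enorm y ^+ 2)) => _; last lra.
rewrite mulr1 /second_diff (le_trans (ler_normB _ _))// normrM [`|2^-1|]ger0_norm//.
have h1 := KA v.
have h2 := le_trans (ler_normD (K (v + y)) (K (v - y))) (lerD (KA _) (KA _)); lra.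
Qed.

Lemma second_diff_integrable v : nu.-integrable setT (EFin \o second_diff K v).
Proof.
apply: (le_integrable_EFin (msd v) (second_diff_min v)).
by apply: integrableZl_EFin; exact: levy_min_integrable.
Qed.

Lemma measurable_levy_op : measurable_fun setT (levy_op nu K).
Proof.
apply: (measurable_Rintegral_param (sigma_finite_copy levy_sigma_finite) (h := fun vy : 'rV[R]_d * 'rV[R]_d => second_diff K vy.1 vy.2)).
apply: measurable_funB; first by apply: (measurableT_comp mK); exact: measurable_fst.
apply: measurable_funM => //; apply: measurable_funD; apply: (measurableT_comp mK).
  by apply: measurable_addrv; [exact: measurable_fst|exact: measurable_snd].
by apply: measurable_subrv; [exact: measurable_fst|exact: measurable_snd].
Qed.

Section delta.
Variable delta : R.
Hypothesis d0 : 0 < delta.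
Hypothesis d1 : delta <= 1.

Definition far_part : {finite_measure set 'rV[R]_d -> \bar R} :=
  mfrestr (measurable_far delta) (levy_far_fin hnu d0).
Local Notation lam := far_part.

Lemma far_partE (B : set 'rV[R]_d) : far_part B = nu (B `&` far delta).
Proof. by []. Qed.

Lemma integral_far_part (f : 'rV[R]_d -> \bar R) : measurable_fun setT f ->
  (\int[lam]_y f y = \int[nu]_(y in far delta) f y)%E.
Proof.
move=> mf; have mfar := @measurable_far R d delta.
transitivity (\int[lam]_(y in far delta) f y)%E.
  rewrite [RHS]integral_mkcond; apply: ae_eq_integral => //.
    by apply/(measurable_restrictT _ _).1 => //; exact: measurable_funTS.
  exists (~` far delta); split.
  - exact: measurableC.
  - by rewrite /= /mfrestr /mrestr setICl measure0.
  - move=> y /= hy fy; apply: hy => _; rewrite patchE mem_set//.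
apply: eq_measure_integral => B mB BD; rewrite /= /mfrestr /mrestr.
by rewrite setIidl.
Qed.

(** [far delta] is invariant under reflection; this is why [jump], for the
    truncated measure, agrees with the symmetrised integrand of [levy_op]. *)
Lemma far_partN (g : 'rV[R]_d -> R) (B : R) : measurable_fun setT g ->
  (forall y, `|g y| <= B) -> \int[lam]_y g (- y) = \int[lam]_y g y.
Proof.
move=> mg gB; rewrite /Rintegral; congr fine.
have mt : measurable_fun setT (fun x : 'rV[R]_d => - x) by exact: measurable_opprv.
rewrite -[LHS](@integral_pushforward _ _ _ _ _ _ mt _ setT (EFin \o g))//; last 2 first.
- exact/measurable_EFinP.
- by apply: (@bounded_integrable _ _ _ _ B) => //; exact: measurableT_comp.
apply: eq_measure_integral => //= C mC _.
rewrite /pushforward /mfrestr /mrestr; case: hnu => _ _ h _.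
rewrite -[RHS]h; last by apply: measurableI => //; exact: measurable_far.
congr (nu _); apply/seteqP; split=> y /=.
  by move=> [Cy fy]; exists (- y); [split=> //; rewrite /far/= enormN|rewrite opprK].
by move=> [z [Cz fz] <-]; rewrite opprK; split => //; rewrite /far/= enormN.
Qed.

Lemma jumpE v : jump lam K v = \int[nu]_(y in far delta) second_diff K v y.
Proof.
have mD : measurable_fun setT (fun y => K (v + y)).
  by apply: (measurableT_comp mK); exact: measurable_addrv.
have mB : measurable_fun setT (fun y => K (v - y)).
  by apply: (measurableT_comp mK); exact: measurable_subrv.
have bi (g : 'rV[R]_d -> R) : measurable_fun setT g -> (forall y, `|g y| <= A) -> lam.-integrable setT (EFin \o g).
  exact: bounded_integrable.
rewrite jump.unlock; transitivity (\int[lam]_y second_diff K v y); last first.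
  by rewrite /Rintegral integral_far_part//; exact/measurable_EFinP.
rewrite /second_diff RintegralB//; try (by apply: bi).
rewrite RintegralB//; last 2 first.
- exact: bi.
- under eq_fun do rewrite /= mulrC.
  by apply: integrableZl_EFin; apply: integrableD_EFin; exact: bi.
congr (_ - _).
under [RHS]eq_Rintegral do rewrite mulrC.
rewrite RintegralZl//; last by apply: integrableD_EFin; exact: bi.
rewrite RintegralD//; try (by apply: bi).
rewrite -(far_partN mB (fun y => KA _)).
under [X in _ = _ * (_ + X)]eq_Rintegral do rewrite opprK.
by field.
Qed.

(** The part of the operator that comes from jumps shorter than [delta]. *)
Definition near_op v : R := levy_op nu K v - jump lam K v.

Lemma near_opE v : near_op v = \int[nu]_(y in ~` far delta) second_diff K v y.
Proof.
have mfar := @measurable_far R d delta.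
rewrite /near_op /levy_op -/(Rintegral nu setT (second_diff K v)) jumpE.
rewrite -(setUv (far delta)) Rintegral_setU//.
- by rewrite addrAC subrr add0r.
- exact: measurableC.
- by rewrite setUv; exact: second_diff_integrable.
- by apply/disj_setPS => y [].
Qed.

Lemma measurable_near_op : measurable_fun setT near_op.
Proof.
apply: measurable_funB; first exact: measurable_levy_op.
exact: measurable_jump.
Qed.

(** Jumps shorter than [delta <= 1] enlarge the support by at most 1. *)
Lemma near_op_out v : ~ box (r + 1) v -> near_op v = 0.
Proof.
move=> hv; rewrite near_opE.
have -> : \int[nu]_(y in ~` far delta) second_diff K v y = \int[nu]_(y in ~` far delta) 0.
  apply: eq_Rintegral => y; rewrite inE /far/= => /negP; rewrite -ltNge => yd.
  have y1 : box 1 y by apply: (@box_le _ _ (enorm y)); [rewrite (le_trans (ltW yd))|exact: box_enorm].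
  have K0 w : ~ box r w -> K w = 0 by case: hK => _ + _; apply.
  rewrite /second_diff !K0 ?addr0 ?mul0r ?subr0// => h; apply: hv.
  - by rewrite -[v](subrK y); apply: boxD.
  - by rewrite -[v](addrK y); apply: boxD => //; apply/boxN.
  - apply: box_le h; rewrite lerDl//.
by rewrite /Rintegral integral0.
Qed.

(** On short jumps the second differences of [K] are at most [A |y|^2]. *)
Lemma near_op_le e v :
  (\int[nu]_y (Num.min 1 (enorm y ^+ 2) * \1_(~` far delta) y)%:E <= e%:E)%E ->
  `|near_op v| <= A * e.
Proof.
move=> he; have mfar := @measurable_far R d delta.
have mfarC := measurableC mfar.
have isd := integrableS measurableT mfarC (@subsetT _ _) (second_diff_integrable v).
rewrite near_opE -lee_fin EFin_normr_Rintegral//.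
apply: (le_trans (le_abse_integral _ _ _)) => //.
  by case/integrableP: isd.
have mmin : measurable_fun setT (fun y : 'rV[R]_d => Num.min 1 (enorm y ^+ 2)).
  by apply: measurable_minr => //; apply: measurable_funX; exact: measurable_enorm.
have min0 y : 0 <= Num.min 1 (enorm y ^+ 2) by rewrite le_min ler01 sqr_ge0.
apply: (@le_trans _ _ (\int[nu]_(y in ~` far delta) (A * Num.min 1 (enorm y ^+ 2))%:E)%E).
  apply: (@le_integral_EFin _ _ _ nu _ (fun y => `|second_diff K v y|)) => //.
  - by apply: measurable_funTS; exact: measurableT_comp.
  - by apply: measurable_funTS; exact: measurable_funM.
  move=> y; rewrite /far/= => /negP; rewrite -ltNge => yd.
  rewrite normr_ge0/= min_r ?second_diff_le//.
  by rewrite expr_le1 ?enorm_ge0// ltW// (lt_le_trans yd).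
rewrite integralZl_EFin_ge0//; last exact: measurable_funTS.
rewrite EFinM; apply: lee_wpmul2l; first by rewrite lee_fin.
apply: le_trans he; rewrite le_eqVlt; apply/orP; left; apply/eqP.
rewrite integral_mkcond; apply: eq_integral => y _.
by rewrite restrict_EFin/= patchE indicE; case: (_ \in _); rewrite ?mulr1 ?mulr0.
Qed.

End delta.
End fixed_kernel.

Section euler.
Variable p : 'rV[R]_d -> R.
Hypothesis p_cont : continuous p.
Hypothesis p_gt0 : forall x, 0 < p x.
Hypothesis p_harnack : exists2 C : R, 0 < C & forall x z : 'rV[R]_d,
    enorm (z - x) < 1 -> p z <= C * p x.
Hypothesis p_jump : exists C : R, forall x : 'rV[R]_d,
    (\int[nu]_(y in [set y : 'rV[R]_d | 1 <= enorm y]%R) (p (x - y)%R)%:E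
     <= (C * p x)%:E)%E.
Local Notation leb := (lebesgue_rV d).
Local Notation Phi := (weight p).

Let mPhi : measurable_fun setT Phi. Proof. exact: weight_measurable. Qed.
Let Phi0 x : 0 <= Phi x. Proof. by rewrite ltW// weight_gt0. Qed.

Lemma far_part_weight : exists2 C : R, 0 <= C & forall delta (d0 : 0 < delta), delta <= 1 ->
  forall x, (\int[far_part d0]_y (Phi (x - y))%:E <=
    ((fine (nu (far delta)) + C) * Phi x)%:E)%E.
Proof.
have [C C0 hC] := weight_jump hnu p_cont p_gt0 p_harnack p_jump.
exists C => // delta d0 d1 x; rewrite integral_far_part; first exact: hC.
apply/measurable_EFinP; apply: measurableT_comp => //; exact: measurable_subrv.
Qed.

Let lamT delta (d0 : 0 < delta) : far_part d0 setT = (fine (nu (far delta)))%:E.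
Proof. by rewrite far_partE setTI fineK// ge0_fin_numE// levy_far_fin. Qed.

(** The operator is split at jumps of length 1: the long jumps give a dominated
    function, and the short ones a bounded function of bounded support. *)
Lemma dominated_levy_op (r A : R) K x : kernel r A K -> dominated p (levy_op nu K) x.
Proof.
move=> hK; have [C C0 hC] := far_part_weight.
have KA v : `|K v| <= A by have [_ _ /(_ v 0)[]] := hK.
have [C1 C10 h1] := @dominated_jump _ _ p p_cont p_gt0 p_harnack (far_part ltr01) _ _
  (lamT ltr01) C0 (hC _ _ (lexx 1)) K A x (kernel_measurable hK) KA
  (dominated_kernel p_gt0 p_harnack x hK).
have [e he] : exists e : R, (\int[nu]_y (Num.min 1 (enorm y ^+ 2) * \1_(~` far 1) y)%:E <= e%:E)%E.
  have [_ _ _ h] := hnu.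
  have h0 : (0 <= \int[nu]_y (Num.min 1 (enorm y ^+ 2))%:E)%E.
    by apply: integral_ge0 => y _; rewrite lee_fin le_min ler01 sqr_ge0.
  exists (fine (\int[nu]_y (Num.min 1 (enorm y ^+ 2))%:E)); rewrite fineK ?ge0_fin_numE//.
  have mmin : measurable_fun setT (fun y : 'rV[R]_d => Num.min 1 (enorm y ^+ 2)).
    by apply: measurable_minr => //; apply: measurable_funX; exact: measurable_enorm.
  apply: le_integral_EFin => //.
    by apply: measurable_funM => //; apply: measurable_indic; apply: measurableC; exact: measurable_far.
  move=> y _; have m0 : 0 <= Num.min 1 (enorm y ^+ 2) by rewrite le_min ler01 sqr_ge0.
  by rewrite mulr_ge0//= ler_piMr// indicE; case: (_ \in _).
have [C2 C20 h2] := dominated_local p_gt0 p_harnack x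
  (fun v => near_op_le hK ltr01 (lexx 1) v he) (fun v => @near_op_out K r A hK 1 ltr01 (lexx 1) v).
exists (C1 + C2) => [|z]; first exact: addr_ge0.
have -> : levy_op nu K (x - z) = jump (far_part ltr01) K (x - z) + near_op K ltr01 (x - z).
  by rewrite /near_op [RHS]addrC subrK.
by rewrite (le_trans (ler_normD _ _))// mulrDl lerD.
Qed.

Context dZ (Z : measurableType dZ).
Variable mz : {sigma_finite_measure set Z -> \bar R}.
Variable q : Z -> 'rV[R]_d.
Hypothesis mq : measurable_fun setT q.
Implicit Types f : Z -> R.

(** The order of the quantifiers is what the passage to the limit uses: the growth
    rate [C0] and the constant [B] do not depend on [e], while the restriction
    [s * M <= 1] on the step does. *)
Lemma euler_levy : exists2 C0 : R, 0 <= C0 & forall (r A : R) K, 0 <= r -> kernel r A K ->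
  exists2 B : R, 0 <= B & forall e, 0 < e -> exists2 M : R, 0 <= M &
  forall f s, measurable_fun setT f -> (mass mz q p f < +oo)%E -> 0 <= s -> s * M <= 1 ->
  (\int[leb]_x (`|conv mz q f K x - s * conv mz q f (levy_op nu K) x| * Phi x)%:E <=
   (1 + s * C0)%:E * \int[leb]_x (`|conv mz q f K x| * Phi x)%:E +
   (s * B * e)%:E * mass mz q p f)%E.
Proof.
have [C0 C0_ge0 hC0] := far_part_weight.
exists C0 => // r A K r0 hK.
have A0 := kernel_ge0 hK.
have mK := kernel_measurable hK.
have KA v : `|K v| <= A by have [_ _ /(_ v 0)[]] := hK.
have [B B0 hB] := conv_bounded mz mq p_cont p_gt0 p_harnack (addr_ge0 r0 ler01).
exists (B * A) => [|e e0]; first exact: mulr_ge0.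
have [delta [d0 d1 hd]] := levy_small hnu e0.
exists (fine (nu (far delta))) => [|f s mf foo s0 sM]; first by rewrite fine_ge0.
set W := conv mz q f K; set N := conv mz q f (near_op K d0).
set J := conv mz q f (jump (far_part d0) K).
have mnear := measurable_near_op hK d0.
have nearA v := near_op_le hK d0 d1 v hd.
have near0 v := @near_op_out K r A hK delta d0 d1 v.
have mjump := @measurable_jump _ _ (far_part d0) K mK.
have dj x := @dominated_jump _ _ p p_cont p_gt0 p_harnack (far_part d0) _ _
  (lamT d0) C0_ge0 (hC0 _ d0 d1) K A x mK KA (dominated_kernel p_gt0 p_harnack x hK).
have dn x := dominated_local p_gt0 p_harnack x nearA near0.
have E x : conv mz q f (levy_op nu K) x = J x + N x.
  rewrite /J /N conv.unlock -RintegralD//; last 2 first.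
  - exact: (conv_integrable mq p_cont p_gt0 mf foo mjump (dj x)).
  - exact: (conv_integrable mq p_cont p_gt0 mf foo mnear (dn x)).
  by apply: eq_Rintegral => z _; rewrite -mulrDr /near_op [X in _ = _ * X]addrC subrK.
have mW : measurable_fun setT W by exact: measurable_conv.
have mN : measurable_fun setT N by exact: measurable_conv.
have mJ : measurable_fun setT J by exact: measurable_conv.
have mWJ : measurable_fun setT (fun x => `|W x - s * J x| * Phi x).
  apply: measurable_funM => //; apply: measurableT_comp => //.
  by apply: measurable_funB => //; exact: measurable_funM.
have mNP : measurable_fun setT (fun x => `|N x| * Phi x).
  by apply: measurable_funM => //; exact: measurableT_comp.
apply: (@le_trans _ _ (\int[leb]_x (`|W x - s * J x| * Phi x + s * (`|N x| * Phi x))%:E)%E).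
  apply: le_integral_EFin => //.
  - apply: measurable_funM => //; apply: measurableT_comp => //.
    apply: measurable_funB => //; apply: measurable_funM => //.
    exact: (measurable_conv mz mq mf (measurable_levy_op hK)).
  - by apply: measurable_funD => //; exact: measurable_funM.
  move=> x _; rewrite mulr_ge0//= E mulrA -mulrDl ler_wpM2r//.
  rewrite mulrDr opprD addrA (le_trans (ler_normB _ _))// normrM (ger0_norm s0)//.
rewrite integralD_EFin_ge0//; last 3 first.
- exact: measurable_funM.
- by move=> x _; rewrite mulr_ge0.
- by move=> x _; rewrite !mulr_ge0.
apply: leeD.
  exact: (euler_jump mq p_cont p_gt0 p_harnack (lamT d0) C0_ge0 (hC0 _ d0 d1) mf foo hK s0 sM).
rewrite integralZl_EFin_ge0//; last by move=> x _; rewrite mulr_ge0.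
apply: (@le_trans _ _ (s%:E * ((B * (A * e))%:E * mass mz q p f))%E).
  by apply: lee_wpmul2l; [rewrite lee_fin|exact: hB].
rewrite muleA -EFinM le_eqVlt; apply/orP; left; apply/eqP.
by congr (_%:E * _)%E; ring.
Qed.

End euler.

End levy_operator.

(** * Gronwall estimate for the mollified equation *)

(** Discrete Gronwall inequality: [1 + a <= exp a]. *)
Lemma euler_gronwall (R : realType) (F : nat -> R) (a b : R) : 0 <= a -> 0 <= b ->
  F 0%N = 0 -> forall n, (forall j, (j < n)%N -> F j.+1 <= (1 + a) * F j + b) ->
  F n <= n%:R * b * expR (n%:R * a).
Proof.
move=> a0 b0 F0 n; elim: n => [_|n IH hF]; first by rewrite F0 !mul0r.
have {}IH := IH (fun j jn => hF j (ltnW jn)).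
rewrite (le_trans (hF n (ltnSn n)))//.
have ea : 1 + a <= expR a by exact: expR_ge1Dx.
have e1 : 1 <= expR (n.+1%:R * a) by rewrite -[X in X <= _]expR0 ler_expR mulr_ge0.
have -> : n.+1%:R * b * expR (n.+1%:R * a) =
    expR a * (n%:R * b * expR (n%:R * a)) + b * expR (n.+1%:R * a).
  rewrite (_ : expR (n.+1%:R * a) = expR (n%:R * a) * expR a); last first.
    by rewrite -natr1 mulrDl mul1r expRD.
  by rewrite -natr1; ring.
apply: lerD; last by rewrite -[X in X <= _]mulr1 ler_wpM2l.
rewrite (le_trans (ler_wpM2l _ IH)) ?addr_ge0//.
by rewrite ler_wpM2r// !mulr_ge0// expR_ge0.
Qed.

Section time_stepping.
Context {R : realType} {d : nat}.
Variable nu : {measure set 'rV[R]_d -> \bar R}.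
Hypothesis hnu : symmetric_levy_measure nu.
Variable p : 'rV[R]_d -> R.
Hypothesis p_cont : continuous p.
Hypothesis p_gt0 : forall x, 0 < p x.
Hypothesis p_harnack : exists2 C : R, 0 < C & forall x z : 'rV[R]_d,
    enorm (z - x) < 1 -> p z <= C * p x.
Hypothesis p_jump : exists C : R, forall x : 'rV[R]_d,
    (\int[nu]_(y in [set y : 'rV[R]_d | 1 <= enorm y]%R) (p (x - y)%R)%:E
     <= (C * p x)%:E)%E.
Context dZ (Z : measurableType dZ).
Variable mz : {sigma_finite_measure set Z -> \bar R}.
Variables (q : Z -> 'rV[R]_d) (sigma omega : Z -> R).
Hypothesis mq : measurable_fun setT q.
Hypothesis msigma : measurable_fun setT sigma.
Hypothesis momega : measurable_fun setT omega.
Hypothesis omega_oo : (mass mz q p omega < +oo)%E.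
Variables (eta eta' : R -> R) (A : R).
Hypothesis A0 : 0 <= A.
Hypothesis meta : measurable_fun setT eta.
Hypothesis meta' : measurable_fun setT eta'.
Hypothesis eta_bnd : forall s, `|eta s| <= A.
Hypothesis eta'_bnd : forall s, `|eta' s| <= A.
Hypothesis eta_taylor : forall s h, `|eta (s + h) - eta s - h * eta' s| <= A * h ^+ 2.
Variables (r AK : R) (K : 'rV[R]_d -> R).
Hypothesis r0 : 0 <= r.
Hypothesis hK : kernel r AK K.
Local Notation leb := (lebesgue_rV d).
Local Notation Phi := (weight p).
Local Notation conv := (conv mz q).
Local Notation mass := (mass mz q p).

Let f t z := omega z * eta (t - sigma z).
Let f' t z := omega z * eta' (t - sigma z).

Variable tau : R.
Hypothesis equation : forall t x, t <= tau ->
  conv (f' t) K x = - conv (f t) (levy_op nu K) x.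
Hypothesis initial : forall z, f 0 z = 0.

Let mPhi : measurable_fun setT Phi. Proof. exact: weight_measurable. Qed.
Let Phi0 x : 0 <= Phi x. Proof. by rewrite ltW// weight_gt0. Qed.

Let mf t : measurable_fun setT (f t).
Proof. by apply: measurable_funM => //; apply: measurableT_comp => //; exact: measurable_funB. Qed.

Let mf' t : measurable_fun setT (f' t).
Proof. by apply: measurable_funM => //; apply: measurableT_comp => //; exact: measurable_funB. Qed.

Let m := fine (mass omega).

Let mE : mass omega = m%:E.
Proof.
by rewrite fineK// ge0_fin_numE// integral_ge0// => z _; rewrite lee_fin mulr_ge0// ltW.
Qed.

Let m0 : 0 <= m.
Proof. by rewrite fine_ge0// integral_ge0// => z _; rewrite lee_fin mulr_ge0// ltW. Qed.

Let mp : measurable_fun setT p. Proof. exact: continuous_measurable_rV. Qed.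

Let mass_le (g : Z -> R) (B : R) : 0 <= B -> measurable_fun setT g ->
  (forall z, `|g z| <= B * `|omega z|) -> (mass g <= (B * m)%:E)%E.
Proof.
move=> B0 mg gB; rewrite EFinM -mE /mass.
have mop : measurable_fun setT (fun z => `|omega z| * p (q z)).
  by apply: measurable_funM; apply: measurableT_comp.
rewrite -integralZl_EFin_ge0//; last by move=> z _; rewrite mulr_ge0// ltW.
apply: le_integral_EFin => //.
- by apply: measurable_funM; apply: measurableT_comp.
- exact: measurable_funM.
- by move=> z _; rewrite mulr_ge0 ?(ltW (p_gt0 _))//= mulrA ler_wpM2r// ltW.
Qed.

Let f_le t z : `|f t z| <= A * `|omega z|.
Proof. by rewrite normrM mulrC ler_wpM2r. Qed.

Let f'_le t z : `|f' t z| <= A * `|omega z|.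
Proof. by rewrite normrM mulrC ler_wpM2r. Qed.

(** Second-order remainder of the Euler step.  Only [eta] depends on the time, so
    the remainder is at most a multiple of [s^2 |omega|]. *)
Let rho t s z := f (t + s) z - f t z - s * f' t z.

Let rho_le t s z : `|rho t s z| <= A * s ^+ 2 * `|omega z|.
Proof.
rewrite /rho /f /f' (_ : t + s - sigma z = t - sigma z + s); last by ring.
rewrite [X in `|X|](_ : _ = omega z * (eta (t - sigma z + s) - eta (t - sigma z) - s * eta' (t - sigma z))); last by ring.
by rewrite normrM mulrC ler_wpM2r.
Qed.

Let mrho t s : measurable_fun setT (rho t s).
Proof. by apply: measurable_funB; [exact: measurable_funB|exact: measurable_funM]. Qed.

Let mass_fin (g : Z -> R) (B : R) : 0 <= B -> measurable_fun setT g ->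
  (forall z, `|g z| <= B * `|omega z|) -> (mass g < +oo)%E.
Proof. by move=> B0 mg gB; rewrite (le_lt_trans (mass_le B0 mg gB)) ?ltry. Qed.

Let W t := conv (f t) K.

Let mK : measurable_fun setT K. Proof. exact: kernel_measurable hK. Qed.
Let KA v : `|K v| <= AK. Proof. by have [_ _ /(_ v 0)[]] := hK. Qed.
Let K_out v : ~ box r v -> K v = 0. Proof. by case: hK => _ + _; apply. Qed.
Let AK0 : 0 <= AK. Proof. exact: kernel_ge0 hK. Qed.

Let mW t : measurable_fun setT (W t). Proof. exact: measurable_conv. Qed.

Let S t := (\int[leb]_x (`|W t x| * Phi x)%:E)%E.

Let S_ge0 t : (0 <= S t)%E.
Proof. by apply: integral_ge0 => x _; rewrite lee_fin mulr_ge0. Qed.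

Let S_fin t : S t = (fine (S t))%:E.
Proof.
rewrite fineK// ge0_fin_numE//.
have [C C0 hC] := conv_bounded mz mq p_cont p_gt0 p_harnack r0.
have foo := mass_fin A0 (mf t) (f_le t).
rewrite /S (le_lt_trans (hC AK (f t) K (mf t) foo mK KA K_out))//.
rewrite (le_lt_trans (lee_wpmul2l _ (mass_le A0 (mf t) (f_le t))))//.
  by rewrite lee_fin mulr_ge0.
by rewrite -EFinM ltry.
Qed.

Let W_step t s x : t <= tau ->
  W (t + s) x = (W t x - s * conv (f t) (levy_op nu K) x) + conv (rho t s) K x.
Proof.
move=> tt; have dK := dominated_kernel p_gt0 p_harnack x hK.
have i1 := conv_integrable mq p_cont p_gt0 (mf (t + s)) (mass_fin A0 (mf _) (f_le _)) mK dK.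
have i2 := conv_integrable mq p_cont p_gt0 (mf t) (mass_fin A0 (mf _) (f_le _)) mK dK.
have i3 := conv_integrable mq p_cont p_gt0 (mf' t) (mass_fin A0 (mf' _) (f'_le _)) mK dK.
have -> : conv (rho t s) K x = W (t + s) x - W t x - s * conv (f' t) K x.
  rewrite /W conv.unlock -RintegralZl// -RintegralB// -RintegralB//; last 2 first.
  - exact: integrableB_EFin.
  - exact: integrableZl_EFin.
  by apply: eq_Rintegral => z _; rewrite /rho; ring.
by rewrite equation//; ring.
Qed.

(** One step multiplies [S] by [1 + s * C0] and adds [s * Bm * e + D * s^2].  With
    [n + 1] steps of length [s = t / (n + 1)], where [n] is so large that
    [s <= e] and [s * M <= 1], the Gronwall inequality bounds [S t] by a constant
    times [e]. *)
Lemma time_stepping t : 0 <= t -> t <= tau -> S t = 0%E.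
Proof.
move=> t0 tt.
have [C0 C0_ge0 hC0] := euler_levy hnu p_cont p_gt0 p_harnack p_jump mz mq.
have [B B0 hB] := hC0 r AK K r0 hK.
have [C C_ge0 hC] := conv_bounded mz mq p_cont p_gt0 p_harnack r0.
pose Bm := B * (A * m); pose D := C * AK * (A * m).
have Bm0 : 0 <= Bm by rewrite !mulr_ge0.
have D0 : 0 <= D by rewrite !mulr_ge0.
have step e : 0 < e -> exists2 M : R, 0 <= M & forall t' s, t' <= tau -> 0 <= s -> s * M <= 1 ->
    fine (S (t' + s)) <= (1 + s * C0) * fine (S t') + (s * Bm * e + D * s ^+ 2).
  move=> e0; have [M M0 hM] := hB e e0; exists M => // t' s tt' s0 sM.
  have foo := mass_fin A0 (mf t') (f_le t').
  have roo := mass_fin (mulr_ge0 A0 (sqr_ge0 s)) (mrho t' s) (rho_le t' s).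
  have mL := measurable_levy_op hnu hK.
  have mcL : measurable_fun setT (conv (f t') (levy_op nu K)) by exact: measurable_conv.
  have mcr : measurable_fun setT (conv (rho t' s) K) by exact: measurable_conv.
  have m1 : measurable_fun setT (fun x => `|W t' x - s * conv (f t') (levy_op nu K) x| * Phi x).
    apply: measurable_funM => //; apply: measurableT_comp => //.
    by apply: measurable_funB => //; exact: measurable_funM.
  have m2 : measurable_fun setT (fun x => `|conv (rho t' s) K x| * Phi x).
    by apply: measurable_funM => //; exact: measurableT_comp.
  have h1 : (S (t' + s) <= \int[leb]_x (`|W t' x - s * conv (f t') (levy_op nu K) x| * Phi x
      + `|conv (rho t' s) K x| * Phi x)%:E)%E.
    apply: le_integral_EFin => //.
    - by apply: measurable_funM => //; exact: measurableT_comp.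
    - exact: measurable_funD.
    move=> x _; rewrite mulr_ge0//= -mulrDl ler_wpM2r// W_step//.
    exact: ler_normD.
  have h2 := hM (f t') s (mf t') foo s0 sM.
  have h3 := hC AK (rho t' s) K (mrho t' s) roo mK KA K_out.
  rewrite -lee_fin -S_fin (le_trans h1)// integralD_EFin_ge0//; last 2 first.
  - by move=> x _; rewrite mulr_ge0.
  - by move=> x _; rewrite mulr_ge0.
  rewrite EFinD; apply: (@le_trans _ _ (((1 + s * C0) * fine (S t'))%:E + (s * B * e * (A * m))%:E +
      (C * AK * (A * s ^+ 2 * m))%:E)%E); last first.
    rewrite -!EFinD lee_fin -addrA lerD2l /Bm /D.
    by rewrite le_eqVlt; apply/orP; left; apply/eqP; ring.
  apply: leeD; last first.
    rewrite (le_trans h3)// [X in (_ <= X)%E]EFinM; apply: lee_wpmul2l; first by rewrite lee_fin mulr_ge0.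
    by apply: mass_le => //; rewrite mulr_ge0// sqr_ge0.
  rewrite (le_trans h2)// -/(S t') [in X in (X <= _)%E]S_fin -EFinM.
  apply: leeD2l; rewrite [X in (_ <= X)%E]EFinM; apply: lee_wpmul2l.
    by rewrite lee_fin !mulr_ge0// ltW.
  exact: mass_le.
rewrite S_fin; congr EFin; apply/eqP; rewrite eq_le fine_ge0// andbT.
pose Q := t * (Bm + D) * expR (t * C0).
have Q0 : 0 <= Q by rewrite !mulr_ge0 ?addr_ge0 ?expR_ge0.
suff hQ e : 0 < e -> fine (S t) <= Q * e.
  apply/ler_addgt0Pr => e e0.
  have Q1 : 0 < Q + 1 by rewrite ltr_wpDl.
  rewrite (le_trans (hQ (e / (Q + 1)) _)) ?divr_gt0//.
  by rewrite add0r mulrCA ger_pMr// ler_pdivrMr// mul1r lerDl.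
move=> e0; have [M M0 hM] := step e e0.
pose n := (Num.truncn (t * (M + e^-1))).
have hn : t * (M + e^-1) <= n.+1%:R.
  by rewrite ltW// truncnS_gt.
pose s := t / n.+1%:R.
have s0 : 0 <= s by rewrite divr_ge0.
have sM : s * M <= 1.
  rewrite /s mulrAC ler_pdivrMr// mul1r (le_trans _ hn)// ler_wpM2l// lerDl invr_ge0 ltW//.
have se : s <= e.
  rewrite /s ler_pdivrMr// mulrC -ler_pdivrMr// (le_trans _ hn)// ler_wpM2l// lerDr//.
have snt : n.+1%:R * s = t by rewrite /s mulrC divfK// pnatr_eq0.
have : fine (S (n.+1%:R * s)) <=
    n.+1%:R * (s * Bm * e + D * s ^+ 2) * expR (n.+1%:R * (s * C0)).
  apply: (@euler_gronwall _ (fun j => fine (S (j%:R * s)))).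
  - by rewrite mulr_ge0.
  - by rewrite addr_ge0 ?mulr_ge0// ltW.
  - rewrite mul0r /S (_ : (fun x => (`|W 0 x| * Phi x)%:E) = cst 0%E) ?integral0//.
    apply/funext => x; rewrite /W conv.unlock.
    under eq_Rintegral do rewrite initial mul0r.
    by rewrite /Rintegral integral0 normr0 mul0r.
  - move=> j jn; rewrite -[j.+1]addn1 natrD mulrDl mul1r; apply: hM => //.
    by rewrite (le_trans _ tt)// -snt ler_wpM2r// ler_nat ltnW.
rewrite mulrA snt => /le_trans; apply.
rewrite (_ : n.+1%:R * (s * Bm * e + D * s ^+ 2) = (n.+1%:R * s) * (Bm * e + D * s)); last by ring.
rewrite snt /Q [X in _ <= X]mulrAC ler_wpM2r ?expR_ge0//.
by rewrite -[X in _ <= X]mulrA ler_wpM2l// mulrDl lerD2l ler_wpM2l.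
Qed.

End time_stepping.

(** * The very weak formulation tested on tensor products *)

Section test_functions.
Context {R : realType} {d : nat}.
Local Notation Z := ('rV[R]_d * R)%type.

Lemma flat_alg_tensor c c' (a b : 'rV[R]_d) (alpha beta : R) :
  @flat_alg R Z (fun z => bumpV c a b z.1 * bump c' alpha beta z.2).
Proof.
apply: flat_alg_mul.
  apply: (@flat_alg_prod R Z _ _ (fun i z => bump c (a ord0 i) (b ord0 i) (z.1 ord0 i))) => i.
  apply: (@flat_alg_bump R Z c _ _ (fun z => z.1 ord0 i) (fun z => z.1 ord0 i)).
    move=> z; apply: (@continuous_comp _ _ _ fst (fun v : 'rV[R]_d => v ord0 i)).
      exact: cvg_fst.
    exact: coord_continuous.
  by move=> z v h /=; rewrite !mxE.
apply: (@flat_alg_bump R Z c' _ _ snd snd) => //.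
by move=> z; exact: cvg_snd.
Qed.

(** The compact set is cut at time 0: only nonnegative times count, and [alpha]
    may be negative. *)
Lemma test_fun_tensor c c' (a b : 'rV[R]_d) (alpha beta T : R) :
  0 <= c -> 0 <= c' -> beta < T ->
  test_fun T (fun z : Z => bumpV c a b z.1 * bump c' alpha beta z.2).
Proof.
move=> c0 c'0 bT; split; first exact/flat_alg_smooth/flat_alg_tensor.
exists ([set v : 'rV[R]_d | forall i, `[a ord0 i, b ord0 i]%classic (v ord0 i)] `*`
  `[0, beta]%classic); first split.
- apply: compact_setX; last exact: segment_compact.
  apply: (@rV_compact R d (fun i => `[a ord0 i, b ord0 i]%classic)) => i.
  exact: segment_compact.
- move=> z [_] /=; rewrite in_itv/= => /andP[-> h] /=; exact: (le_lt_trans h).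
move=> z z0 nK.
have [hs|hs] := leP beta z.2; first by rewrite [X in _ * X]bump_out ?mulr0//; right.
rewrite bumpV_out ?mul0r// => h; apply: nK; split => /=.
  by move=> i; rewrite in_itv/=; have /andP[/ltW -> /ltW ->] := h i.
by rewrite in_itv/= z0 ltW.
Qed.

End test_functions.

Section weak_formulation.
Context {R : realType} {d : nat}.
Variable nu : {measure set 'rV[R]_d -> \bar R}.
Hypothesis hnu : symmetric_levy_measure nu.
Variable p : 'rV[R]_d -> R.
Hypothesis p_cont : continuous p.
Hypothesis p_gt0 : forall x, 0 < p x.
Hypothesis p_harnack : exists2 C : R, 0 < C & forall x z : 'rV[R]_d,
    enorm (z - x) < 1 -> p z <= C * p x.
Hypothesis p_jump : exists C : R, forall x : 'rV[R]_d,
    (\int[nu]_(y in [set y : 'rV[R]_d | 1 <= enorm y]%R) (p (x - y)%R)%:E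
     <= (C * p x)%:E)%E.
Local Notation leb := (lebesgue_rV d).
Local Notation Z := ('rV[R]_d * measurableTypeR R)%type.
(** The product of the Lebesgue measures, with its sigma-finiteness attached. *)
Definition spacetime : {sigma_finite_measure set Z -> \bar R} :=
  sigma_finite_copy (product_sigma_finite (lebesgue_rV d) (@lebesgue_measure R)).
Local Notation mu := spacetime.

(** Truncation to times before [tau] makes the mass finite; it does not affect the
    equation tested on functions supported in times at most [tau]. *)
Definition slab (tau : R) (u : 'rV[R]_d * R -> R) (z : Z) : R :=
  if 0 < z.2 < tau then u z else 0.

Let mp : measurable_fun setT p. Proof. exact: continuous_measurable_rV. Qed.

Lemma slab_restrict tau u :
  slab tau u = (u \_ (setT `*` `]0, tau[)) :> (Z -> R).
Proof.
apply/funext => z; rewrite /slab patchE.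
rewrite (_ : (z \in _) = (0 < z.2 < tau))//.
by apply/idP/idP; rewrite inE /= in_itv/=; [case|].
Qed.

Lemma measurable_slab (T tau : R) u : tau <= T -> L1loc_L1 T p u ->
  measurable_fun setT (slab tau u).
Proof.
move=> tT [mu_ _]; rewrite slab_restrict.
have mD : measurable (setT `*` `]0, tau[ : set Z) by apply: measurableX.
have mD' : measurable (setT `*` `]0, T[ : set Z) by apply: measurableX.
have mu2 : measurable_fun (setT `*` `]0, T[ : set Z) (u : Z -> R) by exact: mu_.
have mu3 : measurable_fun (setT `*` `]0, tau[ : set Z) (u : Z -> R).
  apply: (measurable_funS mD' _ mu2).
  by move=> z [_] /=; rewrite !in_itv/= => /andP[-> h]; split => //; exact: lt_le_trans tT.
exact: ((measurable_restrictT _ mD).1 mu3).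
Qed.

Lemma mass_slab (T tau : R) u : 0 < tau < T -> L1loc_L1 T p u ->
  (mass mu fst p (slab tau u) < +oo)%E.
Proof.
move=> /andP[t0 tT] hu; have [_ /(_ tau)] := hu; rewrite t0 tT => /(_ isT) h.
have ms := measurable_slab (ltW tT) hu.
apply: le_lt_trans h; rewrite /mass.
rewrite (_ : integral _ _ _ = \int[(lebesgue_rV d \x @lebesgue_measure R)%E]_z
  (`|slab tau u z| * p z.1)%:E)%E//.
rewrite fubini_tonelli2//=; last 2 first.
- apply/measurable_EFinP; apply: measurable_funM; first exact: measurableT_comp.
  by apply: measurableT_comp => //; exact: measurable_fst.
- by move=> z; rewrite lee_fin mulr_ge0// ltW.
rewrite [X in (_ <= X)%E]integral_mkcond.
rewrite le_eqVlt; apply/orP; left; apply/eqP; apply: eq_integral => t _.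
rewrite patchE /fubini_G.
rewrite (_ : (t \in _) = (0 < t < tau)); last first.
  by apply/idP/idP; rewrite inE /= in_itv.
case: ifPn => ht; first by apply: eq_integral => x _; rewrite /slab/= ht.
rewrite integral0_eq// => x _; by rewrite /slab/= (negPf ht) normr0 mul0r.
Qed.

Lemma levy_op_reflect (K : 'rV[R]_d -> R) (x z : 'rV[R]_d) (s : R) r A : kernel r A K ->
  levy_op nu (fun y => K (x - y) * s) z = s * levy_op nu K (x - z).
Proof.
move=> hK; have i := second_diff_integrable hnu hK (x - z).
rewrite /levy_op -RintegralZl//; apply: eq_Rintegral => y _.
rewrite /second_diff (_ : x - (z + y) = x - z - y); last by rewrite opprD addrA.
rewrite (_ : x - (z - y) = x - z + y); last by rewrite opprB addrA addrAC.
by field.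
Qed.

(** The very weak formulation tested on
    [bumpV c a b (x - z) * bump c' alpha beta s], rewritten as an identity between
    mollified functions.  The right-hand side depends on [mu0] only, so it
    disappears from the difference of two solutions. *)
Lemma weak_slab (T tau : R) mu0 u (c c' : R) (a b x : 'rV[R]_d)
    (alpha beta : R) (g : R -> R) (A : R) :
  0 < tau < T -> beta <= tau -> 0 <= c -> 0 <= c' ->
  L1loc_L1 T p u -> very_weak_solution nu T mu0 u ->
  measurable_fun setT g -> (forall s, `|g s| <= A) ->
  (forall s : R, is_derive s 1 (bump c' alpha beta) (g s)) ->
  (forall s, beta <= s -> g s = 0) ->
  conv mu fst (fun z => slab tau u z * g z.2) (bumpV c a b) x
  - conv mu fst (fun z => slab tau u z * bump c' alpha beta z.2)
      (levy_op nu (bumpV c a b)) x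
  = - mu0 (fun z => bumpV c (x - b) (x - a) z * bump c' alpha beta 0).
Proof.
move=> tauT btau c0 c'0 hu hw mg gA dg g0.
have [r [AK hK]] := bumpV_kernel a b c0.
set K := bumpV c a b in hK *.
set eta := bump c' alpha beta.
have /andP[tau0 tT] := tauT.
have ms := measurable_slab (ltW tT) hu; have soo := mass_slab tauT hu.
have meta : measurable_fun setT eta.
  apply: continuous_measurable_fun; exact: flat_alg_continuous (flat_alg_bump1 _ _ _).
have etab s : `|eta s| <= 1 by rewrite ger0_norm ?bump_ge0// bump_le1.
have mtime (k : R -> R) : measurable_fun setT k -> measurable_fun setT (fun z : Z => k z.2).
  by move=> mk; apply: measurableT_comp => //; exact: measurable_snd.
have mfg : measurable_fun setT (fun z : Z => slab tau u z * g z.2).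
  by apply: measurable_funM => //; exact: mtime.
have mfe : measurable_fun setT (fun z : Z => slab tau u z * eta z.2).
  by apply: measurable_funM => //; exact: mtime.
have fgoo := mass_mul (@measurable_fst _ _ _ _) p_cont p_gt0 ms soo (mtime g mg) (fun z => gA z.2).
have feoo := mass_mul (@measurable_fst _ _ _ _) p_cont p_gt0 ms soo (mtime eta meta) (fun z => etab z.2).
have mK := kernel_measurable hK.
have mL := measurable_levy_op hnu hK.
have i1 := conv_integrable (@measurable_fst _ _ _ _) p_cont p_gt0 mfg fgoo mK (dominated_kernel p_gt0 p_harnack x hK).
have i2 := conv_integrable (@measurable_fst _ _ _ _) p_cont p_gt0 mfe feoo mL
  (dominated_levy_op hnu p_cont p_gt0 p_harnack p_jump x hK).
pose h (z : Z) := slab tau u z * g z.2 * K (x - z.1) - slab tau u z * eta z.2 * levy_op nu K (x - z.1).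
have ih : mu.-integrable setT (EFin \o h) by exact: integrableB_EFin.
rewrite conv.unlock -RintegralB//.
transitivity (\int[@lebesgue_measure R]_t \int[leb]_y h (y, t)).
  exact/esym/(@Rintegral_prod21 _ _ _ _ _ leb (@lebesgue_measure R) h ih).
have tf := @test_fun_tensor R d c c' (x - b) (x - a) alpha beta T c0 c'0 (le_lt_trans btau tT).
have := hw _ tf; rewrite /= => <-; rewrite [RHS]Rintegral_mkcond; apply: eq_Rintegral => t _; rewrite patchE.
rewrite (_ : (t \in _) = (0 < t < T)); last first.
  by apply/idP/idP; rewrite inE /= in_itv.
case: ifPn => tT'; last first.
  transitivity (\int[leb]_y (0 : R)); last by rewrite /Rintegral integral0.
  apply: eq_Rintegral => y _; rewrite /h /slab/= ifF ?mul0r ?subr0//.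
  by apply: contraNF tT' => /andP[-> /=]/lt_trans; apply.
apply: eq_Rintegral => y _.
rewrite -!bumpV_reflect -/K -/eta.
have -> : (fun s : R => K (x - y) * eta s)^`()%classic t = K (x - y) * g t.
  have [_ dZ] := @is_deriveZ _ _ _ _ (K (x - y)) _ _ _ (dg t).
  by rewrite derive1E; exact: dZ.
under [X in levy_op _ X]eq_fun do rewrite -bumpV_reflect -/K.
rewrite (levy_op_reflect _ _ _ hK) /h /=.
have -> : slab tau u (y, t) * g t = u (y, t) * g t.
  rewrite /slab/=; case: ifPn => // /nandP[]; first by have /andP[-> _] := tT'.
  by rewrite -leNgt => tt; rewrite (g0 t (le_trans btau tt)) !mulr0.
have -> : slab tau u (y, t) * eta t = u (y, t) * eta t.
  rewrite /slab/=; case: ifPn => // /nandP[]; first by have /andP[-> _] := tT'.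
  rewrite -leNgt => tt; rewrite /eta bump_out ?mulr0//; right.
  exact: le_trans btau tt.
by ring.
Qed.

End weak_formulation.

(** * Vanishing mollified functions *)

Section conv_vanishing.
Context {R : realType} {d : nat} dZ (Z : measurableType dZ).
Variable mz : {sigma_finite_measure set Z -> \bar R}.
Variable q : Z -> 'rV[R]_d.
Hypothesis mq : measurable_fun setT q.
Variable p : 'rV[R]_d -> R.
Hypothesis p_cont : continuous p.
Hypothesis p_gt0 : forall x, 0 < p x.
Hypothesis p_harnack : exists2 C : R, 0 < C & forall x z : 'rV[R]_d,
    enorm (z - x) < 1 -> p z <= C * p x.
Local Notation leb := (lebesgue_rV d).
Local Notation Phi := (weight p).
Local Notation conv := (conv mz q).
Local Notation mass := (mass mz q p).

Let mp : measurable_fun setT p. Proof. exact: continuous_measurable_rV. Qed.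
Let mPhi : measurable_fun setT Phi. Proof. exact: weight_measurable. Qed.
Let Phi0 x : 0 <= Phi x. Proof. by rewrite ltW// weight_gt0. Qed.

(** The first differences of [K] near [x0] are supported in the box of radius
    [r + 1], on which [p] is bounded below. *)
Lemma conv_lipschitz (f : Z -> R) (K : 'rV[R]_d -> R) (r A : R) x0 :
  measurable_fun setT f -> (mass f < +oo)%E -> kernel r A K ->
  exists2 L : R, 0 <= L & forall x, box 1 (x - x0) ->
    `|conv f K x - conv f K x0| <= L * enorm (x - x0).
Proof.
move=> mf foo hK; have [C C0 hC] := harnack_box p_harnack (r + 1).
have A0 := kernel_ge0 hK; have mK := kernel_measurable hK.
have K_out v : ~ box r v -> K v = 0 by case: hK => _ + _; apply.
have px0 := p_gt0 x0.
pose B := A * (C / p x0).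
have B0 : 0 <= B by rewrite !mulr_ge0 ?invr_ge0// ltW.
have i := mass_integrable mq p_cont p_gt0 mf foo.
have mpq : measurable_fun setT (fun z => `|f z| * p (q z)).
  by apply: measurable_funM; apply: measurableT_comp.
exists (B * \int[mz]_z (`|f z| * p (q z))).
  by rewrite mulr_ge0// Rintegral_ge0// => z _; rewrite mulr_ge0// ltW.
move=> x xx0.
have dif z : `|K (x - z) - K (x0 - z)| <= B * enorm (x - x0) * p z.
  have [bz|bz] := pselect (box (r + 1) (x0 - z)).
    have [_ _ /(_ (x0 - z) (x - x0))[_ + _]] := hK.
    rewrite (_ : x0 - z + (x - x0) = x - z); last by rewrite addrC addrA subrK.
    move=> /le_trans; apply.
    rewrite (_ : B * _ * _ = A * enorm (x - x0) * (C * p z / p x0)); last by rewrite /B; ring.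
    rewrite ler_peMr ?mulr_ge0 ?enorm_ge0//.
    by rewrite ler_pdivlMr// mul1r hC.
  have -> : K (x0 - z) = 0.
    by apply: K_out => h; apply: bz; apply: box_le h; rewrite lerDl.
  have -> : K (x - z) = 0.
    apply: K_out => h; apply: bz; have := boxD h ((boxN _ _).2 xx0).
    by rewrite opprB [X in box _ X]addrC addrA subrK.
  by rewrite subrr normr0 mulr_ge0 ?(ltW (p_gt0 _))// mulr_ge0// enorm_ge0.
rewrite conv.unlock -RintegralB//; last 2 first.
- exact: conv_integrable (dominated_kernel p_gt0 p_harnack x hK).
- exact: conv_integrable (dominated_kernel p_gt0 p_harnack x0 hK).
have mKx y : measurable_fun setT (fun z => f z * K (y - q z)).
  by apply: measurable_funM => //; apply: measurableT_comp => //; exact: measurable_subrv.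
have ii : mz.-integrable setT (EFin \o (fun z => f z * K (x - q z) - f z * K (x0 - q z))).
  by apply: integrableB_EFin; apply: (conv_integrable mq p_cont p_gt0 mf foo mK);
    exact: dominated_kernel hK.
apply: (le_trans (le_normr_Rintegral measurableT ii)).
rewrite mulrAC -RintegralZl//; apply: le_Rintegral => //.
- by apply: integrable_norm ii.
- exact: integrableZl_EFin.
move=> z _; rewrite -mulrBr normrM.
by rewrite (le_trans (ler_wpM2l _ (dif (q z))))// mulrCA.
Qed.

(** A mollified function is continuous, so it vanishes everywhere once it vanishes
    almost everywhere.  Otherwise it would be bounded below, as well as the
    weight, on a box of positive measure. *)
Lemma conv_eq0 (f : Z -> R) (K : 'rV[R]_d -> R) (r A : R) :
  measurable_fun setT f -> (mass f < +oo)%E -> kernel r A K ->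
  (\int[leb]_x (`|conv f K x| * Phi x)%:E = 0)%E -> forall x, conv f K x = 0.
Proof.
move=> mf foo hK I0 x0; apply/eqP/negPn/negP => W0.
have [L L0 hL] := conv_lipschitz x0 mf foo hK.
have mK := kernel_measurable hK.
have w0 : 0 < `|conv f K x0| by rewrite normr_gt0.
set w := `|conv f K x0| in w0.
pose M := L * Num.sqrt d%:R + 1.
have M0 : 0 < M by rewrite ltr_wpDl// mulr_ge0// sqrtr_ge0.
pose rho := Num.min 1 (w / 2 / M).
have rho0 : 0 < rho by rewrite lt_min ltr01 !divr_gt0.
have [C C0 hC] := harnack_box p_harnack 1.
have [c c0 hc] := weight_ge p_cont p_gt0 p_harnack.
pose D : set 'rV[R]_d := [set x | box rho (x - x0)].
have mD : measurable D by exact: measurable_boxrv.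
have LD : leb D = ((2 * rho) ^+ d)%:E by apply: lebesgue_rV_ball; exact: ltW.
pose k := w / 2 * (c * (p x0 / C)).
have k0 : 0 < k by rewrite !mulr_gt0 ?invr_gt0.
have mW : measurable_fun setT (fun x => `|conv f K x| * Phi x).
  by apply: measurable_funM => //; apply: measurableT_comp => //; exact: measurable_conv.
have : (\int[leb]_x (k * \1_D x)%:E <= 0)%E.
  rewrite -I0; apply: (@le_integral_EFin _ _ _ leb setT (fun x => k * \1_D x)) => //.
    by apply: measurable_funM => //; exact: measurable_indic.
  move=> x _; rewrite indicE; have [xD|_] := boolP (x \in D); last first.
    by rewrite mulr0 lexx mulr_ge0.
  move: xD; rewrite inE mulr1 (ltW k0)/= => xD.
  have x1 : box 1 (x - x0) by apply: box_le xD; rewrite ge_min lexx.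
  have := hL x x1; rewrite -/w => hx.
  have ex : enorm (x - x0) <= Num.sqrt d%:R * rho.
    rewrite (le_trans (enorm_le_coord xD))// sqrtrM// sqrtr_sqr ger0_norm//.
    exact: ltW.
  apply: ler_pM; rewrite ?divr_ge0 ?mulr_ge0 ?(ltW w0) ?(ltW c0) ?(ltW C0) ?(ltW (p_gt0 _)) ?invr_ge0 ?(ltW C0)//.
    have h1 : L * enorm (x - x0) <= w / 2.
      apply: (@le_trans _ _ (M * rho)).
        rewrite (le_trans (ler_wpM2l L0 ex))// mulrA ler_wpM2r ?(ltW rho0)//.
        by rewrite lerDl.
      by rewrite mulrC -ler_pdivlMr// ge_min lexx orbT.
    have := ler_normB (conv f K x) (conv f K x - conv f K x0).
    rewrite opprB addrCA subrr addr0 -/w; lra.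
  rewrite (le_trans _ (hc x))// ler_wpM2l ?(ltW c0)//.
  rewrite ler_pdivrMr// mulrC hC//.
  by rewrite -boxN opprB.
rewrite integral_scale_indic ?(ltW k0)//; apply/negP; rewrite -ltNge.
rewrite (_ : (k%:E * leb D)%E = (k * (2 * rho) ^+ d)%:E).
  by rewrite lte_fin mulr_gt0// exprn_gt0// mulr_gt0.
by rewrite [RHS]EFinM; congr (_ * _)%E; exact: LD.
Qed.

End conv_vanishing.

(** * Functions whose integrals over boxes vanish *)

Section density.
Context d (T : measurableType d) (R : realType).
Variables (mu : {measure set T -> \bar R}).

(** The proofs are arguments so that the measure structure can be attached to
    [density mf f0]. *)
Definition density (f : T -> R) (mf : measurable_fun setT f)
  (f0 : forall x, 0 <= f x) : set T -> \bar R :=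
  fun B => (\int[mu]_(x in B) (f x)%:E)%E.

Variables (f : T -> R) (mf : measurable_fun setT f) (f0 : forall x, 0 <= f x).

Let density0 : density mf f0 set0 = 0%E.
Proof. by rewrite /density integral_set0. Qed.

Let density_ge0 B : (0 <= density mf f0 B)%E.
Proof. by apply: integral_ge0 => x _; rewrite lee_fin. Qed.

Let density_sigma_additive : semi_sigma_additive (density mf f0).
Proof.
apply: semi_sigma_additive_nng_induced; first exact/measurable_EFinP.
by move=> x; rewrite lee_fin.
Qed.

HB.instance Definition _ := isMeasure.Build _ _ _ (density mf f0)
  density0 density_ge0 density_sigma_additive.

End density.

Section boxes.
Context {R : realType} {d : nat}.
Local Notation Z := ('rV[R]_d * measurableTypeR R)%type.

Definition obox (a b : 'rV[R]_d) (alpha beta : R) : set Z :=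
  [set z : 'rV[R]_d * R | (forall i, a ord0 i < z.1 ord0 i < b ord0 i) /\ alpha < z.2 < beta].

Definition oboxes : set (set Z) :=
  [set B | exists a b alpha beta, B = obox a b alpha beta].

Definition cube (k : nat) : set Z :=
  obox (const_mx (- k%:R)) (const_mx k%:R) (- k%:R) k%:R.

Lemma measurable_obox a b alpha beta : measurable (obox a b alpha beta).
Proof.
have -> : obox a b alpha beta = \bigcap_(i in [set: 'I_d])
    (((fun v : 'rV[R]_d => v ord0 i) @^-1` `]a ord0 i, b ord0 i[) `*` setT) `&`
    (setT `*` `]alpha, beta[).
  apply/seteqP; split=> [z [h1 h2]|z [h1 [_ h2]]]; split.
  - by move=> i _; split => //=; rewrite in_itv/= h1.
  - by split => //=; rewrite in_itv.
  - by move=> i; have [/= + _] := h1 i I; rewrite in_itv.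
  - by move: h2; rewrite /= in_itv.
apply: measurableI; last by apply: measurableX.
apply: fin_bigcap_measurable => // i _; apply: measurableX => //.
rewrite -[X in measurable X]setTI; apply: measurable_coord => //.
Qed.

Lemma oboxes_setI : setI_closed oboxes.
Proof.
move=> _ _ [a [b [s [t ->]]]] [a' [b' [s' [t' ->]]]].
exists (\row_i Num.max (a ord0 i) (a' ord0 i)), (\row_i Num.min (b ord0 i) (b' ord0 i)),
  (Num.max s s'), (Num.min t t').
apply/seteqP; split => z /=.
  move=> [[h1 h2] [h3 h4]]; split => [i|].
    by rewrite !mxE gt_max lt_min; have /andP[-> ->] := h1 i; have /andP[-> ->] := h3 i.
  by rewrite gt_max lt_min; have /andP[-> ->] := h2; have /andP[-> ->] := h4.
move=> [h1 h2]; split; split.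
- by move=> i; have := h1 i; rewrite !mxE gt_max lt_min => /andP[/andP[-> _] /andP[-> _]].
- by move: h2; rewrite gt_max lt_min => /andP[/andP[-> _] /andP[-> _]].
- by move=> i; have := h1 i; rewrite !mxE gt_max lt_min => /andP[/andP[_ ->] /andP[_ ->]].
- by move: h2; rewrite gt_max lt_min => /andP[/andP[_ ->] /andP[_ ->]].
Qed.

Lemma bounded_nat (z : Z) : exists k : nat,
  (forall i, `|z.1 ord0 i| < k%:R) /\ `|z.2 : R| < k%:R.
Proof.
pose S := \sum_i `|z.1 ord0 i| + `|z.2 : R|.
have hS : S < (Num.truncn S).+1%:R by rewrite truncnS_gt.
exists (Num.truncn S).+1; split=> [i|]; apply: le_lt_trans hS; rewrite /S.
  by rewrite (bigD1 i)//= -addrA lerDl addr_ge0// sumr_ge0.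
by rewrite lerDr sumr_ge0.
Qed.

Lemma cube_cover : \bigcup_k cube k = setT.
Proof.
apply/seteqP; split => // z _; have [k [h1 h2]] := bounded_nat z.
exists k => //; split => [i|]; rewrite ?mxE -ltr_norml//; exact: h1.
Qed.

(** The identity from the sigma-algebra generated by the boxes to the Borel one is
    measurable because its coordinates are: an interval in one coordinate is a
    countable union of boxes. *)
Lemma oboxes_generate : @measurable _ Z = <<s oboxes >>.
Proof.
apply/seteqP; split; last first.
  apply: smallest_sub; first exact: sigma_algebra_measurable.
  by move=> _ [a [b [s [t ->]]]]; exact: measurable_obox.
pose T := g_sigma_algebraType oboxes.
have mG a b s t : @measurable _ T (obox a b s t).
  by apply: sub_sigma_algebra; exists a, b, s, t.
have mid : measurable_fun setT (id : T -> Z).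
  apply/measurable_fun_pairP; split.
    apply: measurable_fun_rV => i.
    apply: (measurability _ (RGenOpens.measurableE R)) => _ [_ [s [t ->] <-]].
    rewrite setTI.
    rewrite (_ : _ @^-1` _ = \bigcup_k obox
      (\row_j if j == i then s else - k%:R) (\row_j if j == i then t else k%:R)
      (- k%:R) k%:R); first by apply: bigcupT_measurable => k; exact: mG.
    apply/seteqP; split => z /=.
      rewrite in_itv/= => hz; have [k [h1 h2]] := bounded_nat z.
      exists k => //; split => [j|]; last by rewrite -ltr_norml.
      by rewrite !mxE; case: eqP => [->//|_]; rewrite -ltr_norml h1.
    by move=> [k _ [/(_ i) + _]]; rewrite !mxE eqxx in_itv.
  apply: (measurability _ (RGenOpens.measurableE R)) => _ [_ [s [t ->] <-]].
  rewrite setTI (_ : _ @^-1` _ = \bigcup_k obox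
      (const_mx (- k%:R)) (const_mx k%:R) s t);
      first by apply: bigcupT_measurable => k; exact: mG.
  apply/seteqP; split => z /=.
    rewrite in_itv/= => hz; have [k [h1 h2]] := bounded_nat z.
    by exists k => //; split => [j|//]; rewrite !mxE -ltr_norml h1.
  by move=> [k _ [_ +]]; rewrite in_itv.
move=> B mB; have := mid measurableT B mB; by rewrite setTI.
Qed.

(** The positive and negative parts of [w] are densities of two measures that
    agree on boxes, hence on the set where [w] is positive, where the second one
    vanishes. *)
Lemma ae_eq0_of_oboxes (mu : {measure set Z -> \bar R}) (w : Z -> R) :
  measurable_fun setT w ->
  (forall a b s t, mu.-integrable setT (EFin \o (fun z => w z * \1_(obox a b s t) z))) ->
  (forall a b s t, \int[mu]_z (w z * \1_(obox a b s t) z) = 0) ->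
  {ae mu, forall z, w z = 0}.
Proof.
move=> mw iw w0.
pose wp z := Num.max (w z) 0; pose wn z := Num.max (- w z) 0.
have mwp : measurable_fun setT wp by exact: measurable_maxr.
have mwn : measurable_fun setT wn by apply: measurable_maxr => //; exact: measurableT_comp.
have wp0 z : 0 <= wp z by rewrite le_max lexx orbT.
have wn0 z : 0 <= wn z by rewrite le_max lexx orbT.
have wE z : w z = wp z - wn z.
  by rewrite /wp /wn; have [h|h] := leP (w z) 0; [rewrite max_l ?oppr_ge0|rewrite max_r ?oppr_le0 ?ltW] => //; ring.
have wpw z : wp z <= `|w z| by rewrite ge_max ler_norm normr_ge0.
have wnw z : wn z <= `|w z| by rewrite ge_max -normrN ler_norm normr_ge0.
have ind B : forall z : Z, 0 <= \1_B z :> R by move=> z; rewrite indicE.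
have mi (g : Z -> R) a b s t : measurable_fun setT g ->
    measurable_fun setT (fun z => g z * \1_(obox a b s t) z).
  by move=> mg; apply: measurable_funM => //; apply: measurable_indic; exact: measurable_obox.
have ii (g : Z -> R) a b s t : measurable_fun setT g -> (forall z, 0 <= g z) ->
    (forall z, g z <= `|w z|) ->
    mu.-integrable setT (EFin \o (fun z => g z * \1_(obox a b s t) z)).
  move=> mg g_ge0 gw.
  have iwn : mu.-integrable setT (EFin \o (fun z => `|w z * \1_(obox a b s t) z|)).
    exact: integrable_norm (iw a b s t).
  apply: (le_integrable_EFin (mi g a b s t mg) _ iwn) => z.
  rewrite !normrM (ger0_norm (ind _ z)) (ger0_norm (g_ge0 z)).
  by apply: ler_wpM2r.
have dE (g : Z -> R) (mg : measurable_fun setT g) (g0 : forall z, 0 <= g z) a b s t :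
    density mu mg g0 (obox a b s t) = (\int[mu]_z (g z * \1_(obox a b s t) z)%:E)%E.
  rewrite /density integral_mkcond; apply: eq_integral => z _.
  by rewrite restrict_EFin/= patchE indicE; case: (_ \in _); rewrite ?mulr1 ?mulr0.
have key B : measurable B -> density mu mwp wp0 B = density mu mwn wn0 B.
  apply: (measure_unique oboxes cube).
  - exact: oboxes_generate.
  - exact: oboxes_setI.
  - by move=> k; exists (const_mx (- k%:R)), (const_mx k%:R), (- k%:R), k%:R.
  - exact: cube_cover.
  - move=> _ [a [b [s [t ->]]]].
    suff : density mu mwp wp0 (obox a b s t) = density mu mwn wn0 (obox a b s t) by [].
    rewrite !dE.
    have ip := ii wp a b s t mwp wp0 wpw; have im := ii wn a b s t mwn wn0 wnw.
    have := w0 a b s t; under eq_Rintegral do rewrite wE mulrBl.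
    rewrite RintegralB// => /eqP; rewrite subr_eq0 => /eqP h.
    rewrite -(fineK (integrable_fin_num measurableT ip)).
    rewrite -[RHS](fineK (integrable_fin_num measurableT im)).
    by congr EFin.
  - move=> k; suff : (density mu mwp wp0 (cube k) < +oo)%E by [].
    have ip a b s t := ii wp a b s t mwp wp0 wpw.
    by rewrite /cube dE ltey_eq (integrable_fin_num measurableT (ip _ _ _ _)).
pose A := [set z | 0 < w z].
have mA : measurable A.
  rewrite -[X in measurable X]setTI.
  have := mw measurableT `]0, +oo[%classic (measurable_itv _).
  by congr (measurable (_ `&` _)); apply/seteqP; split => z /=; rewrite in_itv/= andbT.
have IA : (density mu mwp wp0 A = 0)%E.
  rewrite key//; apply: integral0_eq => z; rewrite /A/= => h.
  by rewrite /wn max_r// oppr_le0 ltW.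
have IT : (density mu mwp wp0 setT = 0)%E.
  rewrite -IA /density [RHS]integral_mkcond; apply: eq_integral => z _.
  rewrite restrict_EFin/= patchE; case: ifPn => //; rewrite notin_setE /A/= => /negP.
  by rewrite -leNgt => h; rewrite /wp max_r.
have IT' : (density mu mwn wn0 setT = 0)%E by rewrite -key.
have h (g : Z -> R) (mg : measurable_fun setT g) (g0 : forall z, 0 <= g z) :
    density mu mg g0 setT = 0%E -> {ae mu, forall z, g z = 0}.
  rewrite /density => hg; have := (ae_eq_integral_abs mu measurableT (f := EFin \o g) _).1.
  case=> //; first exact/measurable_EFinP.
    by rewrite -[RHS]hg; apply: eq_integral => z _ /=; rewrite ger0_norm.
  by move=> N HN; exists N; case: HN => ? ? hN; split => // z hz; apply: hN => /= /(_ I)[]; exact: hz.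
have hp := h _ _ _ IT; have hn := h _ _ _ IT'.
by apply: filterS2 hp hn => z pz nz; rewrite wE pz nz subrr.
Qed.

End boxes.

(** * Uniqueness *)

(** For [s <= 0] both values of [eta] in the Taylor estimate with a negative
    increment vanish. *)
Lemma taylor_vanish (R : realType) (eta eta' : R -> R) (A : R) : 0 <= A ->
  (forall s h, `|eta (s + h) - eta s - h * eta' s| <= A * h ^+ 2) ->
  (forall s, s <= 0 -> eta s = 0) -> forall s, s <= 0 -> eta' s = 0.
Proof.
move=> A0 ht h0 s s0; apply/eqP; rewrite -normr_le0; apply/ler_addgt0Pr => e e0.
have A1 : 0 < A + 1 by rewrite ltr_wpDl.
pose h := - (e / (A + 1)).
have h_lt0 : h < 0 by rewrite oppr_lt0 divr_gt0.
have := ht s h; rewrite h0 ?h0//; last by rewrite -[X in _ <= X]addr0 lerD// ltW.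
rewrite subrr sub0r normrN normrM -[h ^+ 2](@real_normK _ h) ?num_real//.
rewrite expr2 mulrA mulrC ler_pM2r ?normr_gt0 ?ltr0_neq0// => /le_trans; apply.
rewrite add0r /h normrN gtr0_norm ?divr_gt0//.
by rewrite mulrCA ger_pMr// ler_pdivrMr// mul1r lerDl.
Qed.

Section uniqueness.
Context {R : realType} {d : nat}.
Variable nu : {measure set 'rV[R]_d -> \bar R}.
Hypothesis hnu : symmetric_levy_measure nu.
Variable p : 'rV[R]_d -> R.
Hypothesis p_cont : continuous p.
Hypothesis p_gt0 : forall x, 0 < p x.
Hypothesis p_harnack : exists2 C : R, 0 < C & forall x z : 'rV[R]_d,
    enorm (z - x) < 1 -> p z <= C * p x.
Hypothesis p_jump : exists C : R, forall x : 'rV[R]_d,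
    (\int[nu]_(y in [set y : 'rV[R]_d | 1 <= enorm y]%R) (p (x - y)%R)%:E
     <= (C * p x)%:E)%E.
Variables (T : R) (mu0 : ('rV[R]_d -> R) -> R) (u1 u2 : 'rV[R]_d * R -> R).
Hypothesis hu1 : L1loc_L1 T p u1.
Hypothesis hu2 : L1loc_L1 T p u2.
Hypothesis hw1 : very_weak_solution nu T mu0 u1.
Hypothesis hw2 : very_weak_solution nu T mu0 u2.
Local Notation leb := (lebesgue_rV d).
Local Notation Z := ('rV[R]_d * measurableTypeR R)%type.
Local Notation mu := (@spacetime R d).

Section slab.
Variable tau : R.
Hypothesis tauT : 0 < tau < T.

Let omega (z : Z) : R := slab tau u1 z - slab tau u2 z.

Let m1 : measurable_fun setT (slab tau u1).
Proof. by apply: measurable_slab hu1; case/andP: tauT => _ /ltW. Qed.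

Let m2 : measurable_fun setT (slab tau u2).
Proof. by apply: measurable_slab hu2; case/andP: tauT => _ /ltW. Qed.

Let oo1 := mass_slab p_cont p_gt0 tauT hu1.
Let oo2 := mass_slab p_cont p_gt0 tauT hu2.

Let mq : measurable_fun setT (fst : Z -> 'rV[R]_d).
Proof. exact: measurable_fst. Qed.

Let momega : measurable_fun setT omega.
Proof. exact: measurable_funB. Qed.

Let omega_oo : (mass mu fst p omega < +oo)%E.
Proof. exact: massB. Qed.

Let omega_out z : ~~ (0 < z.2 < tau) -> omega z = 0.
Proof. by move=> /negPf h; rewrite /omega /slab h subrr. Qed.

Let mtime (k : R -> R) : measurable_fun setT k -> measurable_fun setT (fun z : Z => k z.2).
Proof. by move=> mk; apply: measurableT_comp => //; exact: measurable_snd. Qed.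

(** The two identities of [weak_slab] for the mollifier [eta (t - s)], seen as a
    function of [s], subtract to the mollified equation that [time_stepping]
    needs.  The truncation at [tau] is harmless because [eta] and its derivative
    vanish at nonpositive times; for the same reason the initial value is 0. *)
Lemma slab_conv_eq0 (c c' eps t : R) (a b x : 'rV[R]_d) : 0 <= c -> 0 <= c' ->
  0 <= t <= tau ->
  conv mu fst (fun z => omega z * bump c' 0 eps (t - z.2)) (bumpV c a b) x = 0.
Proof.
move=> c0 c'0 /andP[t0 tt].
have [g Gg [A A0 h]] := flat_alg_taylor (flat_alg_bump1 c' 0 eps).
set eta := bump c' 0 eps in h *.
have mcont (k : R -> R) : @flat_alg R R k -> measurable_fun setT k.
  by move=> hk; apply: continuous_measurable_fun; exact: flat_alg_continuous hk.
have meta : measurable_fun setT eta by apply: mcont; exact: flat_alg_bump1.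
have mg : measurable_fun setT g by exact: mcont.
have eta_le0 s : s <= 0 -> eta s = 0 by move=> s0; rewrite /eta bump_out//; left.
have g_le0 : forall s, s <= 0 -> g s = 0.
  by apply: (taylor_vanish A0 _ eta_le0) => s k; have [] := h s.
have [r0 [AK hK]] := bumpV_kernel a b c0.
have [r r_ge0 hKr] : exists2 r, 0 <= r & kernel r AK (bumpV c a b).
  exists (Num.max r0 0); first by rewrite le_max lexx orbT.
  case: hK => h1 h2 h3; split => // v hv; apply: h2 => hb; apply: hv.
  by apply: box_le hb; rewrite le_max lexx.
set K := bumpV c a b in hKr hK *.
have mK := kernel_measurable hKr.
have mL := measurable_levy_op hnu hKr.
have eqn s y : s <= tau -> conv mu fst (fun z => omega z * g (s - z.2)) K y =
    - conv mu fst (fun z => omega z * eta (s - z.2)) (levy_op nu K) y.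
  move=> st.
  pose G r := - g (s - r).
  have mG : measurable_fun setT G.
    by apply: measurableT_comp => //; apply: measurableT_comp => //; exact: measurable_funB.
  have GA r1 : `|G r1| <= A by rewrite normrN; have [] := h (s - r1).
  have GE (r1 : R) : is_derive r1 1 (bump c' (s - eps) s) (G r1).
    have -> : bump c' (s - eps) s = eta \o (fun r => s - r).
      by apply/funext => r2 /=; rewrite /eta bump_reflect subr0.
    have [d1 _ _ _ _] := h (s - r1).
    have d2 : is_derive r1 1 (fun r : R => s - r) (- 1).
      have := is_deriveB (is_derive_cst (s : R) r1 (1 : R)) (is_derive_id r1 (1 : R)).
      by rewrite sub0r.
    by have := @is_derive1_comp _ eta (fun r : R => s - r) r1 _ _ d1 d2; rewrite mulrN1.
  have G0 r1 : s <= r1 -> G r1 = 0 by move=> sr; rewrite /G g_le0 ?oppr0// subr_le0.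
  have e1 := weak_slab hnu p_cont p_gt0 p_harnack p_jump a b y tauT st c0 c'0 hu1 hw1 mG GA GE G0.
  have e2 := weak_slab hnu p_cont p_gt0 p_harnack p_jump a b y tauT st c0 c'0 hu2 hw2 mG GA GE G0.
  have dK := dominated_kernel p_gt0 p_harnack y hKr.
  have dL := dominated_levy_op hnu p_cont p_gt0 p_harnack p_jump y hKr.
  pose eta' := bump c' (s - eps) s.
  have meta' : measurable_fun setT eta' by apply: mcont; exact: flat_alg_bump1.
  have etab r1 : `|eta' r1| <= 1 by rewrite ger0_norm ?bump_ge0// bump_le1.
  have fm (v : Z -> R) (k : R -> R) : measurable_fun setT v -> measurable_fun setT k ->
      measurable_fun setT (fun z : Z => v z * k z.2).
    by move=> mv mk; apply: measurable_funM => //; exact: mtime.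
  have foo (v : Z -> R) (k : R -> R) (B : R) : measurable_fun setT v ->
      (mass mu fst p v < +oo)%E ->
      measurable_fun setT k -> (forall r1, `|k r1| <= B) ->
      (mass mu fst p (fun z : Z => (v z * k z.2)%R) < +oo)%E.
    by move=> mv voo mk kB; apply: (mass_mul mq p_cont p_gt0 mv voo (mtime mk) (fun z => kB z.2)).
  have E1 : conv mu fst (fun z => omega z * G z.2) K y =
      conv mu fst (fun z => slab tau u1 z * G z.2) K y - conv mu fst (fun z => slab tau u2 z * G z.2) K y.
    rewrite -(convB mq p_cont p_gt0 (fm _ _ m1 mG) (fm _ _ m2 mG) (foo _ _ _ m1 oo1 mG GA) (foo _ _ _ m2 oo2 mG GA) mK dK).
    by congr (conv _ _ _ _ _); apply/funext => z; rewrite /omega; ring.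
  have E2 : conv mu fst (fun z => omega z * eta' z.2) (levy_op nu K) y =
      conv mu fst (fun z => slab tau u1 z * eta' z.2) (levy_op nu K) y - conv mu fst (fun z => slab tau u2 z * eta' z.2) (levy_op nu K) y.
    rewrite -(convB mq p_cont p_gt0 (fm _ _ m1 meta') (fm _ _ m2 meta') (foo _ _ _ m1 oo1 meta' etab) (foo _ _ _ m2 oo2 meta' etab) mL dL).
    by congr (conv _ _ _ _ _); apply/funext => z; rewrite /omega; ring.
  have -> : conv mu fst (fun z => omega z * eta (s - z.2)) (levy_op nu K) y =
      conv mu fst (fun z => omega z * eta' z.2) (levy_op nu K) y.
    by congr (conv _ _ _ _ _); apply/funext => z; rewrite /eta bump_reflect subr0.
  have -> : conv mu fst (fun z => omega z * g (s - z.2)) K y =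
      - conv mu fst (fun z => omega z * G z.2) K y.
    rewrite -[LHS]opprK; congr (- _).
    rewrite conv.unlock -mulN1r -RintegralZl//; last first.
      apply: (conv_integrable mq p_cont p_gt0 _ _ mK dK).
        apply: measurable_funM => //; apply: (mtime (k := fun r => g (s - r))).
        by apply: measurableT_comp => //; exact: measurable_funB.
      apply: (foo omega (fun r => g (s - r)) A) => //.
        by apply: measurableT_comp => //; exact: measurable_funB.
      by move=> r1; have [] := h (s - r1).
    by apply: eq_Rintegral => z _; rewrite /G; ring.
  rewrite E1 E2; congr (- _).
  by move: e1 e2; rewrite -/K -/eta'; lra.
have init z : omega z * eta (0 - z.2) = 0.
  have [hz|hz] := boolP (0 < z.2 < tau); last by rewrite omega_out ?mul0r.
  by rewrite eta_le0 ?mulr0// sub0r oppr_le0 ltW//; case/andP: hz.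
have hS := time_stepping hnu p_cont p_gt0 p_harnack p_jump mq
  (@measurable_snd _ _ _ _ : measurable_fun setT (snd : Z -> R)) momega omega_oo A0 meta mg
  (fun s => let: And5 _ b1 _ _ _ := h s in b1) (fun s => let: And5 _ _ b2 _ _ := h s in b2)
  (fun s => let: And5 _ _ _ _ b3 := h s in b3) r_ge0 hKr eqn init t0 tt.
apply: (conv_eq0 mq p_cont p_gt0 p_harnack _ _ hKr hS).
  apply: measurable_funM => //; apply: (mtime (k := fun r => eta (t - r))).
  by apply: measurableT_comp => //; exact: measurable_funB.
apply: (mass_mul mq p_cont p_gt0 momega omega_oo (B := A)).
  apply: (mtime (k := fun r => eta (t - r))).
  by apply: measurableT_comp => //; exact: measurable_funB.
by move=> z; have [] := h (t - z.2).
Qed.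


Lemma indic_obox (a b : 'rV[R]_d) (s t : R) (z : Z) :
  \1_(obox a b s t) z =
  [forall i, (a ord0 i < z.1 ord0 i < b ord0 i)%R]%:R * (s < z.2 < t)%R%:R :> R.
Proof.
rewrite indicE -natrM mulnb; congr (_%:R); congr nat_of_bool; apply/idP/andP.
  by rewrite inE => -[h1 h2]; split => //; exact/forallP.
by rewrite inE => -[/forallP h1 h2]; split.
Qed.

Lemma slab_obox_integrable (a b : 'rV[R]_d) (s t : R) :
  mu.-integrable setT (EFin \o (fun z => omega z * \1_(obox a b s t) z)).
Proof.
pose r := \sum_i (`|a ord0 i| + `|b ord0 i|).
have [C C0 hC] := harnack_box p_harnack r.
have p00 := p_gt0 0.
apply: (@le_integrable_EFin _ _ _ _ _ (fun z : Z => C / p 0 * (`|omega z| * p z.1))).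
- by apply: measurable_funM => //; apply: measurable_indic; exact: measurable_obox.
- move=> z; rewrite normrM [X in _ <= X]mulrCA ler_wpM2l// indicE.
  have [|_] := boolP (z \in _); last by rewrite normr0 !mulr_ge0 ?invr_ge0// ltW.
  rewrite inE normr1 => -[hz _]; rewrite mulrAC ler_pdivlMr// mul1r hC// => i.
  rewrite !mxE sub0r normrN /r (bigD1 i)//=.
  apply: ler_wpDr; first by rewrite sumr_ge0// => j _; rewrite addr_ge0.
  have /andP[h1 h2] := hz i.
  rewrite ler_norml; apply/andP; split.
    have := ler_norm (- a ord0 i); rewrite normrN; have := normr_ge0 (b ord0 i); lra.
  have := ler_norm (b ord0 i); have := normr_ge0 (a ord0 i); lra.
- by apply: integrableZl_EFin; apply: (mass_integrable mq p_cont p_gt0 momega omega_oo).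
Qed.

(** Dominated convergence, with bumps increasing to the indicator of the box.  The
    final time [t] is first lowered to [tau], beyond which [omega] vanishes. *)
Lemma slab_obox_eq0 (a b : 'rV[R]_d) (s t : R) :
  \int[mu]_z (omega z * \1_(obox a b s t) z) = 0.
Proof.
pose t' := Num.min t tau.
have -> : (fun z => omega z * \1_(obox a b s t) z) = (fun z => omega z * \1_(obox a b s t') z).
  apply/funext => z; have [/andP[_ hz]|hz] := boolP (0 < z.2 < tau); last first.
    by rewrite omega_out// !mul0r.
  by rewrite !indic_obox lt_min hz andbT.
have t't : t' <= tau by rewrite ge_min lexx orbT.
have [t'0|t'0] := leP 0 t'; last first.
  rewrite (_ : (fun z => _) = cst 0) ?Rintegral_cst ?mul0r//.
  apply/funext => z; have [/andP[hz _]|hz] := boolP (0 < z.2 < tau); last first.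
    by rewrite omega_out// !mul0r.
  by rewrite indic_obox [s < z.2 < t']andbC ltNge (ltW (lt_trans t'0 hz))/= !mulr0.
pose h n (z : Z) := omega z * bump n.+1%:R s t' z.2 * bumpV n.+1%:R a b z.1.
have hE n : \int[mu]_z (h n z) = 0.
  have n0 : (0 : R) <= n.+1%:R by [].
  (* The bumps are reflected at 0 in space and at [t'] in time. *)
  have := @slab_conv_eq0 _ _ (t' - s) t' (- b) (- a) 0 n0 n0.
  rewrite t'0 t't conv.unlock => /(_ isT) <-.
  apply: eq_Rintegral => z _; rewrite bump_reflect bumpV_reflect.
  by rewrite !opprK !add0r subr0 opprB addrC subrK.
have mh n : measurable_fun setT (h n).
  apply: measurable_funM.
    apply: measurable_funM => //; apply: mtime; apply: continuous_measurable_fun.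
    exact: flat_alg_continuous (flat_alg_bump1 _ _ _).
  have [r [A hK]] := bumpV_kernel a b (ler0n R n.+1).
  by apply: (measurableT_comp (kernel_measurable hK)); exact: measurable_fst.
have io := slab_obox_integrable a b s t'.
have hle n z : `|h n z| <= `|omega z * \1_(obox a b s t') z|.
  rewrite /h -mulrA normrM [X in _ <= X]normrM ler_wpM2l// indicE.
  have h0 : 0 <= bump n.+1%:R s t' z.2 * bumpV n.+1%:R a b z.1.
    by apply: mulr_ge0; [exact: bump_ge0|exact: bumpV_ge0].
  rewrite (ger0_norm h0).
  have [_|hz] := boolP (z \in obox a b s t').
    by rewrite normr1 mulr_ile1 ?bump_ge0 ?bumpV_ge0 ?bump_le1 ?bumpV_le1.
  rewrite normr0; have [h1|h1] := pselect (forall i, a ord0 i < z.1 ord0 i < b ord0 i).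
    rewrite bump_out ?mul0r//; apply/orP; rewrite !leNgt -negb_and.
    by apply: contra hz => h2; rewrite inE.
  by rewrite [X in _ * X]bumpV_out ?mulr0.
have [|||||_ _] := @dominated_convergence _ _ _ mu setT measurableT (fun n => EFin \o h n)
  (EFin \o (fun z => omega z * \1_(obox a b s t') z))
  (EFin \o (fun z => `|omega z * \1_(obox a b s t') z|)).
- by move=> n; exact/measurable_EFinP.
- exact: measurable_int io.
- apply: aeW => z _; apply: cvg_EFin; first exact: nearW.
  rewrite (_ : fine \o _ = h ^~ z)//.
  rewrite indic_obox mulrCA mulrC; apply: cvgM; last exact: bumpV_cvg.
  by apply: cvgM; [exact: cvg_cst|exact: bump_cvg].
- by apply: integrable_norm io.
- by apply: aeW => z n _ /=; rewrite lee_fin hle.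
have E n : (\int[mu]_z (EFin \o h n) z = 0)%E.
  have ih : mu.-integrable setT (EFin \o h n).
    exact: le_integrable_EFin (mh n) (hle n) (integrable_norm io).
  by rewrite -(fineK (integrable_fin_num measurableT ih)) -[fine _]/(\int[mu]_z (h n z)) hE.
under eq_fun do rewrite E.
by move=> /cvg_lim lim0; rewrite /Rintegral -[X in fine X]lim0// lim_cst.
Qed.

Lemma slab_ae_eq : {ae mu, forall z, slab tau u1 z = slab tau u2 z}.
Proof.
have h := ae_eq0_of_oboxes momega slab_obox_integrable slab_obox_eq0.
by apply: filterS h => z /eqP; rewrite subr_eq0 => /eqP.
Qed.

End slab.

(** The times [T * (1 - n.+2%:R^-1)] exhaust the interval from 0 to [T]. *)
Lemma ae_eq_spacetime : {ae mu, forall z : Z, 0 < z.2 < T -> u1 z = u2 z}.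
Proof.
have [T0|T0] := leP T 0.
  by apply: aeW => z /andP[h1 /(lt_trans h1)]; rewrite ltNge T0.
have h n : {ae mu, forall z, slab (T * (1 - n.+2%:R^-1)) u1 z = slab (T * (1 - n.+2%:R^-1)) u2 z}.
  apply: slab_ae_eq; have n1 : n.+2%:R^-1 < 1 :> R by rewrite invf_lt1// ltr1n.
  by rewrite mulr_gt0 ?subr_gt0//= gtr_pMr// gtrDl oppr_lt0 invr_gt0.
have := ae_foralln h; apply: filterS => z hz /andP[z0 zT].
have e0 : 0 < 1 - z.2 / T by rewrite subr_gt0 ltr_pdivrMr// mul1r.
have [N _ hN] := near_infty_natSinv_lt (PosNum e0).
have := hz N; have := hN N.+1 (leqW (leqnn N)) => /= hlt.
rewrite /slab; have -> // : 0 < z.2 < T * (1 - N.+2%:R^-1).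
by rewrite z0/= mulrC -ltr_pdivrMr// ltrBrDr addrC -ltrBrDr.
Qed.

End uniqueness.

Theorem theorem4p5 (R : realType) (d : nat) (hd : (0 < d)%N)
  (nu : {measure set 'rV[R]_d -> \bar R}) (hnu : symmetric_levy_measure nu)
  (T : R) (hT : 0 < T)
  (P : R -> 'rV[R]_d -> R) (hP : heat_kernel nu P)
  (hP1 : forall t : R, 0 < t -> continuous (P t) /\ forall x : 'rV[R]_d, 0 < P t x)
  (hP2 : exists C : R, forall x : 'rV[R]_d,
    (\int[nu]_(y in [set y : 'rV[R]_d | 1 <= enorm y]%R) (P 1%R (x - y)%R)%:E
     <= (C * P 1%R x)%:E)%E)
  (hP3 : forall eps tau : R, 0 < eps -> eps < tau ->
    exists2 C : R, 1 < C & forall (x : 'rV[R]_d) (t s : R),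
      eps <= t <= tau -> eps <= s <= tau ->
      C^-1 * P t x <= P s x <= C * P t x)
  (hP4 : exists2 C : R, 0 < C & forall x z : 'rV[R]_d,
    enorm (z - x) < 1 -> P 1 z <= C * P 1 x)
  (mu0 : ('rV[R]_d -> R) -> R) (hmu0 : signed_radon_measure mu0)
  (u1 u2 : 'rV[R]_d * R -> R)
  (hu1 : L1loc_L1 T (P 1) u1) (hu2 : L1loc_L1 T (P 1) u2)
  (hw1 : very_weak_solution nu T mu0 u1)
  (hw2 : very_weak_solution nu T mu0 u2) :
  {ae (lebesgue_rV d \x lebesgue_measure)%E, forall z : 'rV[R]_d * R,
    0 < z.2 < T -> u1 z = u2 z}.
Proof.
have [p_cont p_gt0] := hP1 1 ltr01.
exact: ae_eq_spacetime hnu _ p_cont p_gt0 hP4 hP2 _ mu0 _ _ hu1 hu2 hw1 hw2.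
Qed.
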